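(* Proper-MLCM-P can be solved in polynomial time on all instances $(G,L)$ whose lines admit consistent directions.
   Context: An instance $(G,L)$ consists of a graph $G=(V,E)$ embedded in the plane and a set $L$ of simple paths in $G$ (lines). The endpoints of a line are its terminals, the other vertices its intermediate stations. For an edge $(u,v)$, $L_{uv}$ is the set of lines containing it. Each vertex is a polygon with one side (port) per incident edge, in embedding order. A line layout specifies for every edge $(u,v)$ linear orders $\pi_{uv},\pi_{vu}$ of $L_{uv}$, $\pi_{uv}$ being the clockwise order (w.r.t. the center of $u$'s polygon) in which lines attach to the port of $u$ for $(u,v)$. Lines $l_1,l_2$ have an edge crossing on $(u,v)$ if $l_1$ precedes $l_2$ in both $\pi_{uv}$ and $\pi_{vu}$; with $\pi_u$ the cyclic concatenation of the orders at the ports of $u$ in clockwise order, they have a vertex crossing at $u$ if $\pi_u=(\dots l_1\dots l_2\dots l_1\dots l_2\dots)$. A crossing is unavoidable if it occurs in every layout. A layout is feasible if it has no avoidable vertex crossings; its number of crossings is its number of edge crossings. The order $\pi_{uv}$ satisfies the periphery condition if $\pi_{uv}=(l_1\dots l_p\,l_{p+1}\dots l_{q-1}\,l_q\dots l_m)$ where $u$ is a terminal of $l_1,\dots,l_p,l_q,\dots,l_m$ and an intermediate station of $l_{p+1},\dots,l_{q-1}$. MLCM-P asks for a feasible layout satisfying the periphery condition at every port with the minimum number of crossings. Proper-MLCM-P is MLCM-P restricted to instances in which no line is a subpath of another line. The lines of $(G,L)$ admit consistent directions if each line can be given a direction (orientation of the path) so that for every edge $e\in E$ all lines containing $e$ traverse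 $e$ in the same direction. *)

(* Defs.v *)
From mathcomp Require Import all_boot.

Set Implicit Arguments.
Unset Strict Implicit.
Unset Printing Implicit Defensive.

(* The machine model is an imperative language over binary trees (the WHILE
   language of N. Jones).  Unlike in Jones' unit-cost semantics, evaluating an
   expression costs the sum of the sizes, as trees without sharing, of the
   values of all its subexpressions; hence a run of cost t is simulated by a
   multitape Turing machine in time polynomial in t, and conversely. *)

Inductive tree : Type := Leaf | Node of tree & tree.

Fixpoint tsize (x : tree) : nat :=
  if x is Node l r then (tsize l + tsize r).+1 else 1.

Fixpoint tree_eqb (x y : tree) : bool :=
  match x, y with
  | Leaf, Leaf => true
  | Node a b, Node c d => tree_eqb a c && tree_eqb b d
  | _, _ => false
  end.

Definition thd (x : tree) : tree := if x is Node l _ then l else Leaf.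
Definition ttl (x : tree) : tree := if x is Node _ r then r else Leaf.
Definition truthy (x : tree) : bool := if x is Leaf then false else true.
Definition of_bool (b : bool) : tree := if b then Node Leaf Leaf else Leaf.

Inductive expr : Type :=
  | EVar of nat
  | ELeaf
  | ENode of expr & expr
  | EHd of expr
  | ETl of expr
  | EEq of expr & expr.

Inductive cmd : Type :=
  | CSkip
  | CAssign of nat & expr
  | CSeq of cmd & cmd
  | CIf of expr & cmd & cmd
  | CWhile of expr & cmd.

Definition store : Type := nat -> tree.

Definition update (s : store) (x : nat) (v : tree) : store :=
  fun y => if y == x then v else s y.

Fixpoint eval (s : store) (e : expr) : tree :=
  match e with
  | EVar x => s x
  | ELeaf => Leaf
  | ENode a b => Node (eval s a) (eval s b)
  | EHd a => thd (eval s a)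
  | ETl a => ttl (eval s a)
  | EEq a b => of_bool (tree_eqb (eval s a) (eval s b))
  end.

Fixpoint ecost (s : store) (e : expr) : nat :=
  tsize (eval s e) +
  match e with
  | EVar _ | ELeaf => 0
  | ENode a b | EEq a b => ecost s a + ecost s b
  | EHd a | ETl a => ecost s a
  end.

(* [exec c s s' t]: started in store [s], the command [c] terminates in store
   [s'] at cost [t]. *)
Inductive exec : cmd -> store -> store -> nat -> Prop :=
  | ExSkip s : exec CSkip s s 1
  | ExAssign s x e :
      exec (CAssign x e) s (update s x (eval s e)) (ecost s e).+1
  | ExSeq c1 c2 s1 s2 s3 t1 t2 :
      exec c1 s1 s2 t1 -> exec c2 s2 s3 t2 ->
      exec (CSeq c1 c2) s1 s3 (t1 + t2).+1
  | ExIf e c1 c2 s s' t :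
      exec (if truthy (eval s e) then c1 else c2) s s' t ->
      exec (CIf e c1 c2) s s' (ecost s e + t).+1
  | ExWhileStop e c s :
      ~~ truthy (eval s e) ->
      exec (CWhile e c) s s (ecost s e).+1
  | ExWhileStep e c s1 s2 s3 t1 t2 :
      truthy (eval s1 e) ->
      exec c s1 s2 t1 -> exec (CWhile e c) s2 s3 t2 ->
      exec (CWhile e c) s1 s3 (ecost s1 e + t1 + t2).+1.

(* Variable 0 holds the input initially and the output finally. *)
Definition computes_in (c : cmd) (x y : tree) (t : nat) : Prop :=
  exists2 s, exec c (update (fun=> Leaf) 0 x) s t & s 0 = y.

Definition solvable_in_poly_time (X : Type) (Y : X -> Type)
    (codeX : X -> tree) (codeY : forall x, Y x -> tree)
    (dom : X -> Prop) (sol : forall x, Y x -> Prop) : Prop :=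
  exists (c : cmd) (k : nat), forall x, dom x ->
    exists (y : Y x) (t : nat),
      [/\ computes_in c (codeX x) (codeY x y) t,
          t <= k * tsize (codeX x) ^ k + k
        & sol x y].

Definition code_nat (n : nat) : tree := iter n (Node Leaf) Leaf.
Definition code_seq (T : Type) (code : T -> tree) (s : seq T) : tree :=
  foldr (fun x => Node (code x)) Leaf s.
Definition code_ord (n : nat) (i : 'I_n) : tree := code_nat i.

(* A plane embedding is given by its rotation system: [nb u] lists the
   neighbours of [u] in clockwise order.  A dart (u, v) is the edge uv seen
   from u. *)
Section Rotation.
Variables (n : nat) (nb : 'I_n -> seq 'I_n).

Definition darts : {set 'I_n * 'I_n} := [set d | d.2 \in nb d.1].
Definition dart_rev (d : 'I_n * 'I_n) := (d.2, d.1).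
Definition dart_turn (d : 'I_n * 'I_n) := (d.1, next (nb d.1) d.2).
Definition dart_face (d : 'I_n * 'I_n) := dart_turn (dart_rev d).
Definition dart_link : rel ('I_n * 'I_n) :=
  [rel d d' | (dart_rev d == d') || (dart_turn d == d')].

(* Euler's formula E + V + F = 2E + 2C, isolated vertices being left out of
   both V and C.  As each component has nonnegative genus, it says that every
   component has genus 0. *)
Definition genus0 : Prop :=
  fcard dart_rev darts + fcard dart_turn darts + fcard dart_face darts
  = #|darts| + 2 * n_comp dart_link darts.
End Rotation.

Record plane_graph : Type := PlaneGraph {
  nv : nat;
  nbrs : 'I_nv -> seq 'I_nv;
  nbrs_uniq : forall u, uniq (nbrs u);
  nbrs_irrefl : forall u, u \notin nbrs u;
  nbrs_sym : forall u v, (v \in nbrs u) = (u \in nbrs v);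
  nbrs_planar : genus0 nbrs
}.

Definition adj (G : plane_graph) : rel 'I_(nv G) := [rel u v | v \in nbrs u].

(* A path is represented by either of its two vertex sequences. *)
Definition simple_path (G : plane_graph) (p : seq 'I_(nv G)) : bool :=
  [&& p != [::], uniq p & sorted (@adj G) p].

Definition same_path (T : eqType) (p q : seq T) : bool :=
  (p == q) || (p == rev q).

Definition subpath (T : eqType) (p q : seq T) : bool :=
  infix p q || infix (rev p) q.

Record instance : Type := Instance {
  graph :> plane_graph;
  nl : nat;
  line : 'I_nl -> seq 'I_(nv graph);
  line_simple : forall l, simple_path (line l);
  line_inj : forall l l', same_path (line l) (line l') -> l = l'
}.

Section Layouts.
Variable I : instance.
Implicit Types (u v : 'I_(nv I)) (l : 'I_(nl I)).

Definition terminal l u : bool :=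
  (head u (line l) == u) || (last u (line l) == u).

Definition intermediate l u : bool := (u \in line l) && ~~ terminal l u.

Definition lines_on u v : {set 'I_(nl I)} :=
  [set l | subpath [:: u; v] (line l)].

(* [pi u v] is the clockwise order at the port of [u] for the edge (u, v);
   its value is irrelevant when u and v are not adjacent. *)
Definition layout : Type := 'I_(nv I) -> 'I_(nv I) -> seq 'I_(nl I).
Implicit Types pi : layout.

Definition is_layout pi : Prop :=
  forall u v, adj u v -> uniq (pi u v) /\ pi u v =i lines_on u v.

Definition precedes (s : seq 'I_(nl I)) l1 l2 : bool := subseq [:: l1; l2] s.

(* An unordered pair of lines crossing on an edge is counted once, since only
   one of its orderings (l1, l2) satisfies [edge_cross]. *)
Definition edge_cross pi u v l1 l2 : bool :=
  precedes (pi u v) l1 l2 && precedes (pi v u) l1 l2.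

Definition crossings pi : nat :=
  \sum_u \sum_(v | adj u v && (u < v))
    #|[set l : 'I_(nl I) * 'I_(nl I) | edge_cross pi u v l.1 l.2]|.

Definition around pi u : seq 'I_(nl I) := flatten [seq pi u v | v <- nbrs u].

Definition vertex_cross pi u l1 l2 : Prop :=
  exists k, subseq [:: l1; l2; l1; l2] (rot k (around pi u)).

Definition unavoidable u l1 l2 : Prop :=
  forall pi, is_layout pi -> vertex_cross pi u l1 l2.

Definition feasible pi : Prop :=
  is_layout pi /\
  forall u l1 l2, vertex_cross pi u l1 l2 -> unavoidable u l1 l2.

Definition periphery pi u v : Prop :=
  exists s1 s2 s3,
    [/\ pi u v = s1 ++ s2 ++ s3,
        {in s1, forall l, terminal l u},
        {in s2, forall l, intermediate l u}
      & {in s3, forall l, terminal l u}].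

Definition MLCM_P_admissible pi : Prop :=
  feasible pi /\ forall u v, adj u v -> periphery pi u v.

Definition MLCM_P_solution pi : Prop :=
  MLCM_P_admissible pi /\
  forall pi', MLCM_P_admissible pi' -> crossings pi <= crossings pi'.

Definition proper_instance : Prop :=
  forall l l', l != l' -> ~~ subpath (line l) (line l').

Definition directed (d : 'I_(nl I) -> bool) l : seq 'I_(nv I) :=
  if d l then rev (line l) else line l.

Definition consistently_directable : Prop :=
  exists d, forall u v, adj u v ->
    {in lines_on u v &, forall l l',
      infix [:: u; v] (directed d l) = infix [:: u; v] (directed d l')}.
End Layouts.

(* Vertices and lines are numbered in unary.  As the input contains one list
   per vertex and per line, its size is polynomially related to the size of
   an encoding with binary numbers. *)
Definition code_instance (I : instance) : tree :=
  Node (code_seq (fun u : 'I_(nv I) => code_seq (@code_ord (nv I)) (nbrs u))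
          (enum 'I_(nv I)))
       (code_seq (fun l : 'I_(nl I) => code_seq (@code_ord (nv I)) (line l))
          (enum 'I_(nl I))).

(* The orders at the ports of each vertex, in the order of [nbrs]. *)
Definition code_layout (I : instance) (pi : layout I) : tree :=
  code_seq
    (fun u : 'I_(nv I) =>
       code_seq (fun v => code_seq (@code_ord (nl I)) (pi u v)) (nbrs u))
    (enum 'I_(nv I)).

(* Main.v *)
Require Import Defs.
From mathcomp Require Import all_boot.
From mathcomp Require Import zify.

(* At every port give each line a key: the number of ports passed when turning
   clockwise from that port to the other edge of the line, or, for a line that
   ends, one of the two extreme values according to the side chosen for it.
   Admissible layouts are sorted by decreasing key at both ends of a maximal common
   subpath of two lines, hence these lines cross there if the keys compare in the
   same way at both ends.  As no line is a subpath of another, each line ends at at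
   most one end of the subpath, so this condition reads: the side of one line (or a
   constant) is 1 and the side of the other (or a constant) is 0.  Minimising the
   number of such crossings is therefore a minimum cut problem.  It is solved by
   reversing the arcs of paths from source to sink as long as there are any, which
   decreases all cuts by one.  Finally, consistent directions allow sorting the
   lines on each edge by where they come from, so that no further crossings occur. *)

Set Implicit Arguments.
Unset Strict Implicit.
Unset Printing Implicit Defensive.

Local Notation tsize := Defs.tsize.

(** * Polynomial-time programs on trees *)

(** The optimum is sandwiched: for every choice [x] of sides the sorted layout has at most
    [cost D x] crossings, and every admissible layout [pi] has at least [cost D (sides pi)], so
    minimising [cost] over sides is enough. The lower bound cannot be local, because a layout may
    put a forced crossing on any edge of the common subpath; hence the amortisation along it.
    Feasibility, which quantifies over all layouts, is replaced by two rules for lines sharing a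
    port: they are sorted by key if they leave by different edges, and stay nested if they leave by
    the same one. Properness keeps the two sides of one line out of the same condition; a
    conjunction of three or four literals would not be an arc of a cut. The directions are not part
    of the input: they are recomputed by grouping the darts that must be traversed alike. No program
    is written as a whole: polynomial time is closed under list combinators, through which recursive
    definitions are restated, and each loop comes with a bound on its intermediate values. *)

Definition poly_bounded (f : nat -> nat) : Prop :=
  exists k, forall n, f n <= (n + k) ^ k.

Lemma expn_add_mono k k' n : k <= k' -> 0 < k' -> (n + k) ^ k <= (n + k') ^ k'.
Proof.
move=> le_kk' k'_gt0; apply: (@leq_trans ((n + k') ^ k)).
  by have [->//|k_gt0] := posnP k; rewrite leq_exp2r// leq_add2l.
by rewrite leq_pexp2l//; lia.
Qed.

Lemma poly_boundedW f g :
  (forall n, f n <= g n) -> poly_bounded g -> poly_bounded f.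
Proof. by move=> fg [k gk]; exists k => n; apply: leq_trans (fg n) (gk n). Qed.

Lemma poly_id : poly_bounded id.
Proof. by exists 1 => n; rewrite expn1 leq_addr. Qed.

Lemma poly_const m : poly_bounded (fun=> m).
Proof.
exists m.+1 => n; apply: (@leq_trans ((n + m.+1) ^ 1)).
  by rewrite expn1; lia.
by rewrite leq_pexp2l//; lia.
Qed.

Lemma poly_mul f g :
  poly_bounded f -> poly_bounded g -> poly_bounded (fun n => f n * g n).
Proof.
move=> [k fk] [l gl]; exists (k + l).+1 => n.
apply: leq_trans (leq_mul (fk n) (gl n)) _.
apply: (@leq_trans ((n + (k + l).+1) ^ k * (n + (k + l).+1) ^ l)).
  by apply: leq_mul; [case: k {fk} => // k|case: l {gl} => // l];
     rewrite leq_exp2r//; lia.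
by rewrite -expnD leq_pexp2l//; lia.
Qed.

Lemma poly_add f g :
  poly_bounded f -> poly_bounded g -> poly_bounded (fun n => f n + g n).
Proof.
move=> pf pg; have pS h : poly_bounded h -> poly_bounded (fun n => (h n).+1).
  move=> [k hk]; exists k.+2 => n; apply: (@leq_ltn_trans ((n + k) ^ k)) => //.
  have le : (n + k) ^ k <= (n + k.+2) ^ k.
    by case: (k) => // k'; rewrite leq_exp2r//; lia.
  have: 0 < (n + k.+2) ^ k by rewrite expn_gt0; apply/orP; left; lia.
  by rewrite !expnS; nia.
(* [f n + g n <= (f n).+1 * (g n).+1] reduces sums to products. *)
apply: poly_boundedW (poly_mul (pS _ pf) (pS _ pg)) => n.
by nia.
Qed.

Lemma poly_comp f g :
  poly_bounded f -> poly_bounded g -> poly_bounded (fun n => f (g n)).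
Proof.
move=> [k fk] /poly_add/(_ (poly_const k)) [l gl].
have : poly_bounded (fun n => (n + l) ^ (l * k)).
  exists (l * k + l).+1 => n; apply: (@leq_trans ((n + (l * k + l).+1) ^ (l * k))).
    have [->//|?] := posnP (l * k); rewrite leq_exp2r//; lia.
  by rewrite leq_pexp2l//; lia.
apply: poly_boundedW => n; apply: leq_trans (fk _) _.
rewrite expnM; have [->//|k_gt0] := posnP k.
by rewrite leq_exp2r//; apply: gl.
Qed.

Lemma poly_exp k : poly_bounded (fun n => (n + k) ^ k).
Proof. by exists k. Qed.

Lemma leq_expn_add m n k : m <= n -> (m + k) ^ k <= (n + k) ^ k.
Proof. by case: k => // k le_mn; rewrite leq_exp2r// leq_add2r. Qed.

Lemma tsize_gt0 x : 0 < tsize x. Proof. by case: x. Qed.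

Lemma tree_eqbP x y : reflect (x = y) (tree_eqb x y).
Proof.
apply: (iffP idP) => [|<-]; last by elim: x => //= a -> b ->.
elim: x y => [|a IHa b IHb] [|c d] //= /andP[/IHa-> /IHb->] //.
Qed.

Fixpoint only_var0 (e : expr) : bool :=
  match e with
  | EVar x => x == 0
  | ELeaf => true
  | ENode a b | EEq a b => only_var0 a && only_var0 b
  | EHd a | ETl a => only_var0 a
  end.

Lemma tsize_of_bool b : tsize (of_bool b) <= 3. Proof. by case: b. Qed.
Lemma tsize_thd x : tsize (thd x) <= tsize x. Proof. by case: x => //= *; lia. Qed.
Lemma tsize_ttl x : tsize (ttl x) <= tsize x. Proof. by case: x => //= *; lia. Qed.

(** A fixed expression copies variable 0 a bounded number of times. The size of the value is bounded
    along with the cost because the value of an enclosing node contains it. *)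
Lemma ecost_linear e : only_var0 e ->
  exists k, forall s, ecost s e + tsize (eval s e) <= k * tsize (s 0).
Proof.
elim: e => [x /eqP->| |a IHa b IHb /andP[/IHa[k ka] /IHb[l lb]]
  |a IHa /IHa[k ka]|a IHa /IHa[k ka]|a IHa b IHb /andP[/IHa[k ka] /IHb[l lb]]].
- by exists 2 => s /=; lia.
- by exists 2 => s /=; have := tsize_gt0 (s 0); lia.
- exists (k * 2 + l * 2 + 2) => s /=.
  by have := tsize_gt0 (s 0); have := ka s; have := lb s; nia.
- exists (k * 2) => s /=; have := ka s; have := tsize_thd (eval s a); nia.
- exists (k * 2) => s /=; have := ka s; have := tsize_ttl (eval s a); nia.
- exists (k + l + 6) => s /=; have := ka s; have := lb s.
  have := tsize_of_bool (tree_eqb (eval s a) (eval s b)).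
  by have := tsize_gt0 (s 0); nia.
Qed.

(* All data sit in variable 0.  The bystander [r] is a stack of pending values,
   so that commands can be run one after the other on parts of the data. *)
Definition poly_time (X : Type) (c h : X -> tree) : Prop :=
  exists (p : cmd) (k : nat), forall x r s, s 0 = Node (c x) r ->
    exists s' t, [/\ exec p s s' t, s' 0 = Node (h x) r,
      t <= (tsize (c x) + tsize r + k) ^ k
    & tsize (h x) <= (tsize (c x) + k) ^ k].

Lemma poly_timeI X (c h : X -> tree) p f g :
  poly_bounded f -> poly_bounded g ->
  (forall x r s, s 0 = Node (c x) r -> exists s' t, [/\ exec p s s' t,
     s' 0 = Node (h x) r, t <= f (tsize (c x) + tsize r)
   & tsize (h x) <= g (tsize (c x))]) -> poly_time c h.
Proof.
move=> [k fk] [l gl] H; exists p, (k + l).+1 => x r s s0.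
have [s' [t [ex s'0 le_t le_h]]] := H x r s s0.
exists s', t; split=> //.
  by apply: leq_trans (leq_trans le_t (fk _)) _; apply: expn_add_mono; lia.
by apply: leq_trans (leq_trans le_h (gl _)) _; apply: expn_add_mono; lia.
Qed.

Lemma poly_time_expr X (c h : X -> tree) e :
  only_var0 e ->
  (forall x r s, s 0 = Node (c x) r -> eval s e = Node (h x) r) ->
  poly_time c h.
Proof.
move=> /ecost_linear[k ek] H.
apply: (@poly_timeI X c h (CAssign 0 e) (fun n => (k * n.+1).+1)
          (fun n => k * n.+2)).
- apply: (@poly_boundedW _ (fun n => k * n + k.+1)) => [n|]; first by lia.
  exact: poly_add (poly_mul (poly_const _) poly_id) (poly_const _).
- apply: (@poly_boundedW _ (fun n => k * n + k * 2)) => [n|]; first by lia.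
  exact: poly_add (poly_mul (poly_const _) poly_id) (poly_const _).
move=> x r s s0; exists (update s 0 (eval s e)), (ecost s e).+1.
split; first exact: ExAssign; first by rewrite /update eqxx (H x r).
  by have := ek s; rewrite s0 /= ; nia.
(* The size of [h x] must be bounded without [r], so the expression is evaluated once more with an
   empty stack. *)
have := ek (update s 0 (Node (c x) Leaf)); rewrite /update eqxx /=.
by rewrite (H x Leaf) ?eqxx//= addn1; nia.
Qed.

Ltac by_expr e :=
  apply: (@poly_time_expr _ _ _ e) => // ? ? ? /= ->.

Lemma pt_refl X (c : X -> tree) : poly_time c c.
Proof. by by_expr (EVar 0). Qed.

Lemma pt_trans X (d c h : X -> tree) :
  poly_time c d -> poly_time d h -> poly_time c h.
Proof.
move=> [p [k Hp]] [q [l Hq]].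
apply: (@poly_timeI X c h (CSeq p q)
  (fun n => (n + k) ^ k + ((n + k) ^ k + n + l) ^ l + 1)
  (fun n => ((n + k) ^ k + l) ^ l)).
- apply: poly_add (poly_const _); apply: poly_add (poly_exp _) _.
  exact: poly_comp (poly_exp l) (poly_add (poly_exp k) poly_id).
- exact: poly_comp (poly_exp l) (poly_exp k).
move=> x r s /Hp[s1 [t1 [ex1 s10 le1 sz1]]].
have [s2 [t2 [ex2 s20 le2 sz2]]] := Hq _ _ _ s10.
exists s2, (t1 + t2).+1; split=> //; first exact: ExSeq ex1 ex2.
  rewrite addn1 ltnS leq_add//; apply: leq_trans le2 _.
  apply: leq_expn_add; apply: leq_add; last by lia.
  by apply: leq_trans sz1 _; apply: leq_expn_add; lia.
by apply: leq_trans sz2 _; apply: leq_expn_add.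
Qed.

Lemma pt_reindex X Y (f : Y -> X) (c h : X -> tree) :
  poly_time c h -> poly_time (c \o f) (h \o f).
Proof. by move=> [p [k H]]; exists p, k => y; apply: H. Qed.

Lemma pt_ext X (c h g : X -> tree) : h =1 g -> poly_time c h -> poly_time c g.
Proof.
move=> hg [p [k H]]; exists p, k => x r s /H[s' [t]].
by rewrite hg => ?; exists s', t.
Qed.

Lemma pt_cst X (c : X -> tree) (a : tree) : poly_time c (fun=> a).
Proof.
have [e [e0 ee]] : exists e, only_var0 e /\ forall s, eval s e = a.
  elim: a => [|a [e [? e1]] b [f [? f1]]]; first by exists ELeaf.
  by exists (ENode e f) => /=; split=> [|s]; [apply/andP|rewrite e1 f1].
apply: (@poly_time_expr _ _ _ (ENode e (ETl (EVar 0)))) => [|x r s s0] /=.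
  by rewrite e0.
by rewrite ee s0.
Qed.

(** The component [d x] is pushed on the stack, which the program for [h] returns intact, and popped
    afterwards. *)
Lemma pt_frame X (c h d : X -> tree) : poly_time c h ->
  poly_time (fun x => Node (c x) (d x)) (fun x => Node (h x) (d x)).
Proof.
move=> [p [k Hp]].
pose e1 := ENode (EHd (EHd (EVar 0))) (ENode (ETl (EHd (EVar 0))) (ETl (EVar 0))).
pose e2 := ENode (ENode (EHd (EVar 0)) (EHd (ETl (EVar 0)))) (ETl (ETl (EVar 0))).
have [//|m1 Hm1] := @ecost_linear e1; have [//|m2 Hm2] := @ecost_linear e2.
pose b n := (n + k) ^ k.
apply: (@poly_timeI _ _ _ (CSeq (CAssign 0 e1) (CSeq p (CAssign 0 e2)))
  (fun n => m1 * n.+1 + b n + m2 * (b n + n + 2) + 5) (fun n => b n + n + 1)).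
- apply: poly_add (poly_const _); apply: poly_add.
    apply: poly_add (poly_exp k); apply: poly_mul (poly_const _) _.
    by apply: poly_boundedW (poly_add poly_id (poly_const 1)) => n; lia.
  apply: poly_mul (poly_const _) (poly_add _ (poly_const _)).
  exact: poly_add (poly_exp k) poly_id.
- exact: poly_add (poly_add (poly_exp k) poly_id) (poly_const _).
move=> x r s s0.
have [|s1 [t [ex s10 le_t sz]]] :=
  Hp x (Node (d x) r) (update s 0 (eval s e1)).
  by rewrite /update eqxx /= s0.
set N := tsize _ + tsize r.
have bN : tsize (h x) <= b N.
  by apply: leq_trans sz _; apply: leq_expn_add; rewrite /N /=; lia.
exists (update s1 0 (eval s1 e2)).
exists ((ecost s e1).+1 + (t + (ecost s1 e2).+1).+1).+1; split.
- by apply: ExSeq (ExAssign _ _ _) (ExSeq ex (ExAssign _ _ _)).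
- by rewrite /update eqxx /= s10.
- have: t <= b N.
    by apply: leq_trans le_t _; apply: leq_expn_add; rewrite /N /=; lia.
  have := Hm1 s; have := Hm2 s1.
  have -> : tsize (s 0) = N.+1 by rewrite s0.
  have : tsize (s1 0) <= b N + N + 2 by rewrite s10 /=; move: bN; rewrite /N /=; lia.
  by move: (ecost s e1) (ecost s1 e2) => *; nia.
have : (tsize (c x) + k) ^ k <= b (tsize (Node (c x) (d x))).
  by apply: leq_expn_add => /=; lia.
by move: sz => /=; lia.
Qed.

Lemma pt_swap X (c d : X -> tree) :
  poly_time (fun x => Node (c x) (d x)) (fun x => Node (d x) (c x)).
Proof.
by by_expr (ENode (ENode (ETl (EHd (EVar 0))) (EHd (EHd (EVar 0)))) (ETl (EVar 0))).
Qed.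

Lemma pt_fst X (c d : X -> tree) : poly_time (fun x => Node (c x) (d x)) c.
Proof. by by_expr (ENode (EHd (EHd (EVar 0))) (ETl (EVar 0))). Qed.

Lemma pt_snd X (c d : X -> tree) : poly_time (fun x => Node (c x) (d x)) d.
Proof. by by_expr (ENode (ETl (EHd (EVar 0))) (ETl (EVar 0))). Qed.

Lemma pt_pair X (c h g : X -> tree) : poly_time c h -> poly_time c g ->
  poly_time c (fun x => Node (h x) (g x)).
Proof.
move=> ch cg; apply: (@pt_trans _ (fun x => Node (c x) (c x))).
  by by_expr (ENode (ENode (EHd (EVar 0)) (EHd (EVar 0))) (ETl (EVar 0))).
apply: pt_trans (pt_frame _ cg) _; apply: pt_trans (pt_swap _ _) _.
exact: pt_frame ch.
Qed.

Lemma pt_thd X (c h : X -> tree) :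
  poly_time c h -> poly_time c (fun x => thd (h x)).
Proof.
by move=> ch; apply: pt_trans ch _; by_expr (ENode (EHd (EHd (EVar 0))) (ETl (EVar 0))).
Qed.

Lemma pt_ttl X (c h : X -> tree) :
  poly_time c h -> poly_time c (fun x => ttl (h x)).
Proof.
by move=> ch; apply: pt_trans ch _; by_expr (ENode (ETl (EHd (EVar 0))) (ETl (EVar 0))).
Qed.

Lemma pt_tree_eqb X (c h g : X -> tree) : poly_time c h -> poly_time c g ->
  poly_time c (fun x => of_bool (tree_eqb (h x) (g x))).
Proof.
move=> ch cg; apply: pt_trans (pt_pair ch cg) _.
by by_expr (ENode (EEq (EHd (EHd (EVar 0))) (ETl (EHd (EVar 0)))) (ETl (EVar 0))).
Qed.

Lemma pt_if_tree X (c h g b : X -> tree) :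
  poly_time c b -> poly_time c h -> poly_time c g ->
  poly_time c (fun x => if truthy (b x) then h x else g x).
Proof.
move=> cb [p [k Hp]] [q [l Hq]].
apply: pt_trans (pt_pair cb (pt_refl c)) _.
pose e := ENode (ETl (EHd (EVar 0))) (ETl (EVar 0)); pose e' := EHd (EHd (EVar 0)).
have [//|m Hm] := @ecost_linear e; have [//|m' Hm'] := @ecost_linear e'.
pose asg := CSeq (CAssign 0 e).
pose B n := (n + k) ^ k + (n + l) ^ l.
have polyB : poly_bounded B by apply: poly_add (poly_exp _) (poly_exp _).
apply: (@poly_timeI _ _ _ (CIf e' (asg p) (asg q))
  (fun n => m' * (n + 1) + m * (n + 1) + B n + 3) B) => //.
  apply: poly_add (poly_const _); apply: poly_add => //.
  by apply: poly_add; apply: poly_mul (poly_const _) _;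
     apply: poly_add poly_id (poly_const _).
move=> x r s s0; set N := tsize _ + tsize r.
have Ns : tsize (s 0) = N.+1 by rewrite s0.
have eN : ecost s e <= m * (N + 1) by have := Hm s; rewrite Ns addn1; lia.
have e'N : ecost s e' <= m' * (N + 1) by have := Hm' s; rewrite Ns addn1; lia.
pose s1 := update s 0 (eval s e).
have s10 : s1 0 = Node (c x) r by rewrite /s1 /update eqxx /= s0.
have be' : truthy (eval s e') = truthy (b x) by rewrite /= s0.
have lekB n n' : n <= n' -> (n + k) ^ k <= B n'.
  by move=> ?; apply: leq_trans (leq_addr _ _); apply: leq_expn_add.
have lelB n n' : n <= n' -> (n + l) ^ l <= B n'.
  by move=> ?; apply: leq_trans (leq_addl _ _); apply: leq_expn_add.
have leN : tsize (c x) + tsize r <= N by rewrite /N /=; lia.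
case Eb : (truthy (b x)).
  have [s2 [t [ex s20 le_t sz]]] := Hp _ _ _ s10.
  exists s2, (ecost s e' + ((ecost s e).+1 + t).+1).+1; split=> //.
  - apply: ExIf; rewrite be' Eb; exact: ExSeq (ExAssign _ _ _) ex.
  - by have := leq_trans le_t (lekB _ _ leN); lia.
  - by apply: leq_trans sz (lekB _ _ _) => /=; lia.
have [s2 [t [ex s20 le_t sz]]] := Hq _ _ _ s10.
exists s2, (ecost s e' + ((ecost s e).+1 + t).+1).+1; split=> //.
- apply: ExIf; rewrite be' Eb; exact: ExSeq (ExAssign _ _ _) ex.
- by have := leq_trans le_t (lelB _ _ leN); lia.
- by apply: leq_trans sz (lelB _ _ _) => /=; lia.
Qed.

(** * Codings of data types and closure properties of polynomial time *)

Class Code (T : Type) := code : T -> tree.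
#[export] Hint Mode Code ! : typeclass_instances.
#[export] Instance code_nat_inst : Code nat := code_nat.
#[export] Instance code_bool_inst : Code bool := of_bool.
#[export] Instance code_unit_inst : Code unit := fun=> Leaf.
#[export] Instance code_ord_inst n : Code 'I_n := @code_ord n.
#[export] Instance code_seq_inst T {cT : Code T} : Code (seq T) := code_seq code.
#[export] Instance code_prod_inst T U {cT : Code T} {cU : Code U} : Code (T * U) :=
  fun p => Node (code p.1) (code p.2).

Lemma tsize_code_cons T {cT : Code T} x (s : seq T) :
  tsize (code (x :: s)) = (tsize (code x) + tsize (code s)).+1.
Proof. by []. Qed.

Lemma tsize_code_pair T U {cT : Code T} {cU : Code U} (x : T) (y : U) :
  tsize (code (x, y)) = (tsize (code x) + tsize (code y)).+1.
Proof. by []. Qed.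

Lemma size_lt_code T {cT : Code T} (s : seq T) : size s < tsize (code s).
Proof.
elim: s => [|x s IH] //; rewrite tsize_code_cons /= ltnS.
by have := tsize_gt0 (code x); lia.
Qed.

(** Inputs act as contexts: [ext] adds one bound variable, whose type may depend on the earlier
    ones. The body of a [map] or a [foldl] is then a function on the extended context. *)
Definition ext X (Z : X -> Type) {cZ : forall x, Code (Z x)} (c : X -> tree)
    (p : {x & Z x}) : tree :=
  Node (c (tag p)) (code (tagged p)).

Section Context.
Variables (X : Type) (c : X -> tree).

Lemma pt_tag (Z : X -> Type) {cZ : forall x, Code (Z x)} h :
  poly_time c h -> poly_time (ext (Z := Z) c) (fun p => h (tag p)).
Proof. by move=> /(pt_reindex (@tag X Z)); apply: pt_trans; apply: pt_fst. Qed.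

Lemma pt_tagged (Z : X -> Type) {cZ : forall x, Code (Z x)} :
  poly_time (ext (Z := Z) c) (fun p => code (tagged p)).
Proof. exact: pt_snd. Qed.

Lemma pt_const T {cT : Code T} (a : T) : poly_time c (fun=> code a).
Proof. exact: pt_cst. Qed.

Section Constructors.
Variables (A B : X -> Type).
Context {cA : forall x, Code (A x)} {cB : forall x, Code (B x)}.

Lemma pt_mkpair (a : forall x, A x) (b : forall x, B x) :
  poly_time c (fun x => code (a x)) -> poly_time c (fun x => code (b x)) ->
  poly_time c (fun x => code (a x, b x)).
Proof. exact: pt_pair. Qed.

Lemma pt_fst_of (f : forall x, A x * B x) :
  poly_time c (fun x => code (f x)) -> poly_time c (fun x => code (f x).1).
Proof. exact: pt_thd. Qed.

Lemma pt_snd_of (f : forall x, A x * B x) :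
  poly_time c (fun x => code (f x)) -> poly_time c (fun x => code (f x).2).
Proof. exact: pt_ttl. Qed.

Lemma pt_if (b : X -> bool) (f g : forall x, A x) :
  poly_time c (fun x => code (b x)) -> poly_time c (fun x => code (f x)) ->
  poly_time c (fun x => code (g x)) ->
  poly_time c (fun x => code (if b x then f x else g x)).
Proof.
move=> cb cf cg; apply: pt_ext (pt_if_tree cb cf cg) => x.
by rewrite /code /code_bool_inst; case: (b x).
Qed.

Lemma pt_cons (a : forall x, A x) (s : forall x, seq (A x)) :
  poly_time c (fun x => code (a x)) -> poly_time c (fun x => code (s x)) ->
  poly_time c (fun x => code (a x :: s x)).
Proof. exact: pt_pair. Qed.

Lemma pt_behead (s : forall x, seq (A x)) :
  poly_time c (fun x => code (s x)) -> poly_time c (fun x => code (behead (s x))).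
Proof.
by move=> /pt_ttl; apply: pt_ext => x; case: (s x).
Qed.

Lemma pt_head (a : forall x, A x) (s : forall x, seq (A x)) :
  poly_time c (fun x => code (a x)) -> poly_time c (fun x => code (s x)) ->
  poly_time c (fun x => code (head (a x) (s x))).
Proof.
move=> ca cs; apply: pt_ext (pt_if_tree cs (pt_thd cs) ca) => x.
by case: (s x).
Qed.

Lemma pt_nilp (s : forall x, seq (A x)) :
  poly_time c (fun x => code (s x)) -> poly_time c (fun x => code (nilp (s x))).
Proof.
move=> cs.
apply: pt_ext (pt_if_tree cs (pt_const false) (pt_const true)) => x.
by case: (s x).
Qed.

(** Polynomial steps alone are not enough, since an accumulator that doubles in every round
    explodes; hence the bound on all partial folds in terms of the input size. *)
Lemma pt_foldl (s : forall x, seq (B x)) (a : forall x, A x)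
    (f : forall x, A x -> B x -> A x) :
  poly_time c (fun x => code (s x)) -> poly_time c (fun x => code (a x)) ->
  poly_time (ext (Z := fun x => (A x * B x)%type) c)
    (fun p => code (f (tag p) (tagged p).1 (tagged p).2)) ->
  (exists k, forall x s1 s2, s x = s1 ++ s2 ->
     tsize (code (foldl (f x) (a x) s1)) <= (tsize (c x) + k) ^ k) ->
  poly_time c (fun x => code (foldl (f x) (a x) (s x))).
Proof.
move=> cs ca [p [k Hp]] [K HK].
pose (h x := Node (c x) (Node (code (a x)) (code (s x)))).
pose (g x := Node (c x) (Node (code (foldl (f x) (a x) (s x))) Leaf)).
suff : poly_time h g.
  move=> /(pt_trans (pt_pair (pt_refl c) (pt_pair ca cs))) cg.
  by have := pt_thd (pt_ttl cg); apply: pt_ext.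
pose V := EHd (EVar 0); pose R := ETl (EVar 0).
(* [e0] tests whether items remain; [e1] saves the context and the rest of the list on the stack and
   presents context, accumulator and next item to [p]; [e2] reassembles the state with the new
   accumulator. *)
pose e0 := ETl (ETl V).
pose e1 := ENode (ENode (EHd V) (ENode (EHd (ETl V)) (EHd (ETl (ETl V)))))
   (ENode (ENode (EHd V) (ETl (ETl (ETl V)))) R).
pose e2 := ENode (ENode (EHd (EHd R)) (ENode V (ETl (EHd R)))) (ETl R).
have [//|m0 Hm0] := @ecost_linear e0.
have [//|m1 Hm1] := @ecost_linear e1.
have [//|m2 Hm2] := @ecost_linear e2.
pose q n := (n + K) ^ K.
(* [w] bounds the store before and after each call of [p], and [M] the cost of one round; the
   constants are generous. *)
pose w n := 10 * n + q n + 10.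
pose M n := (m0 + m1 + m2) * w n + (w n + k) ^ k + 10.
have pw : poly_bounded w.
  apply: poly_add (poly_const _); apply: poly_add (poly_exp _).
  exact: poly_mul (poly_const _) poly_id.
apply: (@poly_timeI _ _ _
  (CWhile e0 (CSeq (CAssign 0 e1) (CSeq p (CAssign 0 e2))))
  (fun n => (n + 1) * M n) w) => //.
  apply: poly_mul (poly_add poly_id (poly_const _)) _.
  apply: poly_add (poly_const _).
  by apply: poly_add (poly_mul (poly_const _) pw) (poly_comp (poly_exp k) pw).
move=> x r st st0; set n := tsize _ + tsize r.
have nE : (tsize (c x) + (tsize (code (a x)) + tsize (code (s x))).+1).+1 + tsize r = n by [].
have leq_q m : m <= n -> q m <= q n by apply: leq_expn_add.
have szA s1 s2 : s x = s1 ++ s2 ->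
    tsize (code (foldl (f x) (a x) s1)) <= q n.
  by move=> /HK/leq_trans; apply; apply: leq_q; lia.
have loop s2 : forall s1 st, s x = s1 ++ s2 -> tsize (code s2) <= n ->
    st 0 = Node (Node (c x) (Node (code (foldl (f x) (a x) s1)) (code s2))) r ->
    exists st' t, [/\ exec (CWhile e0 (CSeq (CAssign 0 e1) (CSeq p (CAssign 0 e2)))) st st' t,
      st' 0 = Node (g x) r & t <= (size s2 + 1) * M n].
  elim: s2 => [|z s2 IH] s1 {st0}st Es sz2 st0.
    exists st, (ecost st e0).+1; split.
    - by apply: ExWhileStop; rewrite /= st0.
    - by rewrite st0 /g Es cats0.
    have := Hm0 st; have := szA _ _ Es; rewrite st0 /=.
    rewrite /M /w; move: (ecost st e0) => E.
    by have := leq_addr (tsize r) (tsize (h x)); rewrite -/n /h /=; nia.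
  have sz2' : (tsize (code z) + tsize (code s2)).+1 <= n by [].
  pose st1 := update st 0 (eval st e1).
  have st10 : st1 0 = Node (Node (c x) (Node (code (foldl (f x) (a x) s1)) (code z)))
      (Node (Node (c x) (code s2)) r).
    by rewrite /st1 /update eqxx /= st0.
  have [st2 [t [ex st20 le_t sz]]] :=
    Hp (Tagged (fun x => (A x * B x)%type) (foldl (f x) (a x) s1, z)) _ _ st10.
  have st20' : st2 0 = Node (code (foldl (f x) (a x) (rcons s1 z)))
      (Node (Node (c x) (code s2)) r) by rewrite st20 foldl_rcons.
  pose st3 := update st2 0 (eval st2 e2).
  have Es' : s x = rcons s1 z ++ s2 by rewrite cat_rcons.
  have [||st4 [t4 [ex4 st40 le_t4]]] := IH (rcons s1 z) st3 Es'; first by lia.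
    by rewrite /st3 /update eqxx /= st20'.
  exists st4, (ecost st e0 + ((ecost st e1).+1 + (t + (ecost st2 e2).+1).+1).+1 + t4).+1.
  split=> //.
    apply: ExWhileStep ex4; first by rewrite /= st0.
    by apply: ExSeq (ExAssign _ _ _) (ExSeq ex (ExAssign _ _ _)).
  have b0 : tsize (st 0) <= w n.
    have -> : tsize (st 0) = ((tsize (c x) + (tsize (code (foldl (f x) (a x) s1)) +
      (tsize (code z) + tsize (code s2)).+1).+1).+1 + tsize r).+1 by rewrite st0.
    rewrite /w.
    by have := szA _ _ Es; lia.
  have b2 : tsize (st2 0) <= w n by rewrite st20' /w /=; have := szA _ _ Es'; lia.
  have bt : t <= (w n + k) ^ k.
    apply: leq_trans le_t _; apply: leq_expn_add; 
    have -> : tsize (ext c (Tagged (fun x => (A x * B x)%type) (foldl (f x) (a x) s1, z))) =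
      (tsize (c x) + (tsize (code (foldl (f x) (a x) s1)) + tsize (code z)).+1).+1 by [].
    rewrite [tsize (Node _ _)]/=.
    by have := szA _ _ Es; rewrite /w; lia.
  have : (size s2 + 1) * M n + M n = (size (z :: s2) + 1) * M n by rewrite /=; lia.
  have c0 : ecost st e0 <= m0 * w n.
    by apply: leq_trans (leq_trans (leq_addr _ _) (Hm0 st)) _; rewrite leq_mul2l b0 orbT.
  have c1 : ecost st e1 <= m1 * w n.
    by apply: leq_trans (leq_trans (leq_addr _ _) (Hm1 st)) _; rewrite leq_mul2l b0 orbT.
  have c2 : ecost st2 e2 <= m2 * w n.
    by apply: leq_trans (leq_trans (leq_addr _ _) (Hm2 st2)) _; rewrite leq_mul2l b2 orbT.
  have eM : M n = m0 * w n + m1 * w n + m2 * w n + (w n + k) ^ k + 10.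
    by rewrite /M !mulnDl.
  clearbody st1 st3; clear - c0 c1 c2 le_t4 bt eM.
  move: c0 c1 c2 le_t4 bt eM.
  by move: (M n) (w n) (ecost _ _) (ecost _ _) (ecost _ _) ((_ + k) ^ k) ((_ + 1) * _); lia.
have [|st' [t [ex st'0 le_t]]] := loop (s x) [::] st erefl _ st0.
  by lia.
exists st', t; split=> //.
  apply: leq_trans le_t _; rewrite leq_mul2r; apply/orP; right.
  by have := @size_lt_code _ (@cB x) (s x); lia.
have := HK x (s x) [::]; rewrite cats0 => /(_ erefl) le.
have ch : tsize (c x) <= tsize (h x) by rewrite /h /=; lia.
have {}le : tsize (code (foldl (f x) (a x) (s x))) <= q (tsize (h x)).
  by apply: leq_trans le _; apply: leq_expn_add.
have -> : tsize (g x) =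
    (tsize (c x) + (tsize (code (foldl (f x) (a x) (s x))) + 1).+1).+1 by [].
by rewrite /w; lia.
Qed.
End Constructors.
End Context.

Lemma tsize_code_elem T {cT : Code T} (s1 s2 : seq T) z :
  tsize (code z) <= tsize (code (s1 ++ z :: s2)).
Proof.
elim: s1 => [|y s1 IH]; rewrite ?cat0s ?cat_cons tsize_code_cons; first by lia.
by apply: leq_trans IH _; lia.
Qed.

Lemma tsize_code_suffix T {cT : Code T} (s1 s2 : seq T) :
  tsize (code s2) <= tsize (code (s1 ++ s2)).
Proof. by elim: s1 => [|y s1 IH] //; rewrite cat_cons tsize_code_cons; lia. Qed.

Lemma tsize_code_cat T {cT : Code T} (s1 s2 : seq T) :
  tsize (code (s1 ++ s2)) = tsize (code s1) + (tsize (code s2)).-1.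
Proof.
have := @tsize_gt0 (code s2); elim: s1 => [|y s1 IH] gt0.
  by rewrite cat0s -[tsize (code [::])]/(tsize Leaf) add1n prednK.
by rewrite cat_cons !tsize_code_cons IH// addnA.
Qed.

Lemma tsize_code_rev T {cT : Code T} (s : seq T) :
  tsize (code (rev s)) = tsize (code s).
Proof.
elim: s => [|y s IH] //; rewrite rev_cons -cats1 tsize_code_cat IH.
by rewrite !tsize_code_cons -[tsize (code [::])]/(tsize Leaf) /=; lia.
Qed.

Lemma tsize_code_prefix T {cT : Code T} (s1 s2 : seq T) :
  tsize (code s1) <= tsize (code (s1 ++ s2)).
Proof. by rewrite tsize_code_cat leq_addr. Qed.

Lemma tsize_code_map T U {cT : Code U} (f : T -> U) (s : seq T) B :
  (forall s1 z s2, s = s1 ++ z :: s2 -> tsize (code (f z)) <= B) ->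
  tsize (code (map f s)) <= size s * B.+1 + 1.
Proof.
elim: s => [|z s IH] H //; rewrite map_cons tsize_code_cons.
have := H [::] z s erefl; have : tsize (code (map f s)) <= size s * B.+1 + 1.
  by apply: IH => s1 z' s2 E; apply: (H (z :: s1) z' s2); rewrite E.
by rewrite -[size (z :: s)]/(size s).+1 mulSn; lia.
Qed.

Lemma tsize_code_nat n : tsize (code n) = n.*2.+1.
Proof.
elim: n => // n IH.
by rewrite -[tsize (code n.+1)]/(tsize (Node Leaf (code n))) /= IH; lia.
Qed.

Lemma pt_size X (c h : X -> tree) : poly_time c h ->
  exists k, forall x, tsize (h x) <= (tsize (c x) + k) ^ k.
Proof.
move=> [p [k H]]; exists k => x.
have [|? [? [_ _ _ ->//]]] := H x Leaf (fun=> Node (c x) Leaf); by [].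
Qed.

Section Reverse.
Variables (X : Type) (c : X -> tree) (A B : X -> Type).
Context {cA : forall x, Code (A x)} {cB : forall x, Code (B x)}.

Lemma pt_nil : poly_time c (fun x => code ([::] : seq (A x))).
Proof. exact: pt_cst. Qed.

Lemma pt_rev (s : forall x, seq (A x)) :
  poly_time c (fun x => code (s x)) -> poly_time c (fun x => code (rev (s x))).
Proof.
move=> cs; have [k Hk] := pt_size cs.
have revE T (t : seq T) : foldl (fun a z => z :: a) [::] t = rev t.
  by rewrite -[rev t]cats0 -catrevE; elim: t [::] => //= z t IH a; apply: IH.
apply: (@pt_ext _ _ (fun x => code (foldl (fun a z => z :: a) [::] (s x)))) => [x|].
  by rewrite revE.
apply: (pt_foldl (A := fun x => seq (A x)) (a := fun x => [::])
  (f := fun x a z => z :: a)) => //.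
- exact: pt_nil.
- apply: pt_cons; [apply: pt_snd_of|apply: pt_fst_of]; exact: pt_tagged.
exists k => x s1 s2 E; rewrite revE tsize_code_rev.
by apply: leq_trans (tsize_code_prefix s1 s2) _; rewrite -E.
Qed.

End Reverse.

Section Foldr.
Variables (X : Type) (c : X -> tree) (A B : X -> Type).
Context {cA : forall x, Code (A x)} {cB : forall x, Code (B x)}.

Lemma pt_foldr (s : forall x, seq (B x)) (a : forall x, A x)
    (f : forall x, B x -> A x -> A x) :
  poly_time c (fun x => code (s x)) -> poly_time c (fun x => code (a x)) ->
  poly_time (ext (Z := fun x => (A x * B x)%type) c)
    (fun p => code (f (tag p) (tagged p).2 (tagged p).1)) ->
  (exists2 q, poly_bounded q & forall x s1 s2, s x = s1 ++ s2 ->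
     tsize (code (foldr (f x) (a x) s2)) <= q (tsize (c x))) ->
  poly_time c (fun x => code (foldr (f x) (a x) (s x))).
Proof.
move=> cs ca cf [q [k qk] H].
apply: (@pt_ext _ _ (fun x => code (foldl (fun a z => f x z a) (a x) (rev (s x))))) => [x|].
  by rewrite foldl_rev.
apply: (pt_foldl (A := A) (B := B) (f := fun x a z => f x z a)) => //.
  exact: (pt_rev cs).
exists k => x s1 s2 E; apply: leq_trans (qk _); rewrite -[s1]revK foldl_rev.
by apply: (H x (rev s2)); rewrite -rev_cat -E revK.
Qed.
End Foldr.

Lemma pt_map X (c : X -> tree) (A B : X -> Type) {cA : forall x, Code (A x)}
    {cB : forall x, Code (B x)} (s : forall x, seq (B x)) (f : forall x, B x -> A x) :
  poly_time c (fun x => code (s x)) ->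
  poly_time (ext (Z := B) c) (fun p => code (f (tag p) (tagged p))) ->
  poly_time c (fun x => code (map (f x) (s x))).
Proof.
move=> cs cf; have [k Hk] := pt_size cs; have [l Hl] := pt_size cf.
apply: (@pt_ext _ _ (fun x => code (foldr (fun z a => f x z :: a) [::] (s x)))) => [x|].
  by elim: (s x) => //= z t ->.
apply: (pt_foldr (A := fun x => seq (A x)) (a := fun x => [::])
  (f := fun x z a => f x z :: a)) => //.
- exact: pt_nil.
- apply: pt_cons; last by apply: pt_fst_of; apply: pt_tagged.
  pose g (p : {x & (seq (A x) * B x)%type}) : {x & B x} :=
    Tagged B (tagged p).2.
  apply: pt_trans (pt_reindex g cf); apply: pt_pair; first exact: pt_tag (pt_refl c).
  by apply: pt_snd_of; apply: pt_tagged.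
pose q n := (n + k) ^ k; pose w n := (n + q n + 1 + l) ^ l.
exists (fun n => q n * (w n + 1) + 1) => [|x s1 s2 E].
  have pq : poly_bounded q by apply: poly_exp.
  apply: poly_add (poly_const _); apply: (poly_mul pq (poly_add _ (poly_const _))).
  apply: poly_comp (poly_exp l) _; apply: poly_add (poly_const _).
  exact: poly_add poly_id pq.
have -> : foldr (fun z a => f x z :: a) [::] s2 = map (f x) s2.
  by elim: s2 {E} => //= z t ->.
have le2 : tsize (code s2) <= q (tsize (c x)).
  by apply: leq_trans (Hk x); rewrite E tsize_code_suffix.
apply: leq_trans (@tsize_code_map _ _ _ _ _ (w (tsize (c x))) _) _ => [t1 z t2 E2|].
  apply: leq_trans (Hl (Tagged B z)) _; apply: leq_expn_add; rewrite /ext /=.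
  by have := @tsize_code_elem _ (@cB x) t1 t2 z; rewrite -E2; lia.
have := @size_lt_code _ (@cB x) s2 => lt2; rewrite -[(w _).+1]addn1.
by rewrite leq_add2r leq_mul2r; apply/orP; right; lia.
Qed.

Lemma pt_cat X (c : X -> tree) (A : X -> Type) {cA : forall x, Code (A x)}
    (s t : forall x, seq (A x)) :
  poly_time c (fun x => code (s x)) -> poly_time c (fun x => code (t x)) ->
  poly_time c (fun x => code (s x ++ t x)).
Proof.
move=> cs ct; have [k Hk] := pt_size cs; have [l Hl] := pt_size ct.
have catE T (u v : seq T) : foldr (fun z a => z :: a) v u = u ++ v.
  by elim: u => //= z u ->.
apply: (@pt_ext _ _ (fun x => code (foldr (fun z a => z :: a) (t x) (s x)))) => [x|].
  by rewrite catE.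
apply: (pt_foldr (A := fun x => seq (A x)) (B := A) (f := fun x z a => z :: a)) => //.
  by apply: pt_cons; [apply: pt_snd_of|apply: pt_fst_of]; apply: pt_tagged.
exists (fun n => (n + k) ^ k + (n + l) ^ l) => [|x s1 s2 E].
  exact: poly_add (poly_exp _) (poly_exp _).
rewrite catE tsize_code_cat; apply: leq_add.
  by apply: leq_trans (Hk x); rewrite E tsize_code_suffix.
by apply: leq_trans (Hl x); apply: leq_pred.
Qed.

Lemma pt_flatten X (c : X -> tree) (A : X -> Type) {cA : forall x, Code (A x)}
    (s : forall x, seq (seq (A x))) :
  poly_time c (fun x => code (s x)) -> poly_time c (fun x => code (flatten (s x))).
Proof.
move=> cs; have [k Hk] := pt_size cs.
apply: (pt_foldr (A := fun x => seq (A x)) (B := fun x => seq (A x))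
  (f := fun x z a => z ++ a)) => //.
- exact: pt_nil.
- by apply: pt_cat; [apply: pt_snd_of|apply: pt_fst_of]; apply: pt_tagged.
exists (fun n => (n + k) ^ k) => [|x s1 s2 E]; first exact: poly_exp.
have: tsize (code (flatten s2)) <= tsize (code s2).
  by elim: s2 {E} => // z t IH; rewrite tsize_code_cons [flatten _]/= tsize_code_cat; lia.
move/leq_trans; apply; apply: leq_trans (Hk x).
by rewrite E tsize_code_suffix.
Qed.

(** Hypotheses and variables of outer contexts are weakened through at most four binders. *)
Ltac pt_leaf :=
  first [ assumption | exact: pt_tagged
    | match goal with H : poly_time _ _ |- _ =>
        first [ exact: (pt_tag H) | exact: (pt_tag (pt_tag H))
              | exact: (pt_tag (pt_tag (pt_tag H)))
              | exact: (pt_tag (pt_tag (pt_tag (pt_tag H)))) ] end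
    | exact: (pt_tag (pt_tagged _)) | exact: (pt_tag (pt_tag (pt_tagged _)))
    | exact: (pt_tag (pt_tag (pt_tag (pt_tagged _))))
    | exact: pt_nil | exact: pt_const ].

(** Proofs of [poly_time] follow the syntax of the term: each head symbol selects its closure lemma.
    The argument [step] keeps the recursion open, so that later tactics can add symbols. *)
Ltac pt_core step :=
  lazymatch goal with
  | |- poly_time _ (fun x => code (fst _)) => apply: pt_fst_of; pt_core step
  | |- poly_time _ (fun x => code (snd _)) => apply: pt_snd_of; pt_core step
  | |- poly_time _ (fun x => code (pair _ _)) => apply: pt_mkpair; pt_core step
  | |- poly_time _ (fun x => code (cons _ _)) => apply: pt_cons; pt_core step
  | |- poly_time _ (fun x => code (cat _ _)) => apply: pt_cat; pt_core step
  | |- poly_time _ (fun x => code (behead _)) => apply: pt_behead; pt_core step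
  | |- poly_time _ (fun x => code (head _ _)) => apply: pt_head; pt_core step
  | |- poly_time _ (fun x => code (nilp _)) => apply: pt_nilp; pt_core step
  | |- poly_time _ (fun x => code (rev _)) => apply: pt_rev; pt_core step
  | |- poly_time _ (fun x => code (flatten _)) => apply: pt_flatten; pt_core step
  | |- poly_time _ (fun x => code (map _ _)) => apply: pt_map; pt_core step
  | |- poly_time _ (fun x => code (if _ then _ else _)) => apply: pt_if; pt_core step
  | |- forall _, _ => let x := fresh in intro x; exact _
  | |- poly_time _ _ => first [step | pt_leaf | idtac]
  | |- _ => idtac
  end.

Ltac pt0 := pt_core ltac:(fail).

(** This turns unary arithmetic into list processing: counting is [map], subtraction is [drop],
    iteration is [foldl]. *)
Lemma code_nat_nseq n : code n = code (nseq n tt).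
Proof. by elim: n => // n IH; rewrite -[code n.+1]/(Node Leaf (code n)) IH. Qed.

Section Booleans.
Variables (X : Type) (c : X -> tree) (a b : X -> bool).
Hypotheses (ca : poly_time c (fun x => code (a x)))
  (cb : poly_time c (fun x => code (b x))).

Lemma pt_negb : poly_time c (fun x => code (~~ a x)).
Proof.
apply: (@pt_ext _ _ (fun x => code (if a x then false else true))) => [x|].
  by case: (a x).
by pt0.
Qed.

Lemma pt_andb : poly_time c (fun x => code (a x && b x)).
Proof. by apply: (@pt_ext _ _ (fun x => code (if a x then b x else false))); last pt0. Qed.

Lemma pt_orb : poly_time c (fun x => code (a x || b x)).
Proof. by apply: (@pt_ext _ _ (fun x => code (if a x then true else b x))); last pt0. Qed.

End Booleans.

Section Lists.
Variables (X : Type) (c : X -> tree) (A : X -> Type).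
Context {cA : forall x, Code (A x)}.
Variable s : forall x, seq (A x).
Hypothesis cs : poly_time c (fun x => code (s x)).

Lemma pt_sizes : poly_time c (fun x => code (size (s x))).
Proof.
apply: (@pt_ext _ _ (fun x => code (map (fun=> tt) (s x)))); last by pt0.
by move=> x; rewrite code_nat_nseq; congr code; elim: (s x) => //= z t ->.
Qed.

Variable p : forall x, A x -> bool.
Hypothesis cp : poly_time (ext (Z := A) c) (fun y => code (@p (tag y) (tagged y))).

Lemma pt_filter : poly_time c (fun x => code (filter (@p x) (s x))).
Proof.
apply: (@pt_ext _ _ (fun x => code
  (flatten (map (fun z => if p z then [:: z] else [::]) (s x))))); last by pt0.
by move=> x; congr code; elim: (s x) => //= z t ->; case: (p z).
Qed.

Lemma pt_has : poly_time c (fun x => code (has (@p x) (s x))).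
Proof.
apply: (@pt_ext _ _ (fun x => code (~~ nilp (filter (@p x) (s x))))) => [x|].
  by rewrite /nilp size_filter -lt0n -has_count.
by apply: pt_negb; apply: pt_nilp; apply: pt_filter.
Qed.

End Lists.

Lemma pt_all X (c : X -> tree) (A : X -> Type) {cA : forall x, Code (A x)}
    (s : forall x, seq (A x)) (p : forall x, A x -> bool) :
  poly_time c (fun x => code (s x)) ->
  poly_time (ext (Z := A) c) (fun y => code (p (tag y) (tagged y))) ->
  poly_time c (fun x => code (all (@p x) (s x))).
Proof.
move=> cs cp.
apply: (@pt_ext _ _ (fun x => code (~~ has (fun z => ~~ p x z) (s x)))) => [x|].
  by rewrite -all_predC; congr code; apply: eq_all => z /=; rewrite negbK.
by apply: pt_negb; apply: pt_has => //; apply: pt_negb.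
Qed.

(** A step that raises the accumulator by at most one provides the bound that [pt_foldr] asks
    for. *)
Lemma pt_foldr_nat X (c : X -> tree) (B : X -> Type) {cB : forall x, Code (B x)}
    (s : forall x, seq (B x)) (a : X -> nat) (f : forall x, B x -> nat -> nat) :
  poly_time c (fun x => code (s x)) -> poly_time c (fun x => code (a x)) ->
  poly_time (ext (Z := fun x => (nat * B x)%type) c)
    (fun p => code (f (tag p) (tagged p).2 (tagged p).1)) ->
  (forall x z n, f x z n <= n.+1) ->
  poly_time c (fun x => code (foldr (f x) (a x) (s x))).
Proof.
move=> cs ca cf fS; have [k Hk] := pt_size cs; have [l Hl] := pt_size ca.
apply: (pt_foldr (A := fun=> nat)) => //.
exists (fun n => (n + k) ^ k * 2 + (n + l) ^ l) => [|x s1 s2 E].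
  apply: poly_add (poly_exp _); apply: poly_mul (poly_exp _) (poly_const _).
have : foldr (f x) (a x) s2 <= size s2 + a x.
  by elim: s2 {E} => //= z t IH; apply: leq_trans (fS _ _ _) _.
have := Hl x; have : size s2 <= (tsize (c x) + k) ^ k.
  apply: leq_trans (Hk x); rewrite E.
  apply: leq_trans (@tsize_code_suffix _ (@cB x) s1 s2).
  exact: ltnW (@size_lt_code _ (@cB x) s2).
by rewrite !tsize_code_nat; lia.
Qed.

Section Naturals.
Variables (X : Type) (c : X -> tree) (m n : X -> nat).
Hypotheses (cm : poly_time c (fun x => code (m x)))
  (cn : poly_time c (fun x => code (n x))).

Lemma pt_succn : poly_time c (fun x => code (m x).+1).
Proof. exact: pt_pair (pt_cst _ Leaf) cm. Qed.

Lemma pt_eqn : poly_time c (fun x => code (m x == n x)).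
Proof.
apply: pt_ext (pt_tree_eqb cm cn) => x; congr of_bool.
apply/tree_eqbP/eqP => [|->//].
by move/(congr1 tsize); rewrite !tsize_code_nat; lia.
Qed.
End Naturals.

Lemma pt_find X (c : X -> tree) (A : X -> Type) {cA : forall x, Code (A x)}
    (s : forall x, seq (A x)) (p : forall x, A x -> bool) :
  poly_time c (fun x => code (s x)) ->
  poly_time (ext (Z := A) c) (fun y => code (p (tag y) (tagged y))) ->
  poly_time c (fun x => code (find (@p x) (s x))).
Proof.
move=> cs cp.
apply: (@pt_ext _ _ (fun x => code
   (foldr (fun (b : bool) n => if b then 0 else n.+1) 0 (map (@p x) (s x))))) => [x|].
  by congr code; elim: (s x) => //= z t ->.
apply: (pt_foldr_nat (B := fun=> bool) (a := fun=> 0)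
  (f := fun _ (b : bool) n => if b then 0 else n.+1)); [by pt0|by pt0| |by move=> x []].
by pt0; apply: pt_succn; pt0.
Qed.

Lemma pt_iter X (c : X -> tree) (A : X -> Type) {cA : forall x, Code (A x)}
    (n : X -> nat) (a : forall x, A x) (f : forall x, A x -> A x) :
  poly_time c (fun x => code (n x)) -> poly_time c (fun x => code (a x)) ->
  poly_time (ext (Z := A) c) (fun y => code (f (tag y) (tagged y))) ->
  (exists2 q, poly_bounded q & forall x i, i <= n x ->
     tsize (code (iter i (f x) (a x))) <= q (tsize (c x))) ->
  poly_time c (fun x => code (iter (n x) (f x) (a x))).
Proof.
move=> cn ca cf [q [k qk] H].
have iterE T m (g : T -> T) z : foldl (fun z (_ : unit) => g z) z (nseq m tt) = iter m g z.
  by elim: m z => // m IH z; rewrite iterSr /= IH.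
apply: (@pt_ext _ _ (fun x => code (foldl (fun z (_ : unit) => f x z) (a x) (nseq (n x) tt)))) => [x|].
  by rewrite iterE.
apply: (pt_foldl (B := fun=> unit) (f := fun x z _ => f x z)) => //.
- by apply: pt_ext cn => x; rewrite code_nat_nseq.
- pose g (p : {x & (A x * unit)%type}) : {x & A x} := Tagged A (tagged p).1.
  apply: pt_trans (pt_reindex g cf); apply: pt_pair; first exact: pt_tag (pt_refl c).
  by apply: pt_fst_of; apply: pt_tagged.
exists k => x s1 s2 E; apply: leq_trans (qk _).
have /(congr1 size) := E; rewrite size_cat size_nseq => En.
have -> : s1 = nseq (size s1) tt.
  by elim: (s1) => // [[]] s /= <-.
by rewrite iterE; apply: H; lia.
Qed.

Lemma pt_drop X (c : X -> tree) (A : X -> Type) {cA : forall x, Code (A x)}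
    (s : forall x, seq (A x)) (n : X -> nat) :
  poly_time c (fun x => code (s x)) -> poly_time c (fun x => code (n x)) ->
  poly_time c (fun x => code (drop (n x) (s x))).
Proof.
move=> cs cn; have [k Hk] := pt_size cs.
have dropE T i (t : seq T) : iter i behead t = drop i t.
  by elim: i t => [|i IH] t; rewrite ?drop0// iterSr IH; case: t.
apply: (@pt_ext _ _ (fun x => code (iter (n x) behead (s x)))) => [x|].
  by rewrite dropE.
apply: (pt_iter (A := fun x => seq (A x)) (f := fun=> behead)); [by pt0|by pt0|by pt0|].
exists (fun n => (n + k) ^ k) => [|x i _]; first exact: poly_exp.
rewrite dropE; apply: leq_trans (Hk x).
by rewrite -{2}(cat_take_drop i (s x)) tsize_code_suffix.
Qed.

Lemma pt_subn X (c : X -> tree) (m n : X -> nat) :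
  poly_time c (fun x => code (m x)) -> poly_time c (fun x => code (n x)) ->
  poly_time c (fun x => code (m x - n x)).
Proof.
move=> cm cn; apply: (@pt_ext _ _ (fun x => code (drop (n x) (nseq (m x) tt)))) => [x|].
  by rewrite drop_nseq -code_nat_nseq.
by apply: (pt_drop (A := fun=> unit)) => //; apply: pt_ext cm => x; rewrite code_nat_nseq.
Qed.

Lemma pt_leq X (c : X -> tree) (m n : X -> nat) :
  poly_time c (fun x => code (m x)) -> poly_time c (fun x => code (n x)) ->
  poly_time c (fun x => code (m x <= n x)).
Proof. by move=> cm cn; apply: pt_eqn; [apply: pt_subn|apply: pt_const]. Qed.

Lemma pt_nth X (c : X -> tree) (A : X -> Type) {cA : forall x, Code (A x)}
    (a : forall x, A x) (s : forall x, seq (A x)) (n : X -> nat) :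
  poly_time c (fun x => code (a x)) ->
  poly_time c (fun x => code (s x)) -> poly_time c (fun x => code (n x)) ->
  poly_time c (fun x => code (nth (a x) (s x) (n x))).
Proof.
move=> ca cs cn; apply: (@pt_ext _ _ (fun x => code (head (a x) (drop (n x) (s x))))) => [x|].
  by rewrite -nth0 nth_drop addn0.
by apply: pt_head => //; apply: pt_drop.
Qed.

Lemma pt_take X (c : X -> tree) (A : X -> Type) {cA : forall x, Code (A x)}
    (s : forall x, seq (A x)) (n : X -> nat) :
  poly_time c (fun x => code (s x)) -> poly_time c (fun x => code (n x)) ->
  poly_time c (fun x => code (take (n x) (s x))).
Proof.
move=> cs cn.
apply: (@pt_ext _ _ (fun x => code (rev (drop (size (s x) - n x) (rev (s x)))))) => [x|].
  by rewrite drop_rev revK; congr code; have [le|/ltnW le] := leqP (n x) (size (s x));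
     [rewrite subKn|rewrite !take_oversize//; lia].
by apply: pt_rev; apply: pt_drop; [apply: pt_rev|apply: pt_subn => //; apply: pt_sizes].
Qed.

Lemma pt_rot X (c : X -> tree) (A : X -> Type) {cA : forall x, Code (A x)}
    (s : forall x, seq (A x)) (n : X -> nat) :
  poly_time c (fun x => code (s x)) -> poly_time c (fun x => code (n x)) ->
  poly_time c (fun x => code (rot (n x) (s x))).
Proof. by move=> cs cn; apply: pt_cat; [apply: pt_drop|apply: pt_take]. Qed.

Lemma pt_iota X (c : X -> tree) (n : X -> nat) :
  poly_time c (fun x => code (n x)) -> poly_time c (fun x => code (iota 0 (n x))).
Proof.
move=> cn; have [k Hk] := pt_size cn.
have iotaE m : iter m (fun t => 0 :: map S t) [::] = iota 0 m.
  by elim: m => // m /= ->; rewrite -(iotaDl 1 0).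
apply: (@pt_ext _ _ (fun x => code (iter (n x) (fun t => 0 :: map S t) [::]))) => [x|].
  by rewrite iotaE.
apply: (pt_iter (A := fun=> seq nat) (a := fun=> [::]) (f := fun=> (fun t => 0 :: map S t))).
- by pt0.
- by pt0.
- apply: pt_cons; first exact: pt_const.
  by apply: (pt_map (A := fun=> nat) (B := fun=> nat) (f := fun=> S)); [pt0|apply: pt_succn; pt0].
exists (fun n => (n + k) ^ k * ((n + k) ^ k * 2 + 2) + 1) => [|x i le_i].
  apply: poly_add (poly_const _); apply: poly_mul (poly_exp _) _.
  apply: poly_add (poly_const _); apply: poly_mul (poly_exp _) (poly_const _).
have := Hk x; rewrite iotaE tsize_code_nat; set q := (_ + k) ^ k => le_q.
rewrite -[iota _ _](map_id).
apply: leq_trans (@tsize_code_map _ _ _ _ _ (q * 2 + 1) _) _ => [s1 z s2 E|].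
  have : z \in iota 0 i by rewrite E mem_cat inE eqxx orbT.
  by rewrite mem_iota tsize_code_nat; lia.
by rewrite size_iota leq_add2r leq_mul//; lia.
Qed.

(** Injectivity lets the machine decide equality by comparing trees. *)
Class CodeEq (T : eqType) {cT : Code T} := code_inj : injective (code (T := T)).
Arguments CodeEq T {cT}.
#[export] Hint Mode CodeEq ! - : typeclass_instances.

#[export] Instance code_nat_inj : CodeEq nat.
Proof. by move=> m n /(congr1 tsize); rewrite !tsize_code_nat; lia. Qed.
#[export] Instance code_bool_inj : CodeEq bool.
Proof. by case=> [] []. Qed.
#[export] Instance code_ord_inj n : CodeEq 'I_n.
Proof. by move=> i j /code_nat_inj/val_inj. Qed.
#[export] Instance code_pair_inj (T U : eqType) (cT : Code T) (cU : Code U)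
  (iT : CodeEq T) (iU : CodeEq U) : CodeEq (T * U)%type.
Proof. by move=> [a b] [a' b'] [/code_inj-> /code_inj->]. Qed.
#[export] Instance code_seq_inj (T : eqType) (cT : Code T) (iT : CodeEq T) : CodeEq (seq T).
Proof. by elim=> [|a s IH] [|b t] //= [/code_inj-> /IH->]. Qed.

Section Equality.
Variables (X : Type) (c : X -> tree) (A : X -> eqType).
Context {cA : forall x, Code (A x)} {iA : forall x, CodeEq (A x)}.

Lemma pt_eq (a b : forall x, A x) :
  poly_time c (fun x => code (a x)) -> poly_time c (fun x => code (b x)) ->
  poly_time c (fun x => code (a x == b x)).
Proof.
move=> ca cb; apply: pt_ext (pt_tree_eqb ca cb) => x; congr of_bool.
by apply/tree_eqbP/eqP => [|->//] /code_inj.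
Qed.

End Equality.

Section Membership.
Variables (X : Type) (c : X -> tree) (A : X -> eqType).
Context {cA : forall x, Code (A x)} {iA : forall x, CodeEq (A x)}.
Variables (a : forall x, A x) (s : forall x, seq (A x)).
Hypotheses (ca : poly_time c (fun x => code (a x)))
  (cs : poly_time c (fun x => code (s x))).

Lemma pt_mem : poly_time c (fun x => code (a x \in s x)).
Proof.
apply: (@pt_ext _ _ (fun x => code (has (fun z => z == a x) (s x)))) => [x|].
  by rewrite -has_pred1.
apply: (pt_has (A := A)) => //.
by apply: (pt_eq (A := fun p : {x & A x} => A (tag p))); pt0.
Qed.

Lemma pt_index : poly_time c (fun x => code (index (a x) (s x))).
Proof.
apply: (pt_find (A := A) (p := fun x z => z == a x)) => //.
by apply: (pt_eq (A := fun p : {x & A x} => A (tag p))); pt0.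
Qed.
End Membership.

Lemma pt_rem X (c : X -> tree) (A : X -> eqType) {cA : forall x, Code (A x)}
    {iA : forall x, CodeEq (A x)} (a : forall x, A x) (s : forall x, seq (A x)) :
  poly_time c (fun x => code (a x)) -> poly_time c (fun x => code (s x)) ->
  poly_time c (fun x => code (rem (a x) (s x))).
Proof.
move=> ca cs; apply: (@pt_ext _ _ (fun x => code
  (take (index (a x) (s x)) (s x) ++ drop (index (a x) (s x)).+1 (s x)))) => [x|].
  by rewrite remE.
have ci : poly_time c (fun x => code (index (a x) (s x))) by apply: pt_index.
by apply: pt_cat; [apply: pt_take|apply: pt_drop => //; apply: pt_succn].
Qed.

(** Primitive recursion on lists. The step sees the remaining tail, as is needed for [pairs], where
    an item meets its successor. *)
Definition para (T R : Type) (g : T -> seq T -> R -> R) (r : R) : seq T -> R :=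
  fix loop s := if s is x :: t then g x t (loop t) else r.

Lemma pt_para X (c : X -> tree) (A B : X -> Type) {cA : forall x, Code (A x)}
    {cB : forall x, Code (B x)} (s : forall x, seq (B x)) (a : forall x, A x)
    (f : forall x, B x -> seq (B x) -> A x -> A x) :
  poly_time c (fun x => code (s x)) -> poly_time c (fun x => code (a x)) ->
  poly_time (ext (Z := fun x => (A x * (B x * seq (B x)))%type) c)
    (fun p => code (f (tag p) (tagged p).2.1 (tagged p).2.2 (tagged p).1)) ->
  (exists2 q, poly_bounded q & forall x s1 s2, s x = s1 ++ s2 ->
     tsize (code (para (f x) (a x) s2)) <= q (tsize (c x))) ->
  poly_time c (fun x => code (para (f x) (a x) (s x))).
Proof.
move=> cs ca cf [q pq H]; have [k Hk] := pt_size cs.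
pose F x := foldr (fun z (st : seq (B x) * A x) => (z :: st.1, f x z st.1 st.2)) ([::], a x).
have FE x t : F x t = (t, para (f x) (a x) t) by elim: t => //= z t ->.
apply: (@pt_ext _ _ (fun x => code (F x (s x)).2)) => [x|]; first by rewrite FE.
apply: pt_snd_of; apply: (pt_foldr (A := fun x => (seq (B x) * A x)%type) (B := B)
  (a := fun x => ([::], a x))
  (f := fun x z (st : seq (B x) * A x) => (z :: st.1, f x z st.1 st.2))).
- by [].
- by pt0.
- pt0.
  pose g (p : {x & ((seq (B x) * A x) * B x)%type}) :
    {x & (A x * (B x * seq (B x)))%type} :=
    Tagged (fun x => (A x * (B x * seq (B x)))%type)
      ((tagged p).1.2, ((tagged p).2, (tagged p).1.1)).
  apply: pt_trans (pt_reindex g cf); apply: pt_pair; first exact: pt_tag (pt_refl c).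
  apply: pt_mkpair; first by pt0.
  by apply: pt_mkpair; pt0.
exists (fun n => (n + k) ^ k + q n + 1) => [|x s1 s2 E].
  exact: poly_add (poly_add (poly_exp _) pq) (poly_const _).
rewrite -/(F x s2) FE tsize_code_pair addn1 ltnS leq_add ?(H x s1)//.
by apply: leq_trans (Hk x); rewrite E tsize_code_suffix.
Qed.

(** Applied to a line it gives the darts traversed; applied twice, the pairs of successive darts. *)
Definition pairs T (s : seq T) : seq (T * T) := zip s (behead s).

Lemma pairsE T (s : seq T) :
  pairs s = para (fun x t r => if nilp t then r else (x, head x t) :: r) [::] s.
Proof. by elim: s => // x [|y t] //= <-. Qed.

Lemma pt_pairs X (c : X -> tree) (A : X -> Type) {cA : forall x, Code (A x)}
    (s : forall x, seq (A x)) :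
  poly_time c (fun x => code (s x)) -> poly_time c (fun x => code (pairs (s x))).
Proof.
move=> cs; have [k Hk] := pt_size cs.
pose f x z (t : seq (A x)) r := if nilp t then r else (z, head z t) :: r.
apply: (@pt_ext _ _ (fun x => code (para (@f x) [::] (s x)))) => [x|].
  by rewrite pairsE.
apply: (pt_para (A := fun x => seq (A x * A x)) (B := A) (f := f) (a := fun=> [::])).
- by [].
- exact: pt_cst.
- by rewrite /f; pt0.
exists (fun n => 2 * (n + k) ^ k) => [|x s1 s2 E].
  exact: poly_mul (poly_const _) (poly_exp _).
rewrite -pairsE; have := Hk x; rewrite E.
have := @tsize_code_suffix _ (@cA x) s1 s2.
move=> le1 le2; apply: (@leq_trans (2 * tsize (code s2))); last first.
  by rewrite leq_mul2l /=; apply: leq_trans le1 le2.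
clear le1 le2.
case: s2 {E} => // y t.
apply: (@leq_trans (tsize (code (pairs (y :: t))) + tsize (code y))).
  exact: leq_addr.
elim: t y => [|z t IH] y.
  by rewrite -[tsize (code (pairs _))]/(tsize Leaf) tsize_code_cons -[tsize Leaf]/(0.+1); lia.
rewrite -[pairs _]/((y, z) :: pairs (z :: t)) tsize_code_cons tsize_code_pair.
by have := IH z; rewrite (tsize_code_cons y); lia.
Qed.

Ltac pt_step tac :=
  lazymatch goal with
  | |- poly_time _ (fun x => code (negb _)) => apply: pt_negb
  | |- poly_time _ (fun x => code (andb _ _)) => apply: pt_andb
  | |- poly_time _ (fun x => code (orb _ _)) => apply: pt_orb
  | |- poly_time _ (fun x => code (size _)) => apply: pt_sizes
  | |- poly_time _ (fun x => code (filter _ _)) => apply: pt_filter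
  | |- poly_time _ (fun x => code (has _ _)) => apply: pt_has
  | |- poly_time _ (fun x => code (all _ _)) => apply: pt_all
  | |- poly_time _ (fun x => code (find _ _)) => apply: pt_find
  | |- poly_time _ (fun x => code (S _)) => apply: pt_succn
  | |- poly_time _ (fun x => code (drop _ _)) => apply: pt_drop
  | |- poly_time _ (fun x => code (take _ _)) => apply: pt_take
  | |- poly_time _ (fun x => code (rot _ _)) => apply: pt_rot
  | |- poly_time _ (fun x => code (subn _ _)) => apply: pt_subn
  | |- poly_time _ (fun x => code (leq _ _)) => apply: pt_leq
  | |- poly_time _ (fun x => code (nth _ _ _)) => apply: pt_nth
  | |- poly_time _ (fun x => code (iota 0 _)) => apply: pt_iota
  | |- poly_time _ (fun x => code (@eq_op (@?A x) _ _)) => apply: (pt_eq (A := A))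
  | |- poly_time _ (fun x => code (@index (@?A x) _ _)) => apply: (pt_index (A := A))
  | |- poly_time _ (fun x => code (@rem (@?A x) _ _)) => apply: (pt_rem (A := A))
  | |- poly_time _ (fun x => code (pairs _)) => apply: pt_pairs
  | |- poly_time _ (fun x => code (@in_mem _ _ (@mem _ (seq_predType (@?A x)) _))) =>
      apply: (pt_mem (A := A))
  | |- _ => tac
  end.
Ltac pt_with tac :=
  pt_core ltac:(pt_step tac; [> pt_with tac ..]).
Ltac pt := pt_with fail.

(** * Minimum cuts *)

Section MinCut.
Variable T : eqType.
Implicit Types (arcs P q : seq (T * T)) (s t : T) (S : pred T).

Definition swap (T : Type) (a : T * T) : T * T := (a.2, a.1).

Definition found s P : seq T := s :: map snd P.

Definition extend_tree s P (a : T * T) :=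
  if (a.1 \in found s P) && (a.2 \notin found s P) then a :: P else P.

Definition search_round arcs s P := foldl (extend_tree s) P arcs.

(* A search tree rooted at [s]: the arcs along which vertices were found, the
   most recent one first. *)
Definition search arcs s := iter (size arcs).+1 (search_round arcs s) [::].

Definition reach arcs s := found s (search arcs s).

Definition trace_step (st : T * seq (T * T)) (a : T * T) :=
  if a.2 == st.1 then (a.1, a :: st.2) else st.

(** One pass suffices, as a search tree lists every arc before the arc that found its tail. *)
Definition trace P t := (foldl trace_step (t, [::]) P).2.

Definition remove_all arcs q := foldl (fun r a => rem a r) arcs q.

Definition augment s t arcs :=
  let P := search arcs s in
  if t \in found s P then
    let q := trace P t in map (@swap T) q ++ remove_all arcs q
  else arcs.

(** Capacities are multiplicities in the list of arcs. At most [size arcs] augmentations can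
    succeed, since each lowers the cut around the source by one. *)
Definition mincut arcs s t :=
  reach (iter (size arcs).+1 (augment s t) arcs) s.

Definition out_arcs arcs S := count (fun a => S a.1 && ~~ S a.2) arcs.
Definition in_arcs arcs S := count (fun a => ~~ S a.1 && S a.2) arcs.

Fixpoint search_tree arcs s P :=
  if P is a :: P' then
    [&& a \in arcs, a.1 \in found s P', a.2 \notin found s P' & search_tree arcs s P']
  else true.

Definition closed_under arcs s P :=
  forall a, a \in arcs -> a.1 \in found s P -> a.2 \in found s P.

Lemma extend_tree_wf arcs s P a :
  a \in arcs -> search_tree arcs s P -> search_tree arcs s (extend_tree s P a).
Proof. by rewrite /extend_tree => a_in wf; case: ifP => //= /andP[-> ->]; rewrite a_in. Qed.

Lemma search_round_wf arcs s P :
  search_tree arcs s P -> search_tree arcs s (search_round arcs s P).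
Proof.
rewrite /search_round => wf.
suff H l : {subset l <= arcs} -> forall P, search_tree arcs s P ->
    search_tree arcs s (foldl (extend_tree s) P l) by apply: H.
elim: l => //= a l IH sub Q wfQ; apply: IH => [b b_l|].
  by apply: sub; rewrite inE b_l orbT.
by apply: extend_tree_wf => //; apply: sub; rewrite mem_head.
Qed.

Lemma search_wf arcs s : search_tree arcs s (search arcs s).
Proof. by rewrite /search; elim: _.+1 => // n IH; apply: search_round_wf. Qed.

Lemma search_tree_uniq arcs s P : search_tree arcs s P -> uniq (map snd P).
Proof.
elim: P => //= a P IH /and4P[_ _ + /IH->]; rewrite inE negb_or andbT.
by case/andP.
Qed.

Lemma search_tree_sub arcs s P : search_tree arcs s P -> {subset P <= arcs}.
Proof.
elim: P => //= a P IH /and4P[a_in _ _ /IH sub] b.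
by rewrite inE => /predU1P[->|/sub].
Qed.

Lemma search_tree_size arcs s P : search_tree arcs s P -> size P <= size arcs.
Proof.
move=> wf; rewrite -(size_map snd) -(size_map snd arcs).
apply: uniq_leq_size; first exact: search_tree_uniq wf.
move=> x /mapP[a a_P ->]; apply: map_f; exact: search_tree_sub wf _ a_P.
Qed.

Lemma size_extend_tree s P a : size P <= size (extend_tree s P a).
Proof. by rewrite /extend_tree; case: ifP. Qed.

Lemma size_search_round arcs s P : size P <= size (search_round arcs s P).
Proof.
rewrite /search_round; elim: arcs P => //= a l IH P.
exact: leq_trans (size_extend_tree s P a) (IH _).
Qed.

Lemma search_round_closed arcs s P :
  closed_under arcs s P -> search_round arcs s P = P.
Proof.
rewrite /search_round; elim: arcs => //= a l IH cl.
have -> : extend_tree s P a = P.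
  rewrite /extend_tree; case: ifP => // /andP[a1]; rewrite cl ?mem_head//.
by apply: IH => b b_l; apply: cl; rewrite inE b_l orbT.
Qed.

Lemma search_round_progress arcs s P :
  closed_under arcs s P \/ size P < size (search_round arcs s P).
Proof.
rewrite /search_round; elim: arcs => [|a l IH /=]; first by left.
rewrite /extend_tree; case: ifPn => [ok|nok].
  right; apply: (@leq_trans (size (a :: P))) => //.
  exact: size_search_round.
case: IH => [cl|lt]; [left|by right].
move=> b; rewrite inE => /predU1P[->|/cl//] a1.
by move: nok; rewrite a1 /= negbK.
Qed.

(** A round that starts from a tree not yet closed adds an arc, and the arcs of a tree have distinct
    heads, so this happens at most [size arcs] times. *)
Lemma search_closed arcs s : closed_under arcs s (search arcs s).
Proof.
have H n : closed_under arcs s (iter n (search_round arcs s) [::]) \/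
    n <= size (iter n (search_round arcs s) [::]).
  elim: n => [|n [cl|le]]; first by right.
    by left; rewrite /= search_round_closed.
  have [cl|lt] := search_round_progress arcs s (iter n (search_round arcs s) [::]).
    by left; rewrite /= search_round_closed.
  by right; apply: leq_trans lt.
have [//|] := H (size arcs).+1.
by rewrite -/(search arcs s) ltnNge (search_tree_size (search_wf arcs s)).
Qed.

Lemma reach_root arcs s : s \in reach arcs s.
Proof. exact: mem_head. Qed.

Lemma reach_closed arcs s a :
  a \in arcs -> a.1 \in reach arcs s -> a.2 \in reach arcs s.
Proof. exact: search_closed. Qed.

Lemma reach_ind arcs s (Q : T -> Prop) :
  Q s -> (forall a, a \in arcs -> Q a.1 -> Q a.2) ->
  forall x, x \in reach arcs s -> Q x.
Proof.
move=> Qs Qa; rewrite /reach; have := search_wf arcs s.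
elim: (search arcs s) => [_ x|a P IH] /=; first by rewrite inE => /eqP->.
move=> /and4P[a_in a1 _ wf] x; rewrite !inE orbCA => /predU1P[->|xP].
  by apply: Qa => //; apply: IH.
by apply: IH => //; rewrite inE.
Qed.

Fixpoint tree_path P t :=
  if P is a :: P' then
    if a.2 == t then a :: tree_path P' a.1 else tree_path P' t
  else [::].

Lemma traceE P t : trace P t = rev (tree_path P t).
Proof.
suff H q : (foldl trace_step (t, q) P).2 = rev (tree_path P t) ++ q.
  by rewrite /trace H cats0.
elim: P t q => //= a P IH t q; rewrite /trace_step /=; case: ifP => _ //.
by rewrite IH rev_cons cat_rcons.
Qed.

Lemma tree_path_subseq P t : subseq (tree_path P t) P.
Proof.
elim: P t => // a P IH t; rewrite [tree_path _ _]/=.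
case: ifP => _; first by rewrite /= eqxx.
by apply: subseq_trans (IH t) _; apply: subseq_cons.
Qed.

(** Along a path from [s] to [t], exits from [S] minus entries telescope to [S s - S t]; the
    equation is arranged to avoid truncated subtraction. *)
Lemma tree_path_cross arcs s P t S :
  search_tree arcs s P -> t \in found s P ->
  out_arcs (tree_path P t) S + S t = in_arcs (tree_path P t) S + S s.
Proof.
rewrite /out_arcs /in_arcs.
elim: P t => [|a P IH] t /=; first by rewrite inE => _ /eqP->.
move=> /and4P[_ a1 a2 wf]; rewrite !inE orbCA.
case: (eqVneq t a.2) => [-> _|ne /= t_P]; last first.
  by rewrite IH// inE.
rewrite /=; have := IH _ wf a1.
by case: (S a.1) (S a.2) => [] []; lia.
Qed.

Lemma remove_all_perm arcs q : uniq q -> {subset q <= arcs} ->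
  perm_eq arcs (q ++ remove_all arcs q).
Proof.
elim: q arcs => //= a q IH arcs /andP[a_q uq] sub.
have a_in : a \in arcs by apply: sub; rewrite mem_head.
apply: (perm_trans (perm_to_rem a_in)); rewrite perm_cons; apply: IH => // b b_q.
have /sub : b \in a :: q by rewrite inE b_q orbT.
rewrite (perm_mem (perm_to_rem a_in)) inE => /predU1P[E|//].
by rewrite -E b_q in a_q.
Qed.

(* A path from [s] to [t] leaves a set separating [s] from [t] once more than it
   enters it. *)
Lemma augment_cross arcs s t S : t \in reach arcs s -> S s -> ~~ S t ->
  (out_arcs (augment s t arcs) S).+1 = out_arcs arcs S.
Proof.
move=> t_in Ss nSt; rewrite /augment -/(reach arcs s) t_in traceE.
set p := tree_path _ t.
have wf := search_wf arcs s.
have sub : {subset rev p <= arcs}.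
  move=> a; rewrite mem_rev => /(mem_subseq (tree_path_subseq _ _)).
  exact: search_tree_sub wf a.
have up : uniq (rev p).
  rewrite rev_uniq; apply: subseq_uniq (tree_path_subseq _ _) _.
  exact: map_uniq (search_tree_uniq wf).
rewrite {2}/out_arcs (permP (remove_all_perm up sub)) /out_arcs !count_cat.
rewrite map_rev !count_rev count_map.
have := tree_path_cross S wf t_in; rewrite Ss (negPf nSt) -/p.
rewrite /out_arcs /in_arcs.
rewrite (@eq_count _ (preim _ _) (fun a => ~~ S a.1 && S a.2)) => [|a /=].
  by rewrite addn0 addn1 => ->; rewrite addSn.
by rewrite andbC.
Qed.

Lemma mincutP arcs s t : s != t ->
  [/\ s \in mincut arcs s t, t \notin mincut arcs s t &
    forall S, S s -> ~~ S t ->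
      out_arcs arcs (mem (mincut arcs s t)) <= out_arcs arcs S].
Proof.
move=> st; pose R n := iter n (augment s t) arcs.
(* [k] counts the successful augmentations. While the sink is reachable all of them have succeeded,
   because a failed one changes nothing. *)
have H n : exists k, (t \in reach (R n) s -> k = n) /\
    forall S, S s -> ~~ S t -> out_arcs (R n) S + k = out_arcs arcs S.
  elim: n => [|n [k [kn kS]]]; first by exists 0; split=> // S _ _; rewrite addn0.
  have [t_in|t_notin] := boolP (t \in reach (R n) s).
    exists n.+1; split=> // S Ss St; rewrite -kS// (kn t_in).
    by rewrite -(augment_cross t_in Ss St) addnS addSn.
  have RE : R n.+1 = R n.
    by rewrite /R /= /augment -/(reach _ s) (negPf t_notin).
  by exists k; rewrite RE; split=> //; rewrite (negPf t_notin).
have [k [kn kS]] := H (size arcs).+1.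
have t_notin : t \notin mincut arcs s t.
  (* Otherwise the cut around the source would have lost more arcs than there are. *)
  apply/negP => /kn Ek; have := kS (pred1 s); rewrite /= eqxx eq_sym st.
  move=> /(_ isT isT); rewrite Ek /out_arcs => E.
  by have := count_size (fun a => pred1 s a.1 && ~~ pred1 s a.2) arcs; lia.
split; [exact: reach_root|exact: t_notin|move=> S Ss St].
rewrite -(kS S)// -(kS (mem (mincut arcs s t)))//; last exact: reach_root.
rewrite leq_add2r; set c := out_arcs _ _; suff -> : c = 0 by [].
apply/eqP; rewrite /c /out_arcs -leqn0 leqNgt -has_count.
apply/hasP => [[a a_R /andP[a1]]]; case/negP.
exact: reach_closed a_R a1.
Qed.
End MinCut.

(** * Sorting *)

Lemma subseq2_index (T : eqType) (s : seq T) x y : uniq s -> x != y ->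
  subseq [:: x; y] s = (x \in s) && (y \in s) && (index x s < index y s).
Proof.
elim: s => //= z s IH /andP[z_s us] ne; rewrite !inE.
case: (eqVneq x z) => [E|xz].
  by subst z; rewrite [y == x]eq_sym (negPf ne) /= andbT sub1seq.
case: (eqVneq y z) => [E|yz] /=; last by rewrite ltnS; apply: IH.
rewrite andbF; apply/negP => /mem_subseq/(_ y).
by rewrite !inE eqxx orbT E (negPf z_s) => /(_ isT).
Qed.

Lemma precedes_total (T : eqType) (s : seq T) x y : uniq s -> x != y ->
  x \in s -> y \in s -> subseq [:: x; y] s = ~~ subseq [:: y; x] s.
Proof.
move=> us ne xs ys; rewrite !subseq2_index// 1?eq_sym// xs ys /=.
rewrite -leqNgt [RHS]leq_eqVlt; case: eqP => // E; case/eqP: ne.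
by rewrite -(nth_index x xs) E nth_index.
Qed.

Lemma subseq2_rev (T : eqType) (s : seq T) x y :
  subseq [:: x; y] (rev s) = subseq [:: y; x] s.
Proof. by rewrite -subseq_rev revK. Qed.

Lemma filter_rot (T : Type) (p : pred T) k s :
  filter p (rot k s) = rot (size (filter p (take k s))) (filter p s).
Proof.
by rewrite -{3}(cat_take_drop k s) filter_cat rot_size_cat /rot filter_cat.
Qed.

(** Vertex crossings are read off a cyclic sequence; this allows restricting it to the two lines
    involved and going back. *)
Lemma filter_rotP (T : Type) (p : pred T) k s :
  exists k', filter p (rot k' s) = rot k (filter p s).
Proof.
have [le|lt] := leqP k (size (filter p s)); last first.
  by exists 0; rewrite rot0 rot_oversize// ltnW.
suff [k' <-] : exists k', size (filter p (take k' s)) = k.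
  by exists k'; rewrite filter_rot.
elim: s k le => [|x s IH] [|k] //=; try by exists 0.
case: ifP => px; last first.
  by move=> /IH[k' Ek]; exists k'.+1; rewrite /= px.
by rewrite ltnS => /IH[k' Ek]; exists k'.+1; rewrite /= px /= Ek.
Qed.

Lemma rot_rotP (T : Type) m n (s : seq T) : exists k, rot m (rot n s) = rot k s.
Proof.
have [le_n|lt_n] := leqP n (size s); last first.
  by exists m; rewrite [rot n s]rot_oversize// ltnW.
have [le_m|lt_m] := leqP m (size s).
  by exists (if m + n <= size s then m + n else m + n - size s); apply: rot_add_mod.
by exists n; rewrite rot_oversize// size_rot ltnW.
Qed.

Lemma rot_invP (T : Type) m n (s : seq T) : exists k, rot m s = rot k (rot n s).
Proof.
by have [k E] := rot_rotP m (size (rot n s) - n) (rot n s); exists k; rewrite -E -/(rotr n _) rotK.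
Qed.

Lemma flatten_map_rot (T U : Type) (f : T -> seq U) n (s : seq T) :
  flatten (map f (rot n s)) =
  rot (size (flatten (map f (take n s)))) (flatten (map f s)).
Proof.
by rewrite -{3}(cat_take_drop n s) map_cat flatten_cat rot_size_cat /rot map_cat
  flatten_cat.
Qed.

Lemma subseq_flatten_map (T U : eqType) (f : T -> seq U) s w :
  w \in s -> subseq (f w) (flatten (map f s)).
Proof.
elim: s => //= x s IH; rewrite inE => /predU1P[->|/IH sub].
  exact: prefix_subseq.
exact: subseq_trans sub (suffix_subseq _ _).
Qed.

Lemma subseq2_flatten_map (T U : eqType) (f : T -> seq U) s w1 w2 x y :
  w1 \in s -> w2 \in s -> index w1 s < index w2 s -> x \in f w1 -> y \in f w2 ->
  subseq [:: x; y] (flatten (map f s)).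
Proof.
move=> + + + xw yw; elim: s => //= z s IH; rewrite !inE.
case: (eqVneq w1 z) => [E|ne1]; last first.
  case: (eqVneq w2 z) => [E|ne2] //= w1s w2s; rewrite ltnS => lt.
  by apply: subseq_trans (IH w1s w2s lt) _; apply: suffix_subseq.
subst z; case: (eqVneq w2 w1) => [->|ne2] //= _ w2s _.
rewrite -[[:: x; y]]/([:: x] ++ [:: y]); apply: cat_subseq; rewrite sub1seq//.
exact: (mem_subseq (subseq_flatten_map f w2s) yw).
Qed.

Lemma count_flatten_map (T U : eqType) (f : T -> seq U) (s : seq T) x :
  {in s, forall w, uniq (f w)} ->
  count_mem x (flatten (map f s)) = count (fun w => x \in f w) s.
Proof.
elim: s => //= w s IH us; rewrite count_cat IH => [|v v_s]; last first.
  by apply: us; rewrite inE v_s orbT.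
by rewrite count_uniq_mem// us// mem_head.
Qed.

Lemma perm2 (T : eqType) (s : seq T) x y : x != y ->
  count_mem x s = 1 -> count_mem y s = 1 ->
  filter (pred2 x y) s = [:: x; y] \/ filter (pred2 x y) s = [:: y; x].
Proof.
move=> ne cx cy; set t := filter _ s.
have tx : count_mem x t = 1.
  by rewrite count_filter -cx; apply: eq_count => z /=; case: eqP.
have ty : count_mem y t = 1.
  by rewrite count_filter -cy; apply: eq_count => z /=; case: eqP; rewrite ?orbT.
have at_ : all (pred2 x y) t by apply: filter_all.
have : size t = 2.
  have := count_predUI (pred1 x) (pred1 y) t; rewrite tx ty.
  rewrite (@eq_count _ (predI _ _) pred0) => [|z /=]; last first.
    by case: eqP => // ->; apply: negPf.
  by rewrite count_pred0 addn0 => E; rewrite -[2]E; apply/esym/eqP; rewrite -all_count.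
move: tx ty at_; case: t => [|a [|b []]] //= tx ty.
rewrite /= andbT => /andP[/pred2P[] Ea /pred2P[] Eb] _; subst.
- by move: tx; rewrite eqxx.
- by left.
- by right.
- by move: ty; rewrite eqxx.
Qed.

(** Insertion by two filters: filtering preserves sortedness and is available as a program
    combinator. *)
Definition isort (T : Type) (r : rel T) : seq T -> seq T :=
  foldr (fun x t => filter (r^~ x) t ++ x :: filter (fun y => ~~ r y x) t) [::].

Lemma isort_perm (T : eqType) (r : rel T) s : perm_eq (isort r s) s.
Proof.
elim: s => //= x s IH; rewrite perm_catC /= perm_cons perm_catC.
by apply: perm_trans IH; apply/permPl; exact: perm_filterC (r^~ x) _.
Qed.

Lemma isort_pairwise (T : eqType) (r : rel T) s : transitive r ->
  uniq s -> {in s &, forall x y, x != y -> r x y || r y x} ->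
  pairwise r (isort r s).
Proof.
move=> tr; elim: s => //= x s IH /andP[x_s us] tot.
have {}IH : pairwise r (isort r s).
  by apply: IH => // y z ys zs; apply: tot; rewrite inE ?ys ?zs orbT.
have rx y : y \in isort r s -> ~~ r y x -> r x y.
  rewrite (perm_mem (isort_perm r s)) => ys nyx.
  have : r x y || r y x; last by rewrite (negPf nyx) orbF.
  apply: tot; rewrite ?inE ?eqxx ?ys ?orbT//.
  by apply: contraNneq x_s => ->.
rewrite pairwise_cat /= !pairwise_filter// !andbT; apply/andP; split.
  apply/allrelP => y z; rewrite mem_filter inE => /andP[yx y_s].
  case/predU1P => [->//|]; rewrite mem_filter => /andP[nzx z_s].
  exact: tr yx (rx _ z_s nzx).
by apply/allP => y; rewrite mem_filter => /andP[nyx y_s]; apply: rx.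
Qed.

Definition strict_total (T : eqType) (r : rel T) : Prop :=
  [/\ irreflexive r, transitive r & forall x y, x != y -> r x y || r y x].

Definition lex2 (T U : eqType) (r : rel T) (q : rel U) : rel (T * U) :=
  fun x y => r x.1 y.1 || (x.1 == y.1) && q x.2 y.2.

Lemma lex2_strict (T U : eqType) (r : rel T) (q : rel U) :
  strict_total r -> strict_total q -> strict_total (lex2 r q).
Proof.
move=> [ri rt rT] [qi qt qT]; split=> [x|y x z|[a b] [c d] ne]; rewrite /lex2 /=.
- by rewrite ri qi andbF.
- case/orP => [xy|/andP[/eqP-> xy]]; case/orP => [yz|/andP[/eqP E yz]].
  + by rewrite (rt _ _ _ xy yz).
  + by rewrite -E xy.
  + by rewrite yz.
  + by rewrite -E eqxx (qt _ _ _ xy yz) orbT.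
case: (eqVneq a c) ne => [<-|ac _]; last by case/orP: (rT _ _ ac) => ->; rewrite ?orbT.
rewrite xpair_eqE eqxx /= => /qT; case/orP => ->; rewrite ?orbT//.
Qed.

Lemma converse_strict (T : eqType) (r : rel T) :
  strict_total r -> strict_total (fun x y => r y x).
Proof.
move=> [ri rt rT]; split=> [x|y x z xy yz|x y ne]; first exact: ri.
  exact: rt yz xy.
by rewrite orbC rT.
Qed.

Lemma ltn_strict : strict_total ltn.
Proof.
by split=> [x|y x z|x y]; [exact: ltnn|exact: ltn_trans|rewrite neq_ltn].
Qed.

Fixpoint lexlt (s t : seq nat) : bool :=
  match s, t with
  | _, [::] => false
  | [::], _ => true
  | m :: s', n :: t' => if m == n then lexlt s' t' else m < n
  end.

Lemma lexlt_strict : strict_total lexlt.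
Proof.
split=> [s|t s u|s t]; first by elim: s => //= m s IH; rewrite eqxx.
  elim: t s u => [|n t IH] [|m s] [|k u] //=.
  case: (eqVneq m n) => [->|mn]; first by case: eqP => // _; apply: IH.
  case: (eqVneq n k) => [<-|nk]; first by rewrite (negPf mn).
  by move=> lt1 lt2; case: eqP; lia.
elim: s t => [|m s IH] [|n t] //=; rewrite eqseq_cons.
case: (eqVneq m n) => [_|mn] /=; first exact: IH.
by rewrite -neq_ltn mn.
Qed.

Lemma pairwise_precedes (T : eqType) (r : rel T) s x y :
  irreflexive r -> transitive r -> uniq s -> pairwise r s ->
  x != y -> x \in s -> y \in s -> subseq [:: x; y] s = r x y.
Proof.
move=> ri rt us ps ne xs ys; apply/idP/idP => [/subseq_pairwise/(_ ps)|xy].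
  by rewrite /= !andbT.
rewrite precedes_total//; apply/negP => /subseq_pairwise/(_ ps).
by rewrite /= !andbT => /(rt _ _ _ xy); rewrite ri.
Qed.

(** * Crossings at a vertex *)

Lemma pairsP (T : eqType) (s : seq T) a b :
  reflect (exists p t, s = p ++ [:: a, b & t]) ((a, b) \in pairs s).
Proof.
apply: (iffP idP) => [|[p [t ->]]]; last first.
  elim: p => [|x [|y p] IH]; first exact: mem_head.
    by rewrite /pairs /= !inE eqxx orbT.
  by rewrite -[pairs _]/((x, y) :: pairs ((y :: p) ++ _)) inE IH orbT.
elim: s => [|x [|y s] IH] //; rewrite -[pairs _]/((x, y) :: pairs (y :: s)) inE.
case/predU1P => [[-> ->]|/IH[p [t ->]]]; first by exists [::], s.
by exists (x :: p), t.
Qed.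

Lemma infix_pairs (T : eqType) (s : seq T) a b :
  infix [:: a; b] s = ((a, b) \in pairs s).
Proof. by apply/idP/idP => [/infixP|/pairsP] [p [t ->]];
  [apply/pairsP|apply/infixP]; exists p, t. Qed.

Lemma pairs_rev (T : eqType) (s : seq T) a b :
  ((a, b) \in pairs (rev s)) = ((b, a) \in pairs s).
Proof.
have H t c d : (c, d) \in pairs t -> (d, c) \in pairs (rev t).
  case/pairsP => p [q ->]; apply/pairsP; exists (rev q), (rev p).
  by rewrite rev_cat !rev_cons !cat_rcons.
by apply/idP/idP => /H; rewrite ?revK.
Qed.

Lemma uniq_split (T : eqType) (p q s t : seq T) v :
  uniq (p ++ v :: s) -> p ++ v :: s = q ++ v :: t -> p = q /\ s = t.
Proof.
move=> us E; have ix p' s' : uniq (p' ++ v :: s') -> index v (p' ++ v :: s') = size p'.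
  rewrite cat_uniq => /and3P[_ /hasPn up _].
  by rewrite index_cat /= eqxx addn0 ifN// (up v) ?mem_head.
have Ep : size p = size q by rewrite -(ix p s)// E ix -?E.
by move/eqP: E; rewrite eqseq_cat// => /andP[/eqP-> /eqP[->]].
Qed.

Lemma pairs_fun (T : eqType) (s : seq T) u a b : uniq s ->
  (u, a) \in pairs s -> (u, b) \in pairs s -> a = b.
Proof.
by move=> + /pairsP[p [t E]] /pairsP[q [r]]; rewrite E => us /(uniq_split us)[_ []].
Qed.

Lemma pairs_fun_rev (T : eqType) (s : seq T) u a b : uniq s ->
  (a, u) \in pairs s -> (b, u) \in pairs s -> a = b.
Proof. by rewrite -rev_uniq -!(pairs_rev s); apply: pairs_fun. Qed.

Lemma pairs_mem (T : eqType) (s : seq T) a b :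
  (a, b) \in pairs s -> a \in s /\ b \in s.
Proof. by case/pairsP=> p [t ->]; rewrite !mem_cat !inE !eqxx !orbT. Qed.

Section Local.
Variable I : instance.
Implicit Types (u v w : 'I_(nv I)) (l : 'I_(nl I)) (pi : layout I).

Lemma line_uniq l : uniq (line l).
Proof. by case/and3P: (line_simple l). Qed.

Lemma in_lines_on u v l : (l \in lines_on u v) =
  ((u, v) \in pairs (line l)) || ((v, u) \in pairs (line l)).
Proof. by rewrite inE /subpath !infix_pairs. Qed.

Lemma lines_on_sym u v : @lines_on I u v = lines_on v u.
Proof. by apply/setP => l; rewrite !in_lines_on orbC. Qed.

Lemma adj_sym u v : adj (G := I) u v = adj v u.
Proof. exact: nbrs_sym. Qed.

Lemma lines_on_adj u v l : l \in lines_on u v -> adj u v.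
Proof.
have H a b : (a, b) \in pairs (line l) -> adj a b.
  case/pairsP => p [t E]; case/and3P: (line_simple l) => _ _.
  by rewrite E; case: p {E} => [|x p] /=; rewrite ?cat_path /= => /andP[] // _ /and3P[].
by rewrite in_lines_on => /orP[/H|/H]; rewrite // adj_sym.
Qed.

Definition through l v u w : bool :=
  [&& l \in lines_on u v, l \in lines_on u w & v != w].

Lemma throughC l v u w : through l v u w = through l w u v.
Proof. by rewrite /through eq_sym andbCA. Qed.

(** A simple path has at most one predecessor and one successor at [u]; these are [v] and [w] in
    some order. *)
Lemma through_ports l v u w w' :
  through l v u w -> (l \in lines_on u w') = (w' == v) || (w' == w).
Proof.
move=> /and3P[lv lw vw]; apply/idP/idP; last by case/pred2P=> ->.
have ul := line_uniq l.
move: lv lw vw; rewrite !in_lines_on.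
case/orP => hv; case/orP => hw vw; case/orP => hw'.
all: try by rewrite (pairs_fun ul hv hw) eqxx in vw.
all: try by rewrite (pairs_fun_rev ul hv hw) eqxx in vw.
all: try by rewrite (pairs_fun ul hw' hv) eqxx.
all: try by rewrite (pairs_fun_rev ul hw' hv) eqxx.
all: try by rewrite (pairs_fun ul hw' hw) eqxx orbT.
all: by rewrite (pairs_fun_rev ul hw' hw) eqxx orbT.
Qed.

(** The other ports of [u] in the order met when turning clockwise from the port to [v]. *)
Definition sweep u v : seq 'I_(nv I) :=
  behead (rot (index v (nbrs u)) (nbrs u)).

Lemma sweepE u v : adj u v -> rot (index v (nbrs u)) (nbrs u) = v :: sweep u v.
Proof. by move=> /rot_index E; rewrite /sweep E. Qed.

Lemma sweep_uniq u v : adj u v -> uniq (v :: sweep u v).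
Proof. by move=> uv; rewrite -sweepE// rot_uniq nbrs_uniq. Qed.

Lemma mem_sweep u v w : adj u v -> (w \in v :: sweep u v) = adj u w.
Proof. by move=> uv; rewrite -sweepE// mem_rot. Qed.

Definition sweep_order pi u v := flatten [seq pi u w | w <- sweep u v].

Lemma around_rot pi u v : adj u v ->
  exists j, pi u v ++ sweep_order pi u v = rot j (around pi u).
Proof.
move=> /sweepE E; exists (size (flatten [seq pi u w | w <- take (index v (nbrs u)) (nbrs u)])).
by rewrite -flatten_map_rot E.
Qed.

Section SharedPort.
Variables (pi : layout I) (u v : 'I_(nv I)) (l1 l2 : 'I_(nl I)).
Variables (w1 w2 : 'I_(nv I)).
Hypotheses (pi_layout : is_layout pi) (ne12 : l1 != l2).
Hypotheses (th1 : through l1 v u w1) (th2 : through l2 v u w2).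

Let uv : adj u v. Proof. by case/and3P: th1 => /lines_on_adj. Qed.

Lemma pi_uniq w : w \in sweep u v -> uniq (pi u w).
Proof.
move=> ws; have : w \in v :: sweep u v by rewrite inE ws orbT.
by rewrite mem_sweep// => /pi_layout[].
Qed.

Lemma mem_pi w l : l \in lines_on u w -> l \in pi u w.
Proof. by move=> lw; have [_ ->] := pi_layout (lines_on_adj lw). Qed.

Lemma through_sweep l w : through l v u w -> w \in sweep u v.
Proof.
case/and3P=> _ /lines_on_adj; rewrite -(mem_sweep _ uv) inE eq_sym.
by case/predU1P=> // ->; rewrite eqxx.
Qed.

Lemma count_sweep_order l w : through l v u w ->
  count_mem l (sweep_order pi u v) = 1.
Proof.
move=> th; rewrite /sweep_order count_flatten_map; last exact: pi_uniq.
have us := sweep_uniq uv; have ws := through_sweep th.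
rewrite (@eq_in_count _ _ (pred1 w)) => [|w' w's].
  by rewrite count_uniq_mem ?ws//; case/andP: us.
have uw' : adj u w' by rewrite -(mem_sweep _ uv) inE w's orbT.
have [_ ->] := pi_layout uw'; rewrite (through_ports _ th) /=.
have : w' != v by apply: contraTneq us => E; rewrite E in w's; rewrite [uniq _]/= w's.
by move/negPf => ->.
Qed.

Lemma sweep_order_total :
  subseq [:: l1; l2] (sweep_order pi u v) =
  ~~ subseq [:: l2; l1] (sweep_order pi u v).
Proof.
have E l l' : l \in [:: l1; l2] -> l' \in [:: l1; l2] ->
    subseq [:: l; l'] (sweep_order pi u v) =
    subseq [:: l; l'] (filter (pred2 l1 l2) (sweep_order pi u v)).
  by rewrite !inE => h h'; rewrite subseq_filter /= h h'.
rewrite !E ?inE ?eqxx ?orbT//.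
have [->|->] := perm2 ne12 (count_sweep_order th1) (count_sweep_order th2);
  by rewrite /= !eqxx ?[l2 == l1]eq_sym (negPf ne12) /= ?eqxx// (negPf ne12).
Qed.

(** Cut open at the port to [v], the cyclic order restricted to the two lines has two entries at
    this port and two in the sweep; it alternates only if both halves show the same order. *)
Lemma vertex_cross_shared : vertex_cross pi u l1 l2 ->
  precedes (pi u v) l1 l2 = subseq [:: l1; l2] (sweep_order pi u v).
Proof.
move=> [k]; have [j Ej] := around_rot pi uv.
have [k' ->] := rot_invP k j (around pi u); rewrite -Ej => {Ej k}sub.
pose P := pred2 l1 l2.
have {sub} : subseq [:: l1; l2; l1; l2] (filter P (rot k' (pi u v ++ sweep_order pi u v))).
  by rewrite subseq_filter sub /= !eqxx !orbT.
rewrite filter_rot filter_cat; move: (size _) => i.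
have pv l w : through l v u w -> count_mem l (pi u v) = 1.
  case/and3P=> lv _ _; have [us _] := pi_layout uv.
  by rewrite count_uniq_mem// mem_pi.
have E s : subseq [:: l1; l2] s = subseq [:: l1; l2] (filter P s).
  by rewrite subseq_filter /= !eqxx !orbT.
rewrite /precedes (E (pi u v)) (E (sweep_order _ _ _)) /P.
have c1 := pv _ _ th1; have c2 := pv _ _ th2.
have ne21 := negPf ne12; have ne12' := ne21; rewrite eq_sym in ne21.
have [->|->] := perm2 ne12 c1 c2;
have [->|->] := perm2 ne12 (count_sweep_order th1) (count_sweep_order th2) => //=.
(* The words left are [l1 l2 l2 l1] and [l2 l1 l1 l2], none of whose rotations alternates. *)
- by case: i => [|[|[|[|i]]]]; rewrite /rot /= ?eqxx ?ne21 ?ne12' //= ?eqxx ?ne21 ?ne12'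
    //= ?eqxx ?ne21 ?ne12'.
- by case: i => [|[|[|[|i]]]]; rewrite /rot /= ?eqxx ?ne21 ?ne12' //= ?eqxx ?ne21 ?ne12'
    //= ?eqxx ?ne21 ?ne12'.
Qed.

Lemma sweep_order_ne : index w1 (sweep u v) < index w2 (sweep u v) ->
  subseq [:: l1; l2] (sweep_order pi u v).
Proof.
move=> lt; apply: subseq2_flatten_map lt _ _; [exact: through_sweep th1
  |exact: through_sweep th2|apply: mem_pi|apply: mem_pi].
  by case/and3P: th1.
by case/and3P: th2.
Qed.

Lemma sweep_order_eq :
  subseq [:: l1; l2] (pi u w1) -> subseq [:: l1; l2] (sweep_order pi u v).
Proof.
move=> sub; apply: subseq_trans sub _; apply: subseq_flatten_map.
exact: through_sweep th1.
Qed.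

Lemma shared_vertex_cross : precedes (pi u v) l1 l2 ->
  subseq [:: l1; l2] (sweep_order pi u v) -> vertex_cross pi u l1 l2.
Proof.
move=> h1 h2; have [j Ej] := around_rot pi uv; exists j; rewrite -Ej.
exact: (cat_subseq h1 h2).
Qed.
End SharedPort.

(* Reversing one port destroys a crossing at a shared port, so such crossings are
   avoidable. *)
Definition flip_port pi u v : layout I :=
  fun a b => if (a == u) && (b == v) then rev (pi a b) else pi a b.

Lemma flip_port_layout pi u v : is_layout pi -> is_layout (flip_port pi u v).
Proof.
move=> lay a b /lay[un mem]; rewrite /flip_port; case: ifP => // _.
by rewrite rev_uniq; split=> // l; rewrite mem_rev.
Qed.

Lemma flip_port_sweep pi u v : adj u v ->
  sweep_order (flip_port pi u v) u v = sweep_order pi u v.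
Proof.
move=> uv; congr flatten; apply/eq_in_map => w ws; rewrite /flip_port eqxx /=.
case: eqP => // E; have := sweep_uniq uv.
by rewrite [uniq _]/= -{1}E ws.
Qed.

Lemma feasible_no_shared_cross pi u v l1 l2 w1 w2 :
  feasible pi -> l1 != l2 -> through l1 v u w1 -> through l2 v u w2 ->
  precedes (pi u v) l1 l2 -> ~~ subseq [:: l1; l2] (sweep_order pi u v).
Proof.
move=> [lay feas] ne th1 th2 pr; apply/negP => sw.
have uv : adj u v by case/and3P: th1 => /lines_on_adj.
have /feas/(_ _ (flip_port_layout u v lay)) := shared_vertex_cross th1 pr sw.
(* Flipping reverses the order at the port but not the sweep, so the crossing claimed to be
   unavoidable is absent from the flipped layout. *)
move/(vertex_cross_shared (flip_port_layout u v lay) ne th1 th2).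
rewrite flip_port_sweep// sw /precedes /flip_port !eqxx /= subseq2_rev.
have [us _] := lay _ _ uv; have m1 := mem_pi lay; rewrite precedes_total//.
- by rewrite -/(precedes _ _ _) pr.
- by rewrite eq_sym.
- by apply: m1; case/and3P: th2.
- by apply: m1; case/and3P: th1.
Qed.

(** Without a crossing the two lines are nested like brackets: the one that is first at the port to
    [v] leaves by the port met last. *)
Lemma feasible_diverging pi u v l1 l2 w1 w2 :
  feasible pi -> l1 != l2 -> through l1 v u w1 -> through l2 v u w2 ->
  index w2 (sweep u v) < index w1 (sweep u v) -> precedes (pi u v) l1 l2.
Proof.
move=> feas ne th1 th2 lt; have [lay _] := feas.
have ne' : l2 != l1 by rewrite eq_sym.
have [us mem] : uniq (pi u v) /\ pi u v =i lines_on u v.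
  by apply: lay; case/and3P: th1 => /lines_on_adj.
rewrite /precedes precedes_total ?mem//; try by [case/and3P: th1|case/and3P: th2].
apply: contraTN (sweep_order_ne lay th2 th1 lt) => pr.
exact: (feasible_no_shared_cross feas ne' th2 th1).
Qed.

(** By the same nesting, the clockwise orders at the two ports of a bundle passing through [u] are
    mutually reverse. *)
Lemma feasible_parallel pi u v w l1 l2 :
  feasible pi -> l1 != l2 -> through l1 v u w -> through l2 v u w ->
  precedes (pi u v) l1 l2 = ~~ precedes (pi u w) l1 l2.
Proof.
move=> feas ne th1 th2; have [lay _] := feas.
have ne' : l2 != l1 by rewrite eq_sym.
have [uv [muv [uw muw]]] : uniq (pi u v) /\ (pi u v =i lines_on u v) /\
    uniq (pi u w) /\ pi u w =i lines_on u w.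
  by case/and3P: th1 => /lines_on_adj/lay[? ?] /lines_on_adj/lay[? ?].
case/and3P: (th1) => m1v m1w _; case/and3P: (th2) => m2v m2w _.
apply/idP/idP => [pr|].
  apply: contraNN (feasible_no_shared_cross feas ne th1 th2 pr).
  exact: sweep_order_eq.
rewrite /precedes -precedes_total ?muw// => pr.
rewrite precedes_total ?muv//; apply/negP => pr'.
have := feasible_no_shared_cross feas ne' th2 th1 pr'.
by rewrite (sweep_order_eq th2).
Qed.

Lemma count_around pi u l : is_layout pi ->
  count_mem l (around pi u) = count (fun w => l \in lines_on u w) (nbrs u).
Proof.
move=> lay; rewrite /around count_flatten_map => [|w uw]; last first.
  by have [] := lay _ _ uw.
by apply: eq_in_count => w uw; have [_ ->] := lay _ _ uw.
Qed.

Lemma ports_le2 u l : count (fun w => l \in lines_on u w) (nbrs u) <= 2.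
Proof.
set p := fun w => _; rewrite -size_filter.
have : uniq (filter p (nbrs u)) by rewrite filter_uniq// nbrs_uniq.
have : {in filter p (nbrs u), forall w, l \in lines_on u w}.
  by move=> w; rewrite mem_filter => /andP[].
case: (filter _ _) => [|a [|b [|d s]]] //= h /and3P[].
rewrite !inE => /norP[ab /norP[ad _]] /norP[bd _] _.
have th : through l a u b by rewrite /through ab !h ?inE ?eqxx ?orbT.
have := h d; rewrite !in_cons eqxx !orbT (through_ports _ th) => /(_ isT).
by rewrite [d == a]eq_sym (negPf ad) [d == b]eq_sym (negPf bd).
Qed.

Lemma vertex_cross_count pi u l1 l2 : vertex_cross pi u l1 l2 ->
  let c l := count_mem l [:: l1; l2; l1; l2] in
  forall l, c l <= count_mem l (around pi u).
Proof.
move=> [k sub] c l; have /permP <- : perm_eq (rot k (around pi u)) (around pi u).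
  by rewrite perm_rot.
exact: leq_count_subseq.
Qed.

Lemma ports_ge2 u l : 1 < count (fun w => l \in lines_on u w) (nbrs u) ->
  exists v w, through l v u w.
Proof.
rewrite -size_filter; set s := filter _ _.
have : uniq s by rewrite filter_uniq// nbrs_uniq.
have : {in s, forall w, l \in lines_on u w}.
  by move=> w; rewrite mem_filter => /andP[].
case: s => [|a [|b s]] //= h /andP[]; rewrite inE => /norP[ab _] _ _.
by exists a, b; rewrite /through ab !h ?inE ?eqxx ?orbT.
Qed.

(** At each port at most one of the two lines occurs, so the cyclic order restricted to them is the
    same in all layouts. *)
Lemma disjoint_unavoidable pi u l1 l2 : is_layout pi ->
  (forall w, ~~ ((l1 \in lines_on u w) && (l2 \in lines_on u w))) ->
  vertex_cross pi u l1 l2 -> unavoidable u l1 l2.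
Proof.
move=> lay disj [k sub] pi' lay'; pose P := pred2 l1 l2.
have E : filter P (around pi u) = filter P (around pi' u).
  rewrite /around !filter_flatten -!map_comp; congr flatten.
  apply/eq_in_map => w uw /=; have [us mem] := lay _ _ uw.
  have [us' mem'] := lay' _ _ uw.
  have one (s s' : seq 'I_(nl I)) : uniq s -> uniq s' -> s =i s' ->
      {in s &, forall x y, x = y} -> s = s'.
    move=> sU s'U ss' xy; have := perm_size (uniq_perm sU s'U ss').
    case: s sU ss' xy => [|a [|b s]] /=; first by case: (s').
      case: s' {s'U} => [|a' []] //= _ ss' _ _.
      by have := ss' a; rewrite !inE eqxx => /esym/eqP->.
    move=> /andP[+ _] _ /(_ a b); rewrite !inE !eqxx orbT => + Eab.
    by rewrite (Eab isT isT) eqxx.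
  apply: one; rewrite ?filter_uniq//.
    by move=> l; rewrite !mem_filter mem mem'.
  move=> x y; rewrite !mem_filter !mem => /andP[/pred2P[]-> h1 /andP[/pred2P[]-> h2]] //;
    by move: (disj w); rewrite h1 h2.
have : subseq [:: l1; l2; l1; l2] (filter P (rot k (around pi u))).
  by rewrite subseq_filter sub /= !eqxx !orbT.
rewrite filter_rot E; set j := size _; have [k' <-] := filter_rotP P j (around pi' u).
by move=> sub'; exists k'; apply: subseq_trans sub' (filter_subseq _ _).
Qed.

(** A crossing needs two occurrences of each line around [u], so both lines pass through it. If they
    share a port there, the two rules exclude the crossing; if not, it is unavoidable. *)
Lemma feasibleI pi : is_layout pi ->
  (forall u v l1 l2 w1 w2, l1 != l2 -> through l1 v u w1 -> through l2 v u w2 ->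
     index w2 (sweep u v) < index w1 (sweep u v) -> precedes (pi u v) l1 l2) ->
  (forall u v w l1 l2, l1 != l2 -> through l1 v u w -> through l2 v u w ->
     precedes (pi u v) l1 l2 -> ~~ precedes (pi u w) l1 l2) ->
  feasible pi.
Proof.
move=> lay A1 A2; split=> // u l1 l2 vc.
have cc := vertex_cross_count vc.
case: (eqVneq l1 l2) => [E|ne].
  have := cc l1; rewrite -E /= !eqxx count_around// => /leq_trans/(_ (ports_le2 _ _)).
  by [].
have [v [w1 th1]] : exists v w, through l1 v u w.
  apply: ports_ge2; rewrite -(count_around _ _ lay); apply: leq_trans (cc l1).
  by rewrite /= !eqxx; lia.
have [v2 [w2 th2]] : exists v w, through l2 v u w.
  apply: ports_ge2; rewrite -(count_around _ _ lay); apply: leq_trans (cc l2).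
  by rewrite /= !eqxx; lia.
have noshare x y z : through l1 x u y -> through l2 x u z -> False.
  move=> t1 t2; have ne' : l2 != l1 by rewrite eq_sym.
  have ux : adj u x by case/and3P: t1 => /lines_on_adj.
  have xy : y \in sweep u x by exact: (through_sweep t1 t1).
  have xz : z \in sweep u x by exact: (through_sweep t2 t2).
  have E := vertex_cross_shared lay ne t1 t2 vc.
  have tot : precedes (pi u x) l1 l2 = ~~ precedes (pi u x) l2 l1.
    have [us mem] := lay _ _ ux; apply: precedes_total; rewrite ?mem//.
      by case/and3P: t1.
    by case/and3P: t2.
  have tot' := sweep_order_total lay ne t1 t2.
  case: (ltngtP (index z (sweep u x)) (index y (sweep u x))) => [lt|lt|Eyz].
  - have := A1 _ _ _ _ _ _ ne t1 t2 lt; rewrite E tot'.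
    by rewrite (sweep_order_ne lay t2 t1 lt).
  - have := A1 _ _ _ _ _ _ ne' t2 t1 lt.
    move: E; rewrite tot (sweep_order_ne lay t1 t2 lt) => /negPf->.
    by [].
  have {Eyz}Ey : z = y by rewrite -(nth_index u xz) Eyz nth_index.
  subst z; have uy : adj u y by case/and3P: t1 => _ /lines_on_adj.
  have toty : precedes (pi u y) l1 l2 = ~~ precedes (pi u y) l2 l1.
    have [us mem] := lay _ _ uy; apply: precedes_total; rewrite ?mem//.
      by case/and3P: t1.
    by case/and3P: t2.
  case p12: (precedes (pi u x) l1 l2).
    have := A2 _ _ _ _ _ ne t1 t2 p12; rewrite toty negbK => p21.
    have := sweep_order_eq t2 p21.
    by move: tot'; rewrite -E p12 => /esym/negPf->.
  have p21 : precedes (pi u x) l2 l1 by move: tot; rewrite p12 => /esym/negbFE.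
  have := A2 _ _ _ _ _ ne' t2 t1 p21.
  rewrite -toty => p'; have := sweep_order_eq t1 p'.
  by rewrite -E p12.
apply: (disjoint_unavoidable lay _ vc) => w; apply/negP => /andP[h1 h2].
have [y ty] : exists y, through l1 w u y.
  by move: h1; rewrite (through_ports _ th1) => /pred2P[->|->];
     [exists w1|exists v; rewrite throughC].
have [z tz] : exists z, through l2 w u z.
  by move: h2; rewrite (through_ports _ th2) => /pred2P[->|->];
     [exists w2|exists v2; rewrite throughC].
exact: noshare ty tz.
Qed.
End Local.

(** * Keys *)

Section Keys.
Variable G : plane_graph.
Implicit Types (u v w : 'I_(nv G)) (s t : seq 'I_(nv G)).

(** For a neighbour [w] other than [v] the value lies strictly between 0 and the degree of [u];
    these two extremes are left for lines that end at [u]. *)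
Definition pos u v w : nat := index w (rot (index v (nbrs u)) (nbrs u)).

(* The position at each vertex of [s], coming from [v], of the edge to the
   next one; a line that ends is first or last at its port according to [b]. *)
Fixpoint keys (b : bool) v s : seq nat :=
  if s is u :: t then
    (if t is w :: _ then pos u v w else if b then size (nbrs u) else 0) :: keys b u t
  else [::].

Definition walk v s : bool := uniq (v :: s) && path (@adj G) v s.

Lemma walk_behead v u s : walk v (u :: s) -> walk u s.
Proof. by rewrite /walk /= => /andP[/and3P[_ -> ->] /andP[_ ->]]. Qed.

Lemma walk_adj v u s : walk v (u :: s) -> adj u v.
Proof. by rewrite /walk /= => /andP[_ /andP[+ _]]; rewrite /adj /= nbrs_sym. Qed.

Lemma walk_adj2 v u w s : walk v [:: u, w & s] -> adj u w /\ w != v.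
Proof.
rewrite /walk /= !inE !negb_or => /andP[/andP[/and3P[_ vw _] _] /and3P[_ -> _]].
by rewrite eq_sym.
Qed.

Lemma pos_gt0 u v w : adj u v -> w != v -> 0 < pos u v w.
Proof.
by move=> /rot_index E wv; rewrite /pos E /= eq_sym (negPf wv).
Qed.

Lemma pos_lt u v w : adj u w -> pos u v w < size (nbrs u).
Proof. by move=> uw; rewrite /pos -(size_rot (index v (nbrs u))) index_mem mem_rot. Qed.

Lemma pos_inj u v w w' : adj u w -> pos u v w = pos u v w' -> w = w'.
Proof.
rewrite /pos; set s := rot _ _ => uw E; have ws : w \in s by rewrite mem_rot.
by rewrite -(nth_index w ws) E nth_index// -index_mem -E index_mem.
Qed.

(** Keys are turning instructions: together with the first edge they determine the walk. *)
Lemma keys_inj b b' v s t : walk v s -> walk v t -> ohead s = ohead t ->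
  keys b v s = keys b' v t -> s = t.
Proof.
elim: s v t => [|u s IH] v [|u' t] //= ws wt [Eu]; subst u'.
case: s IH ws => [|w s] IH ws; case: t wt => [|w' t] wt //=.
move=> [Ep E1 E2]; have [uw _] := walk_adj2 ws; have Ew := pos_inj uw Ep.
congr (u :: _); apply: (IH u) => //=; last by rewrite E1 E2.
- exact: walk_behead ws.
- exact: walk_behead wt.
- by rewrite Ew.
Qed.

(** A side matters only if the comparison reaches the end of a line, that is, if one walk is a
    prefix of the other. The key there is extreme, so the comparison comes down to the literals [b1]
    and [~~ b2]; [e1] and [e2] tell which of them occur. *)
Lemma keys_lt_literals v u s t : walk v (u :: s) -> walk v (u :: t) ->
  exists c e1 e2, [/\ forall b1 b2,
      lexlt (keys b2 v (u :: t)) (keys b1 v (u :: s)) =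
      [&& c, e1 ==> b1 & e2 ==> ~~ b2],
    e1 -> prefix (u :: s) (u :: t) & e2 -> prefix (u :: t) (u :: s)].
Proof.
elim: s v u t => [|w s IH] v u [|w' t] ws wt; have uv := walk_adj ws;
  have deg : 0 < size (nbrs u) by move: uv; rewrite /adj /=; case: (nbrs u).
- exists true, true, true; split=> [b1 b2|_|_] //=; rewrite ?eqxx//.
  by case: b1 b2 => [] []; rewrite /= ?eqxx ?deg//; case: eqP; lia.
- have [uw wv] := walk_adj2 wt; have p0 := pos_gt0 uv wv; have pd := pos_lt v uw.
  exists true, true, false; split=> [b1 b2|_|//]; last by rewrite /= eqxx.
  rewrite /= andbT; case: b1; case: eqP => //; lia.
- have [uw wv] := walk_adj2 ws; have p0 := pos_gt0 uv wv; have pd := pos_lt v uw.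
  exists true, false, true; split=> [b1 b2|//|_]; last by rewrite /= eqxx.
  rewrite /=; case: b2; case: eqP => //; lia.
case: (eqVneq w w') => [E|ne].
  subst w'; have [c [e1 [e2 [H H1 H2]]]] := IH _ _ t (walk_behead ws) (walk_behead wt).
  exists c, e1, e2; split=> [b1 b2|/H1|/H2] /=; rewrite ?eqxx//.
  by rewrite -H.
exists (pos u v w' < pos u v w), false, false; split=> // b1 b2.
rewrite [lexlt _ _]/= andbT; case: eqP => // E; case/eqP: ne.
by apply/esym/(pos_inj _ E); case: (walk_adj2 wt).
Qed.

(** The analogue for the first key alone, which is extreme only if the walk stops at [u]. *)
Lemma head_keys_lt_literals v u s t : walk v (u :: s) -> walk v (u :: t) ->
  exists c e1 e2, [/\ forall b1 b2,
      (head 0 (keys b2 v (u :: t)) < head 0 (keys b1 v (u :: s))) =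
      [&& c, e1 ==> b1 & e2 ==> ~~ b2],
    e1 -> s = [::] & e2 -> t = [::]].
Proof.
move=> ws wt; have uv := walk_adj ws.
have deg : 0 < size (nbrs u) by move: uv; rewrite /adj /=; case: (nbrs u).
case: s ws => [|w s] ws; case: t wt => [|w' t] wt.
- exists true, true, true; split=> // b1 b2 /=.
  by case: b1 b2 => [] []; rewrite /= ?deg; lia.
- have [uw wv] := walk_adj2 wt; have p0 := pos_gt0 uv wv; have pd := pos_lt v uw.
  by exists true, true, false; split=> // b1 b2 /=; rewrite andbT; case: b1; lia.
- have [uw wv] := walk_adj2 ws; have p0 := pos_gt0 uv wv; have pd := pos_lt v uw.
  by exists true, false, true; split=> // b1 b2 /=; case: b2; lia.
by exists (pos u v w' < pos u v w), false, false; split=> // b1 b2 /=; rewrite andbT.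
Qed.
End Keys.

(* [h] tells that the two lines arrive in the order in which they left the start
   of their common subpath: this takes an edge crossing [g], which pays for the
   item [f] at the end of the subpath. *)
Lemma amortize (T : eqType) (ds : seq T) (f g h : pred T) :
  {in ds, forall d, f d -> h d} ->
  (forall d ds', ds = d :: ds' -> h d -> g d) ->
  (forall d d', (d, d') \in pairs ds -> h d' -> g d' || (h d && ~~ f d)) ->
  count f ds <= count g ds.
Proof.
case: ds => // d ds fh /(_ d ds erefl) h0 hs.
(* [h d && ~~ f d] is the credit left after [d]: a crossing paid for and not yet used by an item. *)
suff H : count f ds <= count g ds + (h d && ~~ f d).
  have := fh d (mem_head _ _); rewrite /=.
  by move: H h0; case: (f d) (h d) (g d) => [] [] [] /= H h0 h1; lia.
have {}fh : {in ds, forall d, f d -> h d}.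
  by move=> e eds; apply: fh; rewrite inE eds orbT.
elim: ds d fh hs {h0} => [|e ds IH] d fh hs //=.
have le : count f ds <= count g ds + (h e && ~~ f e).
  apply: IH => [a ads|a b ab]; first by apply: fh; rewrite inE ads orbT.
  by apply: hs; rewrite -[pairs _]/((d, e) :: pairs (e :: ds)) inE ab orbT.
have := hs d e (mem_head _ _); have := fh e (mem_head _ _).
move: le; case: (f e) (h e) (g e) (h d && ~~ f d) => [] [] [] [] /= *; lia.
Qed.

(** * Layouts of directed lines *)

Lemma sorted_suffix (T : Type) (e : rel T) (p : seq T) a s :
  sorted e (p ++ a :: s) -> path e a s.
Proof. by case: p => //= b p; rewrite cat_path /= => /and3P[]. Qed.

Lemma pairwise_of_precedes (T : eqType) (f : T -> nat) (s : seq T) : uniq s ->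
  {in s &, forall a b, f b < f a -> subseq [:: a; b] s} ->
  pairwise (fun a b => f b <= f a) s.
Proof.
elim: s => //= a s IH /andP[a_s us] H; apply/andP; split.
  apply/allP => b bs; rewrite leqNgt; apply/negP => lt.
  have := H b a; rewrite !inE eqxx bs orbT => /(_ isT isT lt).
  rewrite ifN; last by apply: contraNneq a_s => <-.
  by move=> /mem_subseq/(_ a); rewrite !inE eqxx orbT (negPf a_s) => /(_ isT).
apply: IH => // b c bs cs lt; have := H b c; rewrite !inE bs cs !orbT.
move=> /(_ isT isT lt); rewrite ifN//.
by apply: contraNneq a_s => <-.
Qed.

Lemma split_by_key (T : eqType) (f : T -> nat) k (s : seq T) :
  pairwise (fun a b => f b <= f a) s ->
  s = filter (fun a => k <= f a) s ++ filter (fun a => f a < k) s.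
Proof.
elim: s => //= a s IH /andP[/allP H /IH E]; case: leqP => [le|lt] /=.
  by rewrite -E.
have lts : {in s, forall b, f b < k} by move=> b /H le; apply: leq_ltn_trans le lt.
have -> : filter (fun a => k <= f a) s = [::].
  by apply/eqP; rewrite -[_ == _]negbK -has_filter; apply/hasPn => b /lts; rewrite ltnNge.
by congr cons; apply/esym/all_filterP/allP.
Qed.

Lemma pairs_uniq (T : eqType) (s : seq T) : uniq s -> uniq (pairs s).
Proof. exact: zip_uniql. Qed.

Lemma count_finType (T : finType) (a : pred T) (s : seq T) : uniq s ->
  count a s = \sum_d ((d \in s) && a d : nat).
Proof.
move=> us; rewrite -size_filter -(card_uniqP (filter_uniq a us)) -sum1_card.
by rewrite big_mkcond; apply: eq_bigr => d _; rewrite mem_filter andbC; case: (_ && _).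
Qed.

Lemma pairs_consecutive (T : eqType) (s : seq T) d d' :
  (d, d') \in pairs (pairs s) -> d.2 = d'.1.
Proof.
elim: s => [|a [|b [|c s]] IH] //.
rewrite -[pairs [:: a, b, c & s]]/((a, b) :: pairs [:: b, c & s]).
rewrite -[pairs (_ :: _)]/(((a, b), (b, c)) :: pairs (pairs [:: b, c & s])) inE.
by case/predU1P => [[-> ->]|/IH].
Qed.

Lemma leq_count_in (T : eqType) (a b : pred T) (s : seq T) :
  {in s, forall d, a d -> b d} -> count a s <= count b s.
Proof.
elim: s => //= d s IH H; apply: leq_add.
  by have := H d (mem_head _ _); case: (a d) => // ->.
by apply: IH => e es; apply: H; rewrite inE es orbT.
Qed.

Lemma lexlt_head s t : s != [::] -> lexlt s t ->
  head 0 s < head 0 t \/ head 0 s = head 0 t /\ lexlt (behead s) (behead t).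
Proof.
case: s t => [|m s] [|n t] //= _; case: eqP => [->|_]; [by right|by left].
Qed.

Lemma sumn_enum (T : finType) (f : T -> nat) : sumn (map f (enum T)) = \sum_i f i.
Proof. by rewrite sumnE big_map big_enum. Qed.

Section DirectedDefs.
Variables (I : instance) (D : 'I_(nl I) -> seq 'I_(nv I)).
Implicit Types (u v w : 'I_(nv I)) (l : 'I_(nl I)).

Definition traverses l u v : bool := (u, v) \in pairs (D l).

Definition bwd_path l u := rev (take (index u (D l)).+1 (D l)).
Definition fwd_path l u := drop (index u (D l)) (D l).

(* [x l false] ([x l true]) tells whether [l] is clockwise first at the port of
   its first (last) vertex. *)
Variable x : 'I_(nl I) -> bool -> bool.

Definition bwd_keys l u v := keys (x l false) v (bwd_path l u).
Definition fwd_keys l u v := keys (x l true) u (fwd_path l v).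

(* Lines at the first port of an edge are sorted by where they come from, ties
   being broken by where they go.  At the second port they are sorted by the next
   vertex, hence two lines can only cross on the last edge they share. *)
Definition tail_before u v l1 l2 : bool :=
  lex2 (fun s t => lexlt t s) lexlt
    (bwd_keys l1 u v, fwd_keys l1 u v) (bwd_keys l2 u v, fwd_keys l2 u v).

(** The tie-break after the next vertex is the converse of [tail_before], since lines running in
    parallel without a crossing have opposite clockwise orders at the two ports of an edge. *)
Definition head_before u v l1 l2 : bool :=
  lex2 (fun m n => n < m) (lex2 lexlt (fun s t => lexlt t s))
    (head 0 (fwd_keys l1 u v), (bwd_keys l1 u v, fwd_keys l1 u v))
    (head 0 (fwd_keys l2 u v), (bwd_keys l2 u v, fwd_keys l2 u v)).

(** If some line traverses the edge from [u] to [v], this is its tail port; every other port, also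
    one without lines, is treated as a head port. *)
Definition sorted_layout : layout I := fun u v =>
  if has (fun l => traverses l u v) (enum 'I_(nl I)) then
    isort (tail_before u v) [seq l <- enum 'I_(nl I) | traverses l u v]
  else isort (head_before v u) [seq l <- enum 'I_(nl I) | traverses l v u].

(** Both comparisons go the same way, so the two lines have to cross before their common subpath
    ends. As the first forward keys differ, only the last edge of that subpath can be an item. *)
Definition cost_item l1 l2 (d : 'I_(nv I) * 'I_(nv I)) : bool :=
  (head 0 (fwd_keys l2 d.1 d.2) < head 0 (fwd_keys l1 d.1 d.2)) &&
  lexlt (bwd_keys l2 d.1 d.2) (bwd_keys l1 d.1 d.2).

(* The item as a function of the four sides involved; [arc_tail] and [arc_head]
   probe it at constants to find the sides on which it depends. *)
Definition item_under (s1 e1 s2 e2 : bool) l1 l2 (d : 'I_(nv I) * 'I_(nv I)) : bool :=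
  (head 0 (keys e2 d.1 (fwd_path l2 d.2)) < head 0 (keys e1 d.1 (fwd_path l1 d.2))) &&
  lexlt (keys s2 d.2 (bwd_path l2 d.1)) (keys s1 d.2 (bwd_path l1 d.1)).

Definition cost : nat := \sum_(p : 'I_(nl I) * 'I_(nl I))
  count (fun d => traverses p.2 d.1 d.2 && cost_item p.1 p.2 d) (pairs (D p.1)).

End DirectedDefs.

Section CutGraph.
Variables (I : instance) (D : 'I_(nl I) -> seq 'I_(nv I)).

(* The source is [(None, true)] and the sink [(None, false)]; [(Some l, e)] stands
   for the side of [l] at its end [e]. *)
Definition node : Type := (option 'I_(nl I) * bool)%type.

Definition arc_tail l1 l2 d : node :=
  if ~~ item_under D false true false false l1 l2 d then (Some l1, false)
  else if ~~ item_under D true false false false l1 l2 d then (Some l1, true)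
  else (None, true).

Definition arc_head l1 l2 d : node :=
  if ~~ item_under D true true true false l1 l2 d then (Some l2, false)
  else if ~~ item_under D true true false true l1 l2 d then (Some l2, true)
  else (None, false).

(** The assignment [true true false false] favours the item most; where it fails, the item never
    occurs and gives no arc. *)
Definition pair_arcs l1 l2 : seq (node * node) :=
  if l1 == l2 then [::] else
  [seq (arc_tail l1 l2 d, arc_head l1 l2 d)
    | d <- pairs (D l1) & traverses D l2 d.1 d.2 &&
                          item_under D true true false false l1 l2 d].

Definition cut_arcs : seq (node * node) :=
  flatten [seq flatten [seq pair_arcs l1 l2 | l2 <- enum 'I_(nl I)]
             | l1 <- enum 'I_(nl I)].

Definition side_of (x : 'I_(nl I) -> bool -> bool) (n : node) : bool :=
  if n.1 is Some l then x l n.2 else n.2.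

Definition min_cut : seq node := mincut cut_arcs (None, true) (None, false).

Definition min_sides l b : bool := (Some l, b) \in min_cut.
End CutGraph.

(** * Admissibility and crossings of the sorted layout *)

Section Directed.
Variables (I : instance) (D : 'I_(nl I) -> seq 'I_(nv I)).
Implicit Types (u v w : 'I_(nv I)) (l : 'I_(nl I)) (pi : layout I).
Implicit Type x : 'I_(nl I) -> bool -> bool.
Hypothesis D_line : forall l, D l = line l \/ D l = rev (line l).
Hypothesis D_dir : forall l l' u v, traverses D l u v -> ~~ traverses D l' v u.

Local Notation on := (traverses D).
Local Notation bwd := (bwd_path D).
Local Notation fwd := (fwd_path D).
Local Notation back := (bwd_keys D).
Local Notation forw := (fwd_keys D).
Local Notation sol := (sorted_layout D).

Lemma D_uniq l : uniq (D l).
Proof. by case: (D_line l) => ->; rewrite ?rev_uniq line_uniq. Qed.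

Lemma D_sorted l : sorted (@adj I) (D l).
Proof.
have sl : sorted (@adj I) (line l) by case/and3P: (line_simple l).
case: (D_line l) => -> //; rewrite rev_sorted.
by rewrite (eq_sorted (e' := @adj I)) // => u v; rewrite adj_sym.
Qed.

Lemma D_inj l l' : D l = D l' -> l = l'.
Proof.
move=> E; apply: line_inj; rewrite /same_path.
case: (D_line l) (D_line l') E => -> [] ->.
- by move=> ->; rewrite eqxx.
- by move=> ->; rewrite eqxx orbT.
- by move=> <-; rewrite revK eqxx orbT.
- by move=> /(can_inj revK)->; rewrite eqxx.
Qed.

Lemma lines_on_on l u v : (l \in lines_on u v) = on l u v || on l v u.
Proof.
rewrite in_lines_on /traverses; case: (D_line l) => -> //.
by rewrite !pairs_rev orbC.
Qed.

Lemma on_decompose l A u v B : D l = rev A ++ [:: u, v & B] ->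
  [/\ bwd l u = u :: A, fwd l v = v :: B, walk v (u :: A), walk u (v :: B)
    & terminal l u = nilp A].
Proof.
move=> E; have us := D_uniq l; have ss := D_sorted l.
have iu : index u (D l) = size A.
  move: us; rewrite E cat_uniq => /and3P[_ /hasPn up _].
  by rewrite index_cat /= eqxx addn0 size_rev ifN// (up u) ?mem_head.
have uB : uniq [:: u, v & B] by move: us; rewrite E cat_uniq => /and3P[].
have uA : uniq (rev A ++ [:: u]).
  by move: us; rewrite E -cat1s catA cat_uniq => /and3P[].
have uv : u != v by move: uB; rewrite /= inE negb_or => /andP[/andP[]].
have iv : index v (D l) = (size A).+1.
  move: us; rewrite E cat_uniq => /and3P[_ /hasPn up _].
  rewrite index_cat /= eqxx (negPf uv) size_rev addn1 ifN// (up v)//.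
  by rewrite !inE eqxx orbT.
have E' : D l = rev (u :: A) ++ v :: B by rewrite E rev_cons cat_rcons.
have Er : rev (D l) = rev B ++ [:: v, u & A].
  by rewrite E rev_cat !rev_cons revK !cat_rcons.
have sr : sorted (@adj I) (rev (D l)).
  rewrite rev_sorted (eq_sorted (e' := @adj I)) // => a b; exact: adj_sym.
split.
- by rewrite /bwd_path iu E' -[(size A).+1]/(size (u :: A)) -size_rev take_size_cat// revK.
- by rewrite /fwd_path iv E' -[(size A).+1]/(size (u :: A)) -size_rev drop_size_cat.
- rewrite /walk; apply/andP; split.
    by move: us; rewrite -rev_uniq Er cat_uniq => /and3P[].
  by move: sr; rewrite Er; apply: sorted_suffix.
- rewrite /walk; apply/andP; split.
    by move: us; rewrite E cat_uniq => /and3P[].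
  by move: ss; rewrite E; apply: sorted_suffix.
have -> : terminal l u = (head u (D l) == u) || (last u (D l) == u).
  have head_last (t : seq 'I_(nv I)) : head u (rev t) = last u t.
    by case/lastP: t => // t b; rewrite rev_rcons last_rcons.
  rewrite /terminal; case: (D_line l) => -> //.
  by rewrite head_last -[last u (rev _)]head_last revK orbC.
have -> : (last u (D l) == u) = false.
  rewrite E last_cat /=; apply/negP => /eqP Eu.
  by move: uB; rewrite -{1}Eu /= mem_last.
rewrite orbF E; case: A uA {E E' iu iv Er} => [|a A] uA /=; first by rewrite eqxx.
apply/negbTE; apply: contraTneq uA => Eu.
have : u \in a :: A by rewrite -Eu lastI rev_rcons /= -lastI mem_last.
by rewrite cat_uniq /= mem_rev => ->; rewrite andbF.
Qed.

Lemma onP l u v : on l u v -> exists A B, D l = rev A ++ [:: u, v & B].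
Proof. by case/pairsP => p [t ->]; exists (rev p), t; rewrite revK. Qed.

Lemma on_step l u v w : on l u v -> on l v w ->
  bwd l v = v :: bwd l u /\ fwd l v = v :: fwd l w.
Proof.
move=> /onP[A [B E]] /pairsP[p [t E']]; have uD := D_uniq l.
have E1 : D l = rev (u :: A) ++ v :: B by rewrite E rev_cons cat_rcons.
have [_ EB] : rev (u :: A) = p /\ B = w :: t.
  by apply: (@uniq_split _ _ _ _ _ v); rewrite -E1.
subst B; have [-> -> _ _ _] := on_decompose E.
by have [-> -> _ _ _] := on_decompose E1.
Qed.

Lemma on_terminalF l u v w : on l u v -> on l v w -> ~~ terminal l v.
Proof.
move=> /onP[A [B E]] /pairsP[p [t E']]; have uD := D_uniq l.
have E1 : D l = rev (u :: A) ++ v :: B by rewrite E rev_cons cat_rcons.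
have [_ EB] : rev (u :: A) = p /\ B = w :: t.
  by apply: (@uniq_split _ _ _ _ _ v); rewrite -E1.
by subst B; have [_ _ _ _ ->] := on_decompose E1.
Qed.

(** The first key of the part of [l] beyond [u], whichever way the edge is traversed. This is the
    number by which every port is sorted. *)
Definition pkey x l u v : nat :=
  if on l u v then head 0 (back x l u v) else head 0 (forw x l v u).

Lemma tail_port x l u v : on l u v ->
  terminal l u /\ head 0 (back x l u v) = (if x l false then size (nbrs u) else 0)
  \/ exists2 w, through l v u w & on l w u /\ intermediate l u.
Proof.
move=> l_uv; have [A [B E]] := onP l_uv.
have [bE _ _ _ tE] := on_decompose E.
case: A E bE tE => [|w A] E bE tE; first by left; rewrite tE /bwd_keys bE.
right; have l_wu : on l w u.
  by apply/pairsP; exists (rev A), (v :: B); rewrite E rev_cons cat_rcons.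
exists w; last first.
  split=> //; rewrite /intermediate tE andbT.
  have : u \in D l by have [_ ->] := pairs_mem l_wu.
  by case: (D_line l) => ->; rewrite ?mem_rev.
rewrite /through !lines_on_on l_uv l_wu orbT /=.
by apply: contraTneq l_uv => ->; apply: D_dir l_wu.
Qed.

Lemma head_port x l u v : on l u v ->
  terminal l v /\ head 0 (forw x l u v) = (if x l true then size (nbrs v) else 0)
  \/ exists2 w, through l u v w & on l v w /\ intermediate l v.
Proof.
move=> l_uv; have [A [B E]] := onP l_uv.
have [_ fE _ _ _] := on_decompose E.
have E' : D l = rev (u :: A) ++ v :: B by rewrite E rev_cons cat_rcons.
case: B E E' fE => [|w B] E E' fE.
  left; rewrite /fwd_keys fE; split=> //; rewrite /terminal.
  case: (D_line l) E' => [<- ->|EDl]; first by rewrite last_cat eqxx orbT.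
  by move/(congr1 rev); rewrite EDl revK => ->; rewrite rev_cat /= eqxx.
have [_ _ _ _ tE] := on_decompose E'.
have l_vw : on l v w by apply/pairsP; exists (rev (u :: A)), B.
right; exists w.
  rewrite /through !lines_on_on l_uv l_vw orbT /=.
  by apply: contraTneq l_uv => ->; apply: D_dir l_vw.
split=> //; rewrite /intermediate tE andbT.
have : v \in D l by have [_ ->] := pairs_mem l_uv.
by case: (D_line l) => ->; rewrite ?mem_rev.
Qed.

Lemma on_through l u v w : on l u v -> on l v w -> through l u v w.
Proof.
move=> l1 l2; rewrite /through !lines_on_on l1 l2 orbT /=.
by apply: contraTneq l1 => ->; apply: D_dir l2.
Qed.

Lemma through_on l u v w : through l u v w -> on l u v -> on l v w.
Proof.
move=> /and3P[_]; rewrite lines_on_on => /orP[//|wv] uw uv.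
by rewrite (pairs_fun_rev (D_uniq l) uv wv) eqxx in uw.
Qed.

Lemma on_through2 l u v w : through l u v w -> ~~ on l u v -> on l w v /\ on l v u.
Proof.
case/and3P=> lu lw uw /negPf nuv; move: lu lw; rewrite !lines_on_on nuv orbF.
move=> vu /orP[vw|wv]; last by split.
by rewrite (pairs_fun (D_uniq l) vu vw) eqxx in uw.
Qed.

Lemma keys_step x l u v w : on l u v -> on l v w ->
  back x l v w = pos v w u :: back x l u v /\
  forw x l u v = pos v u w :: forw x l v w.
Proof.
move=> l_uv l_vw; have [bE fE] := on_step l_uv l_vw.
rewrite /bwd_keys /fwd_keys bE fE.
have [A [B E]] := onP l_uv; have [-> _ _ _ _] := on_decompose E.
by have [A' [B' E']] := onP l_vw; have [_ -> _ _ _] := on_decompose E'.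
Qed.

Lemma on_terminal_first l u v : on l u v -> terminal l u -> exists B, D l = [:: u, v & B].
Proof.
move=> /onP[A [B E]]; have [_ _ _ _ ->] := on_decompose E.
by case: A E => // -> _; exists B.
Qed.

Lemma through_pos l u v w : through l v u w -> pos u v w = (index w (sweep u v)).+1.
Proof.
move=> th; case/and3P: (th) => /lines_on_adj uv _ vw.
by rewrite /pos sweepE//= (negPf vw).
Qed.

(** [~~ on l u v] names the end of [l] at [u]: [false] if the line starts with this edge, [true] if
    it stops with it. *)
Lemma port_cases x l u v : l \in lines_on u v ->
  terminal l u /\ pkey x l u v = (if x l (~~ on l u v) then size (nbrs u) else 0)
  \/ exists2 w, through l v u w & intermediate l u /\ pkey x l u v = pos u v w.
Proof.
rewrite lines_on_on /pkey => l_on; case: ifP l_on => [l_uv _|_ /= l_vu].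
  case: (tail_port x l_uv) => [|[w th [l_wu int]]]; [by left|right].
  by exists w => //; split=> //; have [->] := keys_step x l_wu l_uv.
case: (head_port x l_vu) => [|[w th [l_uw int]]]; [by left|right].
by exists w => //; split=> //; have [_ ->] := keys_step x l_vu l_uw.
Qed.

Lemma terminalN l u : intermediate l u -> ~~ terminal l u.
Proof. by case/andP. Qed.

Lemma through_pkey x l u v w : through l v u w -> pkey x l u v = (index w (sweep u v)).+1.
Proof.
move=> th; case/and3P: (th) => lv lw vw; rewrite -(through_pos th).
case: (port_cases x lv) => [[tu _]|[w' th' [_ ->]]]; last first.
  by move: lw; rewrite (through_ports _ th') eq_sym (negPf vw) => /eqP->.
move: lv; rewrite lines_on_on => /orP[l_uv|l_vu].
  have [l_wu _] := on_through2 th (D_dir l l_uv).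
  by move: (on_terminalF l_wu l_uv); rewrite tu.
by move: (on_terminalF l_vu (through_on th l_vu)); rewrite tu.
Qed.

Section Order.
Variables (x : 'I_(nl I) -> bool -> bool) (u v : 'I_(nv I)).

Lemma tail_key_inj l1 l2 : on l1 u v -> on l2 u v ->
  back x l1 u v = back x l2 u v -> forw x l1 u v = forw x l2 u v -> l1 = l2.
Proof.
move=> /onP[A [B E]] /onP[A' [B' E']]; rewrite /bwd_keys /fwd_keys.
have [-> -> wA wB _] := on_decompose E; have [-> -> wA' wB' _] := on_decompose E'.
move=> /(keys_inj wA wA' erefl)[EA] /(keys_inj wB wB' erefl)[EB].
by apply: D_inj; rewrite E E' EA EB.
Qed.

Lemma tail_before_strict : irreflexive (tail_before D x u v) /\
  transitive (tail_before D x u v).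
Proof.
have [i t _] := lex2_strict (converse_strict lexlt_strict) lexlt_strict.
by split=> [l|l l1 l2]; [apply: i|apply: t].
Qed.

Lemma head_before_strict : irreflexive (head_before D x u v) /\
  transitive (head_before D x u v).
Proof.
have [i t _] := lex2_strict (converse_strict ltn_strict)
  (lex2_strict lexlt_strict (converse_strict lexlt_strict)).
by split=> [l|l l1 l2]; [apply: i|apply: t].
Qed.

Lemma tail_before_total l1 l2 : on l1 u v -> on l2 u v -> l1 != l2 ->
  tail_before D x u v l1 l2 || tail_before D x u v l2 l1.
Proof.
move=> h1 h2 ne.
have [_ _] := lex2_strict (converse_strict lexlt_strict) lexlt_strict; apply.
by apply: contra_neq ne => -[]; apply: tail_key_inj.
Qed.

Lemma head_before_total l1 l2 : on l1 u v -> on l2 u v -> l1 != l2 ->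
  head_before D x u v l1 l2 || head_before D x u v l2 l1.
Proof.
move=> h1 h2 ne.
have [_ _] := lex2_strict (converse_strict ltn_strict)
  (lex2_strict lexlt_strict (converse_strict lexlt_strict)); apply.
by apply: contra_neq ne => -[_]; apply: tail_key_inj.
Qed.

Definition lines_from := [seq l <- enum 'I_(nl I) | on l u v].

Lemma mem_lines_from l : (l \in lines_from) = on l u v.
Proof. by rewrite mem_filter mem_enum andbT. Qed.

Lemma lines_from_uniq : uniq lines_from.
Proof. by rewrite filter_uniq// enum_uniq. Qed.

Lemma sol_tail l : on l u v -> sol x u v = isort (tail_before D x u v) lines_from.
Proof.
by move=> h; rewrite /sorted_layout ifT//; apply/hasP; exists l; rewrite ?mem_enum.
Qed.

Lemma sol_head l : on l u v -> sol x v u = isort (head_before D x u v) lines_from.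
Proof.
move=> h; rewrite /sorted_layout ifF//; apply/hasP => [[l' _]].
by apply/negP; apply: D_dir h.
Qed.

Lemma tail_sorted : pairwise (tail_before D x u v) (isort (tail_before D x u v) lines_from).
Proof.
apply: isort_pairwise; [exact: tail_before_strict.2|exact: lines_from_uniq|].
by move=> l1 l2; rewrite !mem_lines_from; apply: tail_before_total.
Qed.

Lemma head_sorted : pairwise (head_before D x u v) (isort (head_before D x u v) lines_from).
Proof.
apply: isort_pairwise; [exact: head_before_strict.2|exact: lines_from_uniq|].
by move=> l1 l2; rewrite !mem_lines_from; apply: head_before_total.
Qed.

Lemma sol_tail_precedes l1 l2 : on l1 u v -> on l2 u v -> l1 != l2 ->
  precedes (sol x u v) l1 l2 = tail_before D x u v l1 l2.
Proof.
move=> h1 h2 ne; rewrite (sol_tail h1); have [i t] := tail_before_strict.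
have P := isort_perm (tail_before D x u v) lines_from.
apply: pairwise_precedes; rewrite ?(perm_mem P) ?mem_lines_from//.
  by rewrite (perm_uniq P) lines_from_uniq.
exact: tail_sorted.
Qed.

Lemma sol_head_precedes l1 l2 : on l1 u v -> on l2 u v -> l1 != l2 ->
  precedes (sol x v u) l1 l2 = head_before D x u v l1 l2.
Proof.
move=> h1 h2 ne; rewrite (sol_head h1); have [i t] := head_before_strict.
have P := isort_perm (head_before D x u v) lines_from.
apply: pairwise_precedes; rewrite ?(perm_mem P) ?mem_lines_from//.
  by rewrite (perm_uniq P) lines_from_uniq.
exact: head_sorted.
Qed.
End Order.

Lemma lines_onP u v l : l \in lines_on u v ->
  (forall l', (l' \in lines_on u v) = on l' u v) \/
  (forall l', (l' \in lines_on u v) = on l' v u).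
Proof.
rewrite lines_on_on => /orP[h|h]; [left|right] => l'; rewrite lines_on_on.
  by rewrite (negPf (D_dir l' h)) orbF.
by rewrite (negPf (D_dir l' h)).
Qed.

Lemma sol_layout x : is_layout (sol x).
Proof.
move=> u v uv; rewrite /sorted_layout.
case: ifPn => [/hasP[l _ l_uv]|/hasPn no].
  have P := isort_perm (tail_before D x u v) (lines_from u v).
  split; first by rewrite (perm_uniq P) lines_from_uniq.
  by move=> l'; rewrite (perm_mem P) mem_lines_from lines_on_on (negPf (D_dir l' l_uv)) orbF.
have P := isort_perm (head_before D x v u) (lines_from v u).
split; first by rewrite (perm_uniq P) lines_from_uniq.
move=> l'; rewrite (perm_mem P) mem_lines_from lines_on_on.
by rewrite (negPf (no l' _)) ?mem_enum.
Qed.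

(** Both sorting criteria look first at the key at their own port. *)
Lemma sol_pkey_precedes x u v l1 l2 :
  l1 \in lines_on u v -> l2 \in lines_on u v ->
  pkey x l2 u v < pkey x l1 u v -> precedes (sol x u v) l1 l2.
Proof.
move=> h1 h2 lt; have ne : l1 != l2 by apply: contraTneq lt => ->; rewrite ltnn.
have hf l a b : on l a b -> forall s t : seq nat, s != [::] -> head 0 s < head 0 t -> lexlt s t.
  by move=> _ [|m s] [|n t] //= _ mn; case: eqP => // E; rewrite E ltnn in mn.
case: (lines_onP h1) => H; move: h1 h2; rewrite !H => h1 h2.
  rewrite sol_tail_precedes// /tail_before /lex2 /=.
  move: lt; rewrite /pkey h1 h2 => lt; rewrite (hf _ _ _ h1)//.
  have [A [B E]] := onP h2; have [bE _ _ _ _] := on_decompose E.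
  by rewrite /bwd_keys bE.
rewrite sol_head_precedes// /head_before /lex2 /=.
by move: lt; rewrite /pkey (negPf (D_dir l1 h1)) (negPf (D_dir l2 h1)) => ->.
Qed.

Lemma sol_pkey_sorted x u v : adj u v ->
  pairwise (fun l1 l2 => pkey x l2 u v <= pkey x l1 u v) (sol x u v).
Proof.
move=> uv; have [us mem] := sol_layout x uv.
apply: pairwise_of_precedes => // l1 l2; rewrite !mem.
exact: sol_pkey_precedes.
Qed.

Lemma sol_periphery x u v : adj u v -> periphery (sol x) u v.
Proof.
move=> uv; have [us mem] := sol_layout x uv.
have srt := sol_pkey_sorted x uv; set d := size (nbrs u).
have d0 : 0 < d by move: uv; rewrite /adj /d /=; case: (nbrs u).
(* Keys are [d] or 0 for lines ending at [u] and strictly in between for the others, so the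
   thresholds [d] and 1 cut out the three groups. *)
have E1 := split_by_key d srt; set s1 := filter _ _ in E1; set s' := filter _ _ in E1.
have E2 : s' = filter (fun l => 1 <= pkey x l u v) s' ++ filter (fun l => pkey x l u v < 1) s'.
  by apply: split_by_key; apply: pairwise_filter.
exists s1, (filter (fun l => 1 <= pkey x l u v) s'), (filter (fun l => pkey x l u v < 1) s').
have term l w : through l v u w -> 0 < pos u v w < d.
  move=> /and3P[_ /lines_on_adj uw vw]; rewrite pos_lt// pos_gt0//.
  by rewrite eq_sym.
split; first by rewrite -E2.
- move=> l; rewrite mem_filter mem => /andP[le /port_cases-/(_ x)].
  by case=> [[]//|[w /term/andP[_ lt] [_ E]]]; move: le; rewrite E leqNgt lt.
- move=> l; rewrite !mem_filter mem => /and3P[gt0 lt /port_cases-/(_ x)].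
  case=> [[_ E]|[w _ [//]]].
  by move: gt0 lt; rewrite E; case: (x _ _); rewrite ?ltnn.
move=> l; rewrite !mem_filter mem => /and3P[le0 _ /port_cases-/(_ x)].
case=> [[]//|[w /term/andP[gt0 _] [_ E]]].
by move: le0; rewrite E ltnNge gt0.
Qed.

(** Passing [v] side by side prepends equal keys for both lines, so the lexicographic comparisons
    stay as they are and only the sense of the port changes. *)
Lemma tail_head_flip x u v w l1 l2 : on l1 u v -> on l2 u v -> on l1 v w -> on l2 v w ->
  tail_before D x v w l1 l2 = head_before D x u v l2 l1.
Proof.
move=> a1 a2 b1 b2; rewrite /tail_before /head_before /lex2 /=.
have [-> ->] := keys_step x a1 b1; have [-> ->] := keys_step x a2 b2.
by rewrite /= !eqxx ltnn /= eqseq_cons eqxx /= [_ == back x l1 u v]eq_sym.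
Qed.

Lemma sol_feasible x : feasible (sol x).
Proof.
have lay := sol_layout x; apply: feasibleI => //.
  move=> u v l1 l2 w1 w2 _ t1 t2 lt; apply: sol_pkey_precedes.
  - by case/and3P: t1.
  - by case/and3P: t2.
  by rewrite (through_pkey x t1) (through_pkey x t2).
move=> u v w l1 l2 ne t1 t2; have ne' : l2 != l1 by rewrite eq_sym.
case/and3P: (t1) => lv1 lw1 vw; case/and3P: (t2) => lv2 lw2 _.
have tot : precedes (sol x u w) l2 l1 = ~~ precedes (sol x u w) l1 l2.
  have [us mem] := lay _ _ (lines_on_adj lw1).
  by apply: precedes_total; rewrite ?mem.
rewrite -tot; case: (lines_onP lv1) => H; move: lv1 lv2; rewrite !H => h1 h2.
  have [g1 _] := on_through2 t1 (D_dir l1 h1).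
  have [g2 _] := on_through2 t2 (D_dir l2 h2).
  by rewrite (sol_tail_precedes x h1 h2 ne) (sol_head_precedes x g2 g1 ne')
    (tail_head_flip x g1 g2 h1 h2).
have g1 := through_on t1 h1; have g2 := through_on t2 h2.
by rewrite (sol_head_precedes x h1 h2 ne) (sol_tail_precedes x g2 g1 ne')
  (tail_head_flip x h2 h1 g2 g1).
Qed.

Lemma sol_admissible x : MLCM_P_admissible (sol x).
Proof. by split; [exact: sol_feasible|exact: sol_periphery]. Qed.

(** All lines on an edge traverse it in one direction, so a crossing of the pair is counted at
    exactly one dart of the first line. *)
Lemma crossingsE pi : is_layout pi -> crossings pi =
  \sum_(p : 'I_(nl I) * 'I_(nl I))
    count (fun d => on p.2 d.1 d.2 && edge_cross pi d.1 d.2 p.1 p.2) (pairs (D p.1)).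
Proof.
move=> lay; pose c (p : 'I_(nl I) * 'I_(nl I)) u v : bool :=
  [&& on p.1 u v, on p.2 u v & edge_cross pi u v p.1 p.2].
transitivity (\sum_(u : 'I_(nv I)) \sum_(v : 'I_(nv I))
    \sum_(p : 'I_(nl I) * 'I_(nl I)) (if u < v then c p u v + c p v u else 0)).
  apply: eq_bigr => u _; rewrite big_mkcond; apply: eq_bigr => v _.
  rewrite -sum1_card.
  case uv: (adj u v); last first.
    rewrite /= big1 // => p _; case: ifP => // _.
    have F l : (l \in lines_on u v) = false.
      by apply/negP => /lines_on_adj; rewrite uv.
    move: (F p.1); rewrite lines_on_on /c => /norP[/negPf-> /negPf->].
    by [].
  case: ltnP => /= _; last by rewrite big1.
  rewrite big_mkcond; apply: eq_bigr => p _; rewrite inE.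
  have [_ muv] := lay _ _ uv.
  have ecC : edge_cross pi v u p.1 p.2 = edge_cross pi u v p.1 p.2.
    by rewrite /edge_cross andbC.
  rewrite /c ecC; case ec: (edge_cross pi u v p.1 p.2); last by rewrite !andbF.
  have [m1 m2] : p.1 \in lines_on u v /\ p.2 \in lines_on u v.
    case/andP: ec => /mem_subseq sub _.
    by rewrite -!muv; split; apply: sub; rewrite !inE eqxx ?orbT.
  rewrite !andbT; case: (lines_onP m1) => H; move: m1 m2; rewrite !H => h1 h2.
    by rewrite h1 h2 (negPf (D_dir p.1 h1)).
  by rewrite h1 h2 (negPf (D_dir p.1 h1)).
under eq_bigr do rewrite exchange_big /=.
rewrite exchange_big; apply: eq_bigr => p _ /=.
rewrite count_finType; last exact: pairs_uniq (D_uniq _).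
transitivity (\sum_(u : 'I_(nv I)) \sum_(v : 'I_(nv I)) (c p u v : nat)); last first.
  rewrite pair_bigA; apply: eq_bigr => d _; congr nat_of_bool.
  by rewrite /c /traverses -surjective_pairing.
transitivity (\sum_(u : 'I_(nv I)) \sum_(v : 'I_(nv I)) (if u < v then c p u v : nat else 0)
  + \sum_(u : 'I_(nv I)) \sum_(v : 'I_(nv I)) (if u < v then c p v u : nat else 0)).
  rewrite -big_split; apply: eq_bigr => u _; rewrite -big_split; apply: eq_bigr => v _ /=.
  by case: ifP.
rewrite [X in _ + X]exchange_big -big_split; apply: eq_bigr => u _ /=.
rewrite -big_split; apply: eq_bigr => v _ /=.
case: (ltngtP u v) => [||/val_inj->] //; first by rewrite addn0.
by rewrite /c; case h: (on p.1 v v) => //; move: (D_dir p.1 h); rewrite h.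
Qed.

Lemma on_nonempty x l u v : on l u v -> back x l u v != [::] /\ forw x l u v != [::].
Proof.
move=> /onP[A [B E]]; have [bE fE _ _ _] := on_decompose E.
by rewrite /bwd_keys /fwd_keys bE fE.
Qed.

(** When the next keys tie, the two orders are opposite, so a crossing needs different first forward
    keys; the tail order then forces the backward keys to differ in the same sense. *)
Lemma crossings_sol x : crossings (sol x) <= cost D x.
Proof.
rewrite (crossingsE (sol_layout x)); apply: leq_sum => p _.
apply: leq_count_in => -[u v] h1 /= /andP[h2 /andP[pr1 pr2]]; rewrite h2 /=.
rewrite -/(on p.1 u v) in h1.
have ne : p.1 != p.2.
  apply: contraTneq pr1 => E; rewrite E /precedes; apply/negP => sub.
  have uv : adj u v by apply: (@lines_on_adj _ u v p.2); rewrite lines_on_on h2.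
  have [us _] := sol_layout x uv.
  by have := leq_count_subseq (pred1 p.2) sub; rewrite /= eqxx count_uniq_mem//; case: (_ \in _).
move: pr1 pr2; rewrite (sol_tail_precedes x h1 h2 ne) (sol_head_precedes x h1 h2 ne).
rewrite /tail_before /head_before /lex2 /cost_item /=.
have [_ fn1] := on_nonempty x h1; have [_ fn2] := on_nonempty x h2.
have [i t _] := lexlt_strict.
move=> T; case/orP => [lt|/andP[/eqP Eh H]].
  rewrite lt /=; case/orP: T => // /andP[_ /lexlt_head]-/(_ fn1).
  by case=> [|[E _]]; [rewrite ltnNge (ltnW lt)|rewrite E ltnn in lt].
case/orP: T => [b21|/andP[/eqP Eb f12]].
  by case/orP: H => [b12|/andP[/eqP Eb _]]; [have := t _ _ _ b12 b21|move: b21; rewrite Eb]; rewrite i.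
by case/orP: H => [|/andP[_ f21]]; [rewrite Eb i|have := t _ _ _ f12 f21; rewrite i].
Qed.

(** * Sides of a given layout and the lower bound *)

Definition first_at pi u v l : bool :=
  all (fun m => intermediate m u ==> precedes (pi u v) l m) (pi u v).

(** The default [false] concerns lines of a single vertex, which have no port. *)
Definition sides pi l (e : bool) : bool :=
  if (if e then rev (D l) else D l) is u :: v :: _ then first_at pi u v l else false.

Lemma sides_terminal pi u v l : l \in lines_on u v -> terminal l u ->
  sides pi l (~~ on l u v) = first_at pi u v l.
Proof.
rewrite lines_on_on => h tu; have [l_uv|nuv] := boolP (on l u v).
  by rewrite /sides /=; have [B ->] := on_terminal_first l_uv tu.
have l_vu : on l v u by move: h; rewrite (negPf nuv).
rewrite /sides; have [A [B E]] := onP l_vu.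
case: B E => [|w B] E; last first.
  have l_uw : on l u w by apply/pairsP; exists (rev (v :: A)), B; rewrite E rev_cons cat_rcons.
  by move: (on_terminalF l_vu l_uw); rewrite tu.
by rewrite E rev_cat revK.
Qed.

Section LowerBound.
Variable pi : layout I.
Hypothesis adm : MLCM_P_admissible pi.
Let x := sides pi.

(** By the periphery condition the intermediate lines form a block. A line ending here that does not
    precede the whole block follows some member of it, hence lies in the last part. *)
Lemma admissible_terminal u v l m : l \in lines_on u v -> m \in lines_on u v ->
  terminal l u -> intermediate m u ->
  if first_at pi u v l then precedes (pi u v) l m else precedes (pi u v) m l.
Proof.
move=> hl hm tl im; have [lay _] := adm.1; have uv := lines_on_adj hl.
have [us mem] := lay _ _ uv; case: ifPn => [/allP/(_ m)|].
  by rewrite mem im => /(_ hm).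
case/allPn => m0; rewrite mem negb_imply => hm0 /andP[im0 npr].
have ne m' : intermediate m' u -> l != m'.
  by move=> /terminalN; apply: contraNneq => <-.
have {npr}pr : precedes (pi u v) m0 l.
  by rewrite /precedes precedes_total ?mem// eq_sym ne.
have [s1 [s2 [s3 [E T1 T2 T3]]]] := adm.2 _ _ uv.
have m0s : m0 \in s2.
  have : m0 \in pi u v by rewrite mem.
  have nt := terminalN im0.
  by rewrite E !mem_cat => /or3P[/T1|//|/T3]; rewrite (negPf nt).
have ms : m \in s2.
  have : m \in pi u v by rewrite mem.
  have nt := terminalN im.
  by rewrite E !mem_cat => /or3P[/T1|//|/T3]; rewrite (negPf nt).
have ls : l \in s3.
  have : l \in pi u v by rewrite mem.
  rewrite E !mem_cat => /or3P[l1|/T2/terminalN|//]; last by rewrite tl.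
  move: pr; rewrite /precedes subseq2_index// 1?eq_sym ?ne// => /andP[_].
  rewrite E !index_cat l1; case: ifP => [m1|_]; last first.
    by rewrite ltnNge (leq_trans _ (leq_addr _ _))// ltnW// index_mem.
  by have := T1 _ m1; rewrite (negPf (terminalN im0)).
rewrite /precedes E; apply: subseq_trans (suffix_subseq s1 _).
by rewrite -[[:: m; l]]/([:: m] ++ [:: l]); apply: cat_subseq; rewrite sub1seq.
Qed.

(** Two ending lines with different keys are separated by an intermediate line; for an ending and a
    passing line the side decides; for two passing lines feasibility does. *)
Lemma admissible_pkey u v l1 l2 : l1 \in lines_on u v -> l2 \in lines_on u v ->
  pkey x l2 u v < pkey x l1 u v -> precedes (pi u v) l1 l2.
Proof.
move=> h1 h2 lt; have ne : l1 != l2 by apply: contraTneq lt => ->; rewrite ltnn.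
have [lay _] := adm.1; have uv := lines_on_adj h1; have [us mem] := lay _ _ uv.
case: (port_cases x h1) => [[t1 E1]|[w1 th1 [i1 E1]]];
case: (port_cases x h2) => [[t2 E2]|[w2 th2 [i2 E2]]].
- move: lt; rewrite E1 E2 /x !sides_terminal//.
  case f1: (first_at pi u v l1); last by case: ifP.
  case f2: (first_at pi u v l2); first by rewrite ltnn.
  move=> _; move/negbT: f2 => /allPn[m hm]; rewrite mem in hm.
  rewrite negb_imply => /andP[im].
  move=> npr2; have := admissible_terminal h1 hm t1 im; rewrite f1 => pr1.
  have ne2 : l2 != m by apply: contraTneq t2 => ->; apply: terminalN.
  have ne1 : l1 != m by apply: contraTneq t1 => ->; apply: terminalN.
  move: pr1 npr2; rewrite /precedes !subseq2_index// !mem h1 h2 hm /= -leqNgt.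
  exact: leq_trans.
- have := admissible_terminal h1 h2 t1 i2; case: ifPn => // f1.
  by move: lt; rewrite E1 /x sides_terminal// (negPf f1).
- have := admissible_terminal h2 h1 t2 i1; case: ifPn => // f2.
  move: lt; rewrite E1 E2 /x sides_terminal// f2.
  have uw1 : adj u w1 by case/and3P: th1 => _ /lines_on_adj.
  by rewrite ltnNge ltnW// pos_lt.
apply: (feasible_diverging adm.1 ne th1 th2).
by move: lt; rewrite E1 E2 (through_pos th1) (through_pos th2).
Qed.

(** If the first keys tie, the comparison is decided later, so [l1] does not start at [u]. Nor does
    [l2], as turning keys are never extreme, and equal turning keys give the same previous
    vertex. *)
Lemma back_lt_cases u v l1 l2 : on l1 u v -> on l2 u v ->
  lexlt (back x l2 u v) (back x l1 u v) ->
  pkey x l2 u v < pkey x l1 u v \/ exists t, on l1 t u /\ on l2 t u.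
Proof.
move=> h1 h2 /lexlt_head[]; first by have [] := on_nonempty x h2.
  by left; rewrite /pkey h1 h2.
move=> [E B]; case: (tail_port x h1) => [[t1 E1]|[w1 th1 [wu1 i1]]].
  have [C EC] := on_terminal_first h1 t1.
  have [bE _ _ _ _] := on_decompose (A := [::]) EC.
  by move: B; rewrite {2}/bwd_keys bE /=; case: (behead _).
have [b1 _] := keys_step x wu1 h1; have p0 : 0 < pos u v w1.
  by rewrite (through_pos th1).
have pd : pos u v w1 < size (nbrs u).
  by apply: pos_lt; case/and3P: th1 => _ /lines_on_adj.
case: (tail_port x h2) => [[t2 E2]|[w2 th2 [wu2 i2]]].
  by move: E; rewrite E2 b1 /=; case: ifP => _ E; [rewrite E ltnn in pd|rewrite -E in p0].
have [b2 _] := keys_step x wu2 h2; right; exists w1; split=> //.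
move: E; rewrite b1 b2 /= => /pos_inj <- //.
by case/and3P: th2 => _ /lines_on_adj.
Qed.

(** For each pair of lines, an item is charged to a crossing at or before it on the same common
    subpath. *)
Lemma leq_cost_crossings : cost D x <= crossings pi.
Proof.
have [lay _] := adm.1; rewrite (crossingsE lay); apply: leq_sum => -[l1 l2] _ /=.
case: (eqVneq l1 l2) => [<-|ne].
  apply: leq_count_in => d _ /andP[_ /andP[_]].
  by have [i _ _] := lexlt_strict; rewrite i.
pose h (d : 'I_(nv I) * 'I_(nv I)) :=
  [&& on l2 d.1 d.2, lexlt (back x l2 d.1 d.2) (back x l1 d.1 d.2)
    & precedes (pi d.2 d.1) l1 l2].
have dart (d : 'I_(nv I) * 'I_(nv I)) : d \in pairs (D l1) -> on l1 d.1 d.2.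
  by rewrite /traverses -surjective_pairing.
apply: (amortize (h := h)).
- move=> [u v] /dart /= h1 /andP[/= h2 /andP[/= lt back_lt]]; rewrite /h /= h2 back_lt /=.
  apply: admissible_pkey; rewrite ?lines_on_on ?h1 ?h2 ?orbT//.
  by rewrite /pkey (negPf (D_dir l1 h1)) (negPf (D_dir l2 h2)).
- move=> [u v] ds E /and3P[/= h2 back_lt pr]; rewrite h2 /edge_cross pr andbT /=.
  have h1 : on l1 u v by apply: (dart (u, v)); rewrite E mem_head.
  case: (back_lt_cases h1 h2 back_lt) => [lt|[t [tu _]]].
    by apply: admissible_pkey; rewrite ?lines_on_on ?h1 ?h2.
  have : terminal l1 u.
    case: (D l1) E (on_decompose (l := l1) (A := [::]) (u := u) (v := v)).
      by [].
    move=> a [|b s] //= [-> -> _] H.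
    by have [_ _ _ _ ->] := H _ erefl.
  by rewrite (negPf (on_terminalF tu h1)).
move=> [t u] [u' v] dd; have /= E := pairs_consecutive dd; subst u'.
have [/dart d1 /dart d2] := pairs_mem dd.
move=> /and3P[/= h2 back_lt pr]; rewrite h2 /edge_cross pr andbT /=.
case: (back_lt_cases d2 h2 back_lt) => [lt|[t' [t1 t2]]].
  by apply/orP; left; apply: admissible_pkey; rewrite ?lines_on_on ?d2 ?h2.
have E := pairs_fun_rev (D_uniq l1) t1 d1; subst t'; rewrite /h /= t2 /=.
have [b1 f1] := keys_step x d1 d2; have [b2 f2] := keys_step x t2 h2.
(* The lines stay together at [u], so on the previous edge their first forward keys tie and that
   edge is no item. *)
rewrite /cost_item /= f1 f2 /= ltnn /= andbT.
move: back_lt; rewrite b1 b2 /= eqxx => ->; rewrite /=.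
have th1 := on_through d1 d2; have th2 := on_through t2 h2.
rewrite throughC in th1; rewrite throughC in th2.
(* Passing [u] in parallel reverses the order: either the tail port yields a crossing on this edge,
   or [h] holds one edge earlier. *)
by rewrite (feasible_parallel adm.1 ne th1 th2); case: (precedes _ _ _).
Qed.
End LowerBound.

(** * The cost as the capacity of a cut *)

Section MinCutCost.
Hypothesis proper : proper_instance I.

Lemma not_infix l1 l2 : l1 != l2 -> ~~ infix (D l1) (D l2).
Proof.
move=> /proper; apply: contraNN => inf; rewrite /subpath.
case: (D_line l1) (D_line l2) inf => -> [] ->.
- by move=> ->.
- by rewrite -infix_rev revK => ->; rewrite orbT.
- by move=> ->; rewrite orbT.
- by rewrite infix_rev => ->.
Qed.

(** If both sides of one line mattered, it would stop at both ends of the common subpath and be a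
    subpath of the other line, against properness. *)
Lemma item_under_literals l1 l2 d : l1 != l2 -> on l1 d.1 d.2 -> on l2 d.1 d.2 ->
  exists c es1 ee1 es2 ee2, [/\ forall s1 e1 s2 e2, item_under D s1 e1 s2 e2 l1 l2 d =
    [&& c, es1 ==> s1, ee1 ==> e1, es2 ==> ~~ s2 & ee2 ==> ~~ e2],
    ~~ (es1 && ee1) & ~~ (es2 && ee2)].
Proof.
case: d => u v ne /= /onP[A [B E]] /onP[A' [B' E']].
have [bE fE wA wB _] := on_decompose E; have [bE' fE' wA' wB' _] := on_decompose E'.
have [c [es1 [es2 [H H1 H2]]]] := keys_lt_literals wA wA'.
have [c' [ee1 [ee2 [H' H1' H2']]]] := head_keys_lt_literals wB wB'.
exists (c && c'), es1, ee1, es2, ee2; split=> [s1 e1 s2 e2||].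
- rewrite /item_under /= bE bE' fE fE' H H'.
  by case: c c' es1 ee1 es2 ee2 {H H' H1 H2 H1' H2'} => [] [] [] [] [] [];
     rewrite /= ?andbT ?andbF//; case: s1 e1 s2 e2 => [] [] [] [].
- apply/negP => /andP[/H1/prefixP[t Et] /H1' EB].
  case/negP: (not_infix ne); rewrite E E' EB; move: Et => [->].
  by apply/infixP; exists (rev t), B'; rewrite rev_cat -!catA.
apply/negP => /andP[/H2/prefixP[t Et] /H2' EB].
have ne' : l2 != l1 by rewrite eq_sym.
case/negP: (not_infix ne'); rewrite E E' EB; move: Et => [->].
by apply/infixP; exists (rev t), B; rewrite rev_cat -!catA.
Qed.

(** A conjunction of at most one positive and one negative literal says that an arc leaves a set;
    source and sink stand for missing literals. *)
Lemma cost_item_arc x l1 l2 d : l1 != l2 -> on l1 d.1 d.2 -> on l2 d.1 d.2 ->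
  cost_item D x l1 l2 d =
  [&& item_under D true true false false l1 l2 d, side_of x (arc_tail D l1 l2 d)
    & ~~ side_of x (arc_head D l1 l2 d)].
Proof.
move=> ne h1 h2.
have [c [es1 [ee1 [es2 [ee2 [H n1 n2]]]]]] := item_under_literals ne h1 h2.
have -> : cost_item D x l1 l2 d =
  item_under D (x l1 false) (x l1 true) (x l2 false) (x l2 true) l1 l2 d by [].
rewrite /arc_tail /arc_head !H.
case: c {H}; last by [].
by case: es1 ee1 n1 => [] [] // _; case: es2 ee2 n2 => [] [] //= _; rewrite ?andbT.
Qed.

Lemma cost_cut x : cost D x = out_arcs (cut_arcs D) (side_of x).
Proof.
rewrite /out_arcs /cut_arcs count_flatten -map_comp sumn_enum /cost.
rewrite -(pair_bigA _ (fun l1 l2 => count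
  (fun d => on l2 d.1 d.2 && cost_item D x l1 l2 d) (pairs (D l1)))).
apply: eq_bigr => l1 _ /=; rewrite count_flatten -map_comp sumn_enum.
apply: eq_bigr => l2 _ /=; rewrite /pair_arcs; case: (eqVneq l1 l2) => [<-|ne].
  rewrite -[RHS](count_pred0 (pairs (D l1))); apply: eq_count => d /=.
  by rewrite /cost_item ltnn andbF.
rewrite count_map count_filter; apply: eq_in_count => d d1 /=.
have h1 : on l1 d.1 d.2 by rewrite /traverses -surjective_pairing.
case h2: (on l2 d.1 d.2); last by rewrite andbF.
by rewrite (cost_item_arc x ne h1 h2) /= andbC andbA.
Qed.

(** The crossings of this layout are at most its cost, a minimum cut; that is at most the cut given
    by the sides of any admissible layout, hence at most the crossings of the latter. *)
Lemma sol_min_sides : MLCM_P_solution (sol (min_sides D)).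
Proof.
split=> [|pi adm]; first exact: sol_admissible.
apply: leq_trans (crossings_sol _) _; apply: leq_trans (leq_cost_crossings adm).
rewrite !cost_cut.
have [//|src snk min] := @mincutP _ (cut_arcs D) (None, true) (None, false).
rewrite (_ : out_arcs _ (side_of (min_sides D)) = out_arcs (cut_arcs D) (mem (min_cut D))).
  exact: min.
apply: eq_count => -[a b] /=.
(* For the two constant nodes this is the fact that the cut contains the source and not the sink. *)
have E n : side_of (min_sides D) n = (n \in min_cut D).
  by case: n => [[l|] []] //=; rewrite /side_of /= /min_cut ?src ?(negPf snk).
by rewrite !E.
Qed.
End MinCutCost.
End Directed.

(** * Orientation *)

Lemma pairs_rcons (T : eqType) (s : seq T) a b :
  pairs (rcons (rcons s b) a) = rcons (pairs (rcons s b)) (b, a).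
Proof.
elim: s => // c s IH; rewrite !rcons_cons; case: s IH => // d s IH.
by rewrite !rcons_cons in IH *; rewrite -[LHS]/((c, d) :: pairs (d :: _)) IH.
Qed.

Lemma pairs_rev_map (T : eqType) (s : seq T) :
  pairs (rev s) = rev (map (@swap T) (pairs s)).
Proof.
elim: s => [|a [|b s] IH] //.
have -> : pairs [:: a, b & s] = (a, b) :: pairs (b :: s) by [].
by rewrite map_cons [in RHS]rev_cons -IH !rev_cons pairs_rcons.
Qed.

Section Orientation.
Variable I : instance.
Notation dart := ('I_(nv I) * 'I_(nv I))%type.
Implicit Types (d : dart) (l : 'I_(nl I)).

Definition dart_seq : seq dart :=
  flatten [seq [seq (u, v) | v <- nbrs u] | u <- enum 'I_(nv I)].

(** Both reading directions are linked, because the direction of the line is still to be chosen. *)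
Definition line_links l : seq (dart * dart) :=
  pairs (pairs (line l)) ++ pairs (pairs (rev (line l))).

Definition links : seq (dart * dart) :=
  flatten [seq line_links l ++ map (@swap dart) (line_links l) | l <- enum 'I_(nl I)].

(* Darts met in succession along a line have the same rank, whereas consistent
   directions keep a dart and its reverse in different components. *)
Definition rank d : nat := find (fun d' => d' \in reach links d) dart_seq.

(** Of the components of a dart and of its reverse, the one with the earlier first member in
    [dart_seq] is declared forward, so lines meeting the same component agree. *)
Definition forward d : bool := rank d < rank (swap d).

Definition orient l : seq 'I_(nv I) :=
  if all forward (pairs (line l)) then line l else rev (line l).

Lemma orient_line l : orient l = line l \/ orient l = rev (line l).
Proof. by rewrite /orient; case: ifP; [left|right]. Qed.

Lemma mem_dart_seq d : (d \in dart_seq) = adj d.1 d.2.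
Proof.
case: d => u v; apply/flattenP/idP => [[s /mapP[u' _ ->] /mapP[v' v'u [-> ->]]]//|uv].
exists [seq (u, w) | w <- nbrs u]; first by apply: map_f; rewrite mem_enum.
exact: map_f.
Qed.

Lemma mem_links a : (a \in links) =
  [exists l, (a \in line_links l) || (swap a \in line_links l)].
Proof.
apply/flattenP/existsP => [[s /mapP[l _ ->]]|[l h]].
  rewrite mem_cat => /orP[h|/mapP[b h ->]]; exists l; first by rewrite h.
  by rewrite /swap /= -surjective_pairing h orbT.
exists (line_links l ++ map (@swap dart) (line_links l)).
  by apply: (map_f (fun l => _ ++ _)); rewrite mem_enum.
rewrite mem_cat; case/orP: h => [->//|h]; apply/orP; right; apply/mapP.
by exists (swap a) => //; case: a {h}.
Qed.

(** Links are symmetric, so both darts reach the same set and find the same first member. *)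
Lemma rank_link d d' : (d, d') \in links -> rank d = rank d'.
Proof.
have sym e e' : (e, e') \in links -> (e', e) \in links.
  by rewrite !mem_links => /existsP[l h]; apply/existsP; exists l; rewrite orbC.
have sub e e' : (e, e') \in links -> {subset reach links e <= reach links e'}.
  move=> h; apply: (@reach_ind _ links e (fun y => y \in reach links e')) => [|a].
    exact: (@reach_closed _ links e' (e', e) (sym _ _ h) (reach_root _ _)).
  exact: reach_closed.
move=> h; apply: eq_find => x; apply/idP/idP; apply: sub => //; exact: sym.
Qed.

Lemma forward_link l d d' : (d, d') \in pairs (pairs (line l)) -> forward d = forward d'.
Proof.
move=> h; rewrite /forward (@rank_link d d'); last first.
  by rewrite mem_links; apply/existsP; exists l; rewrite mem_cat h.
have -> : rank (swap d') = rank (swap d); last by [].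
apply: rank_link; rewrite mem_links; apply/existsP; exists l.
have E := pairs_rev_map (line l).
rewrite mem_cat E (pairs_rev (map _ _)).
suff -> : (swap d, swap d') \in pairs (map (@swap _) (pairs (line l))) by rewrite orbT.
case/pairsP: h => p [t ->]; rewrite map_cat /=; apply/pairsP.
by exists (map (@swap _) p), (map (@swap _) t).
Qed.

Lemma pairs_constant (T : eqType) (U : Type) (f : T -> U) (s : seq T) :
  (forall a b, (a, b) \in pairs s -> f a = f b) ->
  {in s &, forall a b, f a = f b}.
Proof.
elim: s => // a s IH H.
suff fa : {in s, forall b, f b = f a}.
  by move=> b c; rewrite !inE => /predU1P[->|/fa->] /predU1P[->|/fa->].
case: s H IH => // b s H IH c cs; have Hb : f a = f b by apply: H; exact: mem_head.
rewrite Hb; apply: IH => //; last exact: mem_head.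
by move=> x y xy; apply: H; rewrite -[pairs _]/((a, b) :: pairs (b :: s)) inE xy orbT.
Qed.

Lemma pairs_asym (T : eqType) (s : seq T) a b : uniq s ->
  (a, b) \in pairs s -> (b, a) \notin pairs s.
Proof.
move=> us /pairsP[q [r E']]; apply/negP => /pairsP[p [t E]].
have [E3 _] : p ++ [:: b] = q /\ t = b :: r.
  by apply: (@uniq_split _ _ _ _ _ a); rewrite -catA -?E.
by move: us; rewrite E' -E3 -catA cat_uniq /= !inE eqxx orbT /= ?andbF.
Qed.

Section Consistent.
Variable o : 'I_(nl I) -> bool.
Hypothesis consistent : forall u v : 'I_(nv I), adj u v ->
  {in lines_on u v &, forall l l',
     infix [:: u; v] (directed o l) = infix [:: u; v] (directed o l')}.

(** The invariant that separates components: it is constant along links and differs between a dart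
    of a line and its reverse. *)
Definition directed_dart d : bool := [exists l, d \in pairs (directed o l)].

Lemma directed_uniq l : uniq (directed o l).
Proof. by rewrite /directed; case: ifP; rewrite ?rev_uniq line_uniq. Qed.

Lemma directed_lines_on l u v : (u, v) \in pairs (directed o l) -> l \in lines_on u v.
Proof.
by rewrite in_lines_on /directed; case: ifP => _; rewrite ?pairs_rev => ->; rewrite ?orbT.
Qed.

Lemma directed_dart_asym d : directed_dart d -> ~~ directed_dart (swap d).
Proof.
case: d => u v /existsP[l h]; apply/negP => /existsP[l' h'].
have m := directed_lines_on h; have m' := directed_lines_on h'.
rewrite lines_on_sym in m'.
have := consistent (lines_on_adj m) m m'; rewrite !infix_pairs h => /esym h2.
by move: (pairs_asym (directed_uniq l') h2); rewrite h'.
Qed.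

Lemma directed_dart_link a : a \in links -> directed_dart a.1 = directed_dart a.2.
Proof.
have H l e : e \in line_links l -> directed_dart e.1 = directed_dart e.2.
  case: e => d d'; rewrite mem_cat => h /=.
  have [s [dd d's Es]] : exists s,
      [/\ d \in pairs s, d' \in pairs s & s = line l \/ s = rev (line l)].
    by case/orP: h => /pairs_mem[h1 h2]; [exists (line l)|exists (rev (line l))]; split; auto.
  have [E|E] : directed o l = s \/ directed o l = rev s.
    by rewrite /directed; case: Es => ->; case: ifP; rewrite ?revK; auto.
    have fT e : e \in pairs s -> directed_dart e by move=> es; apply/existsP; exists l; rewrite E.
    by rewrite !fT.
  have fF e : e \in pairs s -> directed_dart e = false.
    move=> es; apply/negbTE.
    case: e es => u v es; apply: (@directed_dart_asym (v, u)).
    by apply/existsP; exists l; rewrite E pairs_rev.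
  by rewrite !fF.
rewrite mem_links => /existsP[l /orP[/H//|/H]].
by case: a => a b.
Qed.

Lemma rank_swap l d : d \in pairs (line l) -> rank d != rank (swap d).
Proof.
move=> h; apply/eqP => Er; have m : l \in lines_on d.1 d.2.
  by rewrite in_lines_on -surjective_pairing h.
have hd : has (fun d' => d' \in reach links d) dart_seq.
  apply/hasP; exists d; last exact: reach_root.
  by rewrite mem_dart_seq; apply: lines_on_adj m.
have hs : has (fun d' => d' \in reach links (swap d)) dart_seq.
  apply/hasP; exists (swap d); last exact: reach_root.
  by rewrite mem_dart_seq adj_sym; apply: lines_on_adj m.
have same e : forall x, x \in reach links e -> directed_dart x = directed_dart e.
  apply: (@reach_ind _ links e (fun x => directed_dart x = directed_dart e) erefl).
  by move=> a /directed_dart_link->.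
(* Equal ranks would point at one dart reached from both [d] and its reverse, on which the invariant
   would take both values. *)
have E1 : directed_dart (nth d dart_seq (rank d)) = directed_dart d.
  exact: same (nth_find d hd).
have E2 : directed_dart (nth d dart_seq (rank (swap d))) = directed_dart (swap d).
  exact: same (nth_find d hs).
have E : directed_dart (swap d) = directed_dart d by rewrite -E1 -E2 Er.
have : directed_dart d || directed_dart (swap d).
  have : (d \in pairs (directed o l)) || (swap d \in pairs (directed o l)).
    rewrite /directed; case: ifP => _; last by rewrite h.
    by case: d h {hd hs Er m E E1 E2} => u v h; rewrite !pairs_rev h orbT.
  by case/orP => h'; apply/orP; [left|right]; apply/existsP; exists l.
by rewrite E orbb => h'; move: (directed_dart_asym h'); rewrite E h'.
Qed.

Lemma orient_forward l d : d \in pairs (orient l) -> forward d.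
Proof.
rewrite /orient; case: ifPn => [/allP H /H//|/allPn[e e_l nfe]].
case: d => u v; rewrite pairs_rev => h.
have E := pairs_constant (@forward_link l) h e_l.
move: nfe; rewrite -E /forward -leqNgt leq_eqVlt => /orP[/eqP Er|//].
by case/eqP: (rank_swap h); exact: esym Er.
Qed.

Lemma orient_consistent l l' u v :
  traverses orient l u v -> ~~ traverses orient l' v u.
Proof.
move=> /orient_forward f; apply/negP => /orient_forward.
by rewrite /forward ltnNge (ltnW f).
Qed.
End Consistent.
End Orientation.

Lemma solution_orient (I : instance) :
  proper_instance I -> consistently_directable I ->
  MLCM_P_solution (sorted_layout (@orient I) (min_sides (@orient I))).
Proof.
move=> prop [o cons]; apply: sol_min_sides => //; first exact: orient_line.
exact: orient_consistent cons.
Qed.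

(** * The algorithm runs in polynomial time *)

Lemma tsize_code_perm (T : eqType) {cT : Code T} (s t : seq T) :
  perm_eq s t -> tsize (code s) = tsize (code t).
Proof.
have E (r : seq T) : tsize (code r) = (\sum_(z <- r) (tsize (code z)).+1).+1.
  elim: r => [|z r IH]; first by rewrite big_nil.
  by rewrite big_cons tsize_code_cons IH; lia.
by move=> p; rewrite !E (perm_big _ p).
Qed.

Lemma tsize_code_mem (T : eqType) {cT : Code T} (s : seq T) z :
  z \in s -> tsize (code z) <= tsize (code s).
Proof. by case/splitPr => p q; apply: tsize_code_elem. Qed.

Lemma tsize_code_sub (T : eqType) {cT : Code T} (s t : seq T) :
  size s <= size t -> {subset s <= t} ->
  tsize (code s) <= tsize (code t) * (tsize (code t)).+1 + 1.
Proof.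
move=> le sub; rewrite -[s]map_id.
apply: leq_trans (@tsize_code_map _ _ _ id s (tsize (code t)) _) _.
  move=> s1 z s2 E; apply: tsize_code_mem; apply: sub.
  by rewrite E mem_cat mem_head orbT.
rewrite leq_add2r leq_mul2r /=; apply: leq_trans le (ltnW (@size_lt_code _ cT t)).
Qed.

Lemma tsize_swap T {cT : Code T} (a : T * T) : tsize (code (swap a)) = tsize (code a).
Proof. by case: a => a b; rewrite !tsize_code_pair addnC. Qed.

Section Found.
Variables (X : Type) (c : X -> tree) (T : X -> eqType).
Context {cT : forall x, Code (T x)} {iT : forall x, CodeEq (T x)}.

Lemma pt_found (s : forall x, T x) (P : forall x, seq (T x * T x)) :
  poly_time c (fun x => code (s x)) -> poly_time c (fun x => code (P x)) ->
  poly_time c (fun x => code (found (s x) (P x))).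
Proof. by move=> cs cP; rewrite /found; pt. Qed.

Lemma pt_extend_tree (s : forall x, T x) (P : forall x, seq (T x * T x))
    (a : forall x, (T x * T x)%type) :
  poly_time c (fun x => code (s x)) -> poly_time c (fun x => code (P x)) ->
  poly_time c (fun x => code (a x)) ->
  poly_time c (fun x => code (extend_tree (s x) (P x) (a x))).
Proof.
move=> cs cP ca; rewrite /extend_tree.
have cf : poly_time c (fun x => code (found (s x) (P x))) by apply: pt_found.
by pt.
Qed.
End Found.

Section SearchRound.
Variables (X : Type) (c : X -> tree) (T : X -> eqType).
Context {cT : forall x, Code (T x)} {iT : forall x, CodeEq (T x)}.
Variables (s : forall x, T x) (arcs : forall x, seq (T x * T x)).
Hypotheses (cs : poly_time c (fun x => code (s x)))
  (carcs : poly_time c (fun x => code (arcs x))).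

Lemma pt_search_round (P : forall x, seq (T x * T x)) :
  poly_time c (fun x => code (P x)) ->
  poly_time c (fun x => code (search_round (arcs x) (s x) (P x))).
Proof.
move=> cP; rewrite /search_round.
apply: (pt_foldl (A := fun x => seq (T x * T x)) (B := fun x => (T x * T x)%type)
  (f := fun x => extend_tree (s x))) => //.
  by apply: (pt_extend_tree (T := fun p => T (tag p))); pt.
have [k Hk] := pt_size carcs; have [l Hl] := pt_size cP.
have [m Hm] : poly_bounded (fun n => (n + k) ^ k + (n + l) ^ l).
  exact: poly_add (poly_exp _) (poly_exp _).
exists m => x s1 s2 E; apply: leq_trans (Hm _); rewrite addnC.
apply: (@leq_trans (tsize (code (P x)) + tsize (code s1))); last first.
  apply: leq_add; first exact: Hl.
  by apply: leq_trans (Hk x); rewrite E tsize_code_prefix.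
elim: s1 (P x) {E} => [|a s1 IH] Q; first exact: leq_addr.
apply: leq_trans (IH _) _; rewrite tsize_code_cons /extend_tree.
by case: ifP => _; rewrite ?tsize_code_cons; lia.
Qed.

Lemma tsize_search_tree x (P : seq (T x * T x)) :
  search_tree (arcs x) (s x) P ->
  tsize (code P) <= tsize (code (arcs x)) * (tsize (code (arcs x))).+1 + 1.
Proof.
move=> wf; apply: tsize_code_sub; first exact: search_tree_size wf.
exact: search_tree_sub wf.
Qed.
End SearchRound.

Section Reach.
Variables (X : Type) (c : X -> tree) (T : X -> eqType).
Context {cT : forall x, Code (T x)} {iT : forall x, CodeEq (T x)}.
Variables (s : forall x, T x) (arcs : forall x, seq (T x * T x)).
Hypotheses (cs : poly_time c (fun x => code (s x)))
  (carcs : poly_time c (fun x => code (arcs x))).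

Lemma pt_search : poly_time c (fun x => code (search (arcs x) (s x))).
Proof.
rewrite /search; apply: (pt_iter (A := fun x => seq (T x * T x)) (a := fun=> [::])
  (f := fun x => search_round (arcs x) (s x))).
- by pt.
- by pt.
- by apply: (pt_search_round (T := fun p => T (tag p))); pt.
have [k Hk] := pt_size carcs.
exists (fun n => (n + k) ^ k * ((n + k) ^ k + 1) + 1) => [|x i _].
  apply: poly_add (poly_const _); apply: poly_mul (poly_exp _) _.
  exact: poly_add (poly_exp _) (poly_const _).
have wf : search_tree (arcs x) (s x) (iter i (search_round (arcs x) (s x)) [::]).
  by elim: i => // i IH; apply: search_round_wf.
apply: leq_trans (tsize_search_tree wf) _.
by rewrite leq_add2r addn1 leq_mul// ltnS.
Qed.

Lemma pt_reach : poly_time c (fun x => code (reach (arcs x) (s x))).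
Proof. by apply: pt_found => //; apply: pt_search. Qed.

End Reach.

Lemma pt_trace X (c : X -> tree) (T : X -> eqType) {cT : forall x, Code (T x)}
    {iT : forall x, CodeEq (T x)} (t : forall x, T x) (P : forall x, seq (T x * T x)) :
  poly_time c (fun x => code (t x)) -> poly_time c (fun x => code (P x)) ->
  poly_time c (fun x => code (trace (P x) (t x))).
Proof.
move=> ct cP; rewrite /trace; apply: pt_snd_of.
apply: (pt_foldl (A := fun x => (T x * seq (T x * T x))%type)
  (B := fun x => (T x * T x)%type) (a := fun x => (t x, [::])) (f := fun x => @trace_step (T x))).
- by pt.
- by pt.
- by rewrite /trace_step; pt.
have [k Hk] := pt_size cP; have [l Hl] := pt_size ct.
have [m Hm] : poly_bounded (fun n => (n + l) ^ l + (n + k) ^ k + (n + k) ^ k + 2).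
  apply: poly_add (poly_const _); apply: poly_add (poly_exp _).
  exact: poly_add (poly_exp _) (poly_exp _).
exists m => x s1 s2 E; apply: leq_trans (Hm _).
have {E} : tsize (code s1) <= (tsize (c x) + k) ^ k.
  by apply: leq_trans (Hk x); rewrite E tsize_code_prefix.
have := Hl x; set K := (_ + k) ^ k; set L := (_ + l) ^ l => lt les1.
set st := foldl _ _ _.
have H : tsize (code st.1) <= L + tsize (code s1) /\ tsize (code st.2) <= tsize (code s1).
  rewrite {}/st; elim/last_ind: s1 {les1} => [|s1 a [IH1 IH2]].
    by split=> //=; apply: leq_trans lt (leq_addr _ _).
  have Er : tsize (code (rcons s1 a)) = tsize (code s1) + (tsize (code a)).+1.
    rewrite -cats1 tsize_code_cat tsize_code_cons.
    by rewrite -[tsize (code [::])]/(tsize Leaf) [tsize Leaf]/=; lia.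
  rewrite foldl_rcons {1 3}/trace_step; case: ifP => _.
    rewrite [(_, _).1]/= [(_, _).2]/= tsize_code_cons Er.
    have -> : tsize (code a) = (tsize (code a.1) + tsize (code a.2)).+1.
      by rewrite {1}[a]surjective_pairing tsize_code_pair.
    by split; lia.
  by rewrite Er; split; lia.
case: H; case: st => a b; rewrite tsize_code_pair [(_, _).1]/= [(_, _).2]/=.
move: les1; clearbody K L; lia.
Qed.

Lemma pt_remove_all X (c : X -> tree) (T : X -> eqType) {cT : forall x, Code (T x)}
    {iT : forall x, CodeEq (T x)} (arcs q : forall x, seq (T x * T x)) :
  poly_time c (fun x => code (arcs x)) -> poly_time c (fun x => code (q x)) ->
  poly_time c (fun x => code (remove_all (arcs x) (q x))).
Proof.
move=> ca cq; rewrite /remove_all.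
apply: (pt_foldl (A := fun x => seq (T x * T x))
  (B := fun x => (T x * T x)%type) (f := fun x r a => rem a r)) => //.
  by apply: (pt_rem (A := fun p => (T (tag p) * T (tag p))%type)); pt.
have [k Hk] := pt_size ca; exists k => x s1 s2 _; apply: leq_trans (Hk x).
elim: s1 (arcs x) => // a s1 IH r; apply: leq_trans (IH _) _.
have [a_r|nar] := boolP (a \in r); last by rewrite rem_id.
by rewrite (tsize_code_perm (perm_to_rem a_r)) tsize_code_cons leqW// leq_addl.
Qed.

Section MinCut.
Variables (X : Type) (c : X -> tree) (T : X -> eqType).
Context {cT : forall x, Code (T x)} {iT : forall x, CodeEq (T x)}.

Lemma pt_augment (s t : forall x, T x) (arcs : forall x, seq (T x * T x)) :
  poly_time c (fun x => code (s x)) -> poly_time c (fun x => code (t x)) ->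
  poly_time c (fun x => code (arcs x)) ->
  poly_time c (fun x => code (augment (s x) (t x) (arcs x))).
Proof.
move=> cs ct ca.
have cS : poly_time c (fun x => code (search (arcs x) (s x))) by apply: pt_search.
have cq : poly_time c (fun x => code (trace (search (arcs x) (s x)) (t x))).
  exact: pt_trace.
rewrite /augment; apply: pt_if => //.
  by apply: pt_mem => //; apply: pt_found.
apply: pt_cat; last exact: pt_remove_all.
by rewrite /swap; pt.
Qed.

(** Reversing an arc only swaps its two ends, so the residual arcs keep the exact size of the input
    however often augmentation is repeated. *)
Lemma tsize_augment x (s t : T x) arcs :
  tsize (code (augment s t arcs)) = tsize (code arcs).
Proof.
rewrite /augment; case: ifP => // _; rewrite traceE; set p := tree_path _ t.
have wf := search_wf arcs s.
have P : perm_eq arcs (rev p ++ remove_all arcs (rev p)).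
  apply: remove_all_perm.
    rewrite rev_uniq; apply: subseq_uniq (tree_path_subseq _ _) _.
    exact: map_uniq (search_tree_uniq wf).
  move=> a; rewrite mem_rev => /(mem_subseq (tree_path_subseq _ _)).
  exact: search_tree_sub wf a.
rewrite (tsize_code_perm P) !tsize_code_cat; congr (_ + _).
elim: (rev p) => // a q IH; rewrite map_cons !tsize_code_cons IH.
by rewrite tsize_swap.
Qed.

End MinCut.

Lemma pt_mincut X (c : X -> tree) (T : X -> eqType) {cT : forall x, Code (T x)}
    {iT : forall x, CodeEq (T x)} (s t : forall x, T x) (arcs : forall x, seq (T x * T x)) :
  poly_time c (fun x => code (s x)) -> poly_time c (fun x => code (t x)) ->
  poly_time c (fun x => code (arcs x)) ->
  poly_time c (fun x => code (mincut (arcs x) (s x) (t x))).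
Proof.
move=> cs ct ca; rewrite /mincut; apply: pt_reach => //.
apply: (pt_iter (A := fun x => seq (T x * T x)) (f := fun x => augment (s x) (t x))).
- by pt.
- by [].
- by apply: (pt_augment (T := fun p => T (tag p))); pt.
have [k Hk] := pt_size ca.
exists (fun n => (n + k) ^ k) => [|x i _]; first exact: poly_exp.
by apply: leq_trans (Hk x); elim: i => // i IH; rewrite iterS tsize_augment.
Qed.

(** * Programs for instances, orientations, keys and layouts *)

#[export] Instance code_option_inst T {cT : Code T} : Code (option T) :=
  fun o => if o is Some a then Node (code a) Leaf else Leaf.
#[export] Instance code_option_inj (T : eqType) (cT : Code T) (iT : CodeEq T) :
  CodeEq (option T).
Proof. by move=> [a|] [b|] //= [/code_inj->]. Qed.

Lemma code_enum_ord n : code (enum 'I_n) = code (iota 0 n).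
Proof.
rewrite -val_enum_ord; elim: (enum _) => // i s IH.
by rewrite -[code (i :: s)]/(Node (code i) (code s)) IH.
Qed.

Lemma code_map T U {cU : Code U} (f : T -> U) (s : seq T) :
  code (map f s) = code_seq (fun x => code (f x)) s.
Proof. by elim: s => // x s IH; rewrite -[LHS]/(Node _ (code (map f s))) IH. Qed.

Lemma pt_some X (c : X -> tree) (A : X -> Type) {cA : forall x, Code (A x)}
    (a : forall x, A x) :
  poly_time c (fun x => code (a x)) -> poly_time c (fun x => code (Some (a x))).
Proof. by move=> ca; apply: pt_pair ca (pt_cst _ _). Qed.

Lemma pt_none X (c : X -> tree) (A : X -> Type) {cA : forall x, Code (A x)} :
  poly_time c (fun x => code (None : option (A x))).
Proof. exact: (pt_cst c Leaf). Qed.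

Section Instance.
Variables (X : Type) (c : X -> tree) (J : X -> instance).
Hypothesis cJ : poly_time c (fun x => code_instance (J x)).

Lemma pt_all_nbrs : poly_time c (fun x => code [seq nbrs u | u <- enum 'I_(nv (J x))]).
Proof.
apply: pt_ext (pt_thd cJ) => x; rewrite /code_instance /=.
by elim: (enum _) => //= u s ->.
Qed.

Lemma pt_all_lines : poly_time c (fun x => code [seq line l | l <- enum 'I_(nl (J x))]).
Proof.
apply: pt_ext (pt_ttl cJ) => x; rewrite /code_instance /=.
by elim: (enum _) => //= u s ->.
Qed.

Lemma pt_enum_vertices : poly_time c (fun x => code (enum 'I_(nv (J x)))).
Proof.
apply: (@pt_ext _ _ (fun x => code (iota 0 (size [seq nbrs u | u <- enum 'I_(nv (J x))])))).
  by move=> x; rewrite size_map size_enum_ord code_enum_ord.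
by apply: pt_iota; apply: pt_sizes; apply: pt_all_nbrs.
Qed.

Lemma pt_enum_lines : poly_time c (fun x => code (enum 'I_(nl (J x)))).
Proof.
apply: (@pt_ext _ _ (fun x => code (iota 0 (size [seq line l | l <- enum 'I_(nl (J x))])))).
  by move=> x; rewrite size_map size_enum_ord code_enum_ord.
by apply: pt_iota; apply: pt_sizes; apply: pt_all_lines.
Qed.

(** A lookup in a table that is part of the input, the vertex number being the index. *)
Lemma pt_nbrs (u : forall x, 'I_(nv (J x))) :
  poly_time c (fun x => code (u x)) -> poly_time c (fun x => code (nbrs (u x))).
Proof.
move=> cu; apply: (@pt_ext _ _ (fun x => code
  (nth [::] [seq nbrs u | u <- enum 'I_(nv (J x))] (u x : nat)))) => [x|].
  by rewrite (nth_map (u x)) ?size_enum_ord// nth_ord_enum.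
by apply: pt_nth => //; [exact: pt_nil|exact: pt_all_nbrs].
Qed.

Lemma pt_line (l : forall x, 'I_(nl (J x))) :
  poly_time c (fun x => code (l x)) -> poly_time c (fun x => code (line (l x))).
Proof.
move=> cl; apply: (@pt_ext _ _ (fun x => code
  (nth [::] [seq line l | l <- enum 'I_(nl (J x))] (l x : nat)))) => [x|].
  by rewrite (nth_map (l x)) ?size_enum_ord// nth_ord_enum.
by apply: pt_nth => //; [exact: pt_nil|exact: pt_all_lines].
Qed.
End Instance.

Ltac pt_inst tac :=
  pt_with ltac:(idtac; lazymatch goal with
  | |- poly_time _ (fun x => code (nbrs _)) => apply: pt_nbrs
  | |- poly_time _ (fun x => code (line _)) => apply: pt_line
  | |- poly_time _ (fun x => code (enum_mem _)) =>
      first [apply: pt_enum_vertices | apply: pt_enum_lines]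
  | |- poly_time _ (fun x => code (Some _)) => apply: pt_some
  | |- _ => tac
  end).

Section Orientation.
Variables (X : Type) (c : X -> tree) (J : X -> instance).
Hypothesis cJ : poly_time c (fun x => code_instance (J x)).

Lemma pt_dart_seq : poly_time c (fun x => code (dart_seq (J x))).
Proof. by rewrite /dart_seq; pt_inst fail. Qed.

Lemma pt_links : poly_time c (fun x => code (links (J x))).
Proof. by rewrite /links /line_links /swap; pt_inst fail. Qed.

Lemma pt_rank (d : forall x, ('I_(nv (J x)) * 'I_(nv (J x)))%type) :
  poly_time c (fun x => code (d x)) -> poly_time c (fun x => code (rank (d x))).
Proof.
move=> cd; rewrite /rank; apply: pt_find; first exact: pt_dart_seq.
apply: (pt_mem (A := fun p : {x & ('I_(nv (J x)) * 'I_(nv (J x)))%type} =>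
  ('I_(nv (J (tag p))) * 'I_(nv (J (tag p))))%type)); first exact: pt_tagged.
have cr : poly_time c (fun x => code (reach (links (J x)) (d x))).
  exact: (pt_reach (T := fun x => ('I_(nv (J x)) * 'I_(nv (J x)))%type) cd pt_links).
exact: (pt_tag cr).
Qed.

Lemma pt_forward (d : forall x, ('I_(nv (J x)) * 'I_(nv (J x)))%type) :
  poly_time c (fun x => code (d x)) -> poly_time c (fun x => code (forward (d x))).
Proof.
move=> cd; rewrite /forward; apply: pt_leq; last by apply: pt_rank; rewrite /swap; pt.
by apply: pt_succn; apply: pt_rank.
Qed.
End Orientation.

Lemma pt_orient X (c : X -> tree) (J : X -> instance) (l : forall x, 'I_(nl (J x))) :
  poly_time c (fun x => code_instance (J x)) -> poly_time c (fun x => code (l x)) ->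
  poly_time c (fun x => code (orient (l x))).
Proof.
move=> cJ cl; rewrite /orient; pt_inst fail.
by apply: pt_forward; pt.
Qed.

Section Lexicographic.
Variables (X : Type) (c : X -> tree).

(** Recursion on two lists at once is replaced by a search for the position at which they first
    differ or the first list stops. *)
Lemma lexltE s t : lexlt s t =
  has (fun i => [&& take i s == take i t, i < size t
                  & (size s <= i) || (nth 0 s i < nth 0 t i)]) (iota 0 (size t)).
Proof.
elim: s t => [|m s IH] [|n t] //=; rewrite -[iota 1 _]/(iota (1 + 0) _) iotaDl has_map.
case: eqP => [->|ne]; last first.
  rewrite (_ : has _ _ = false) ?orbF//; apply/negbTE/hasPn => i _ /=.
  by rewrite eqseq_cons; case: eqP ne.
rewrite ltnn /= IH; apply: eq_has => i /=.
by rewrite eqseq_cons eqxx ltnS.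
Qed.

Lemma pt_lexlt (s t : X -> seq nat) :
  poly_time c (fun x => code (s x)) -> poly_time c (fun x => code (t x)) ->
  poly_time c (fun x => code (lexlt (s x) (t x))).
Proof.
move=> cs ct; apply: (@pt_ext _ _ (fun x => code
  (has (fun i => [&& take i (s x) == take i (t x), i < size (t x)
     & (size (s x) <= i) || (nth 0 (s x) i < nth 0 (t x) i)]) (iota 0 (size (t x)))))) => [x|].
  by rewrite lexltE.
by pt.
Qed.
End Lexicographic.

Lemma pt_pos X (c : X -> tree) (J : X -> instance) (u v w : forall x, 'I_(nv (J x))) :
  poly_time c (fun x => code_instance (J x)) -> poly_time c (fun x => code (u x)) ->
  poly_time c (fun x => code (v x)) -> poly_time c (fun x => code (w x)) ->
  poly_time c (fun x => code (pos (u x) (v x) (w x))).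
Proof. by move=> cJ cu cv cw; rewrite /pos; pt_inst fail. Qed.

(** A single entry of [keys], computed from the walk still ahead together with the vertex it comes
    from; this makes [keys] a [map] over suffixes. [d] is only a default for [head]. *)
Definition key_of (G : plane_graph) (d : 'I_(nv G)) (b : bool) (s : seq 'I_(nv G)) : nat :=
  let t := behead s in
  if nilp (behead t) then (if b then size (nbrs (head d t)) else 0)
  else pos (head d t) (head d s) (head d (behead t)).

Lemma keysE (G : plane_graph) (d : 'I_(nv G)) b v s :
  keys b v s = [seq key_of d b (drop i (v :: s)) | i <- iota 0 (size s)].
Proof.
elim: s v => //= u s IH v; rewrite IH; congr (_ :: _); last first.
  by rewrite -[iota 1 _]/(iota (1 + 0) _) iotaDl -map_comp.
by rewrite /key_of /=; case: s {IH}.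
Qed.

Lemma pt_keys X (c : X -> tree) (J : X -> instance) (b : X -> bool)
    (v : forall x, 'I_(nv (J x))) (s : forall x, seq 'I_(nv (J x))) :
  poly_time c (fun x => code_instance (J x)) -> poly_time c (fun x => code (b x)) ->
  poly_time c (fun x => code (v x)) -> poly_time c (fun x => code (s x)) ->
  poly_time c (fun x => code (keys (b x) (v x) (s x))).
Proof.
move=> cJ cb cv cs; apply: (@pt_ext _ _ (fun x => code
  [seq key_of (v x) (b x) (drop i (v x :: s x)) | i <- iota 0 (size (s x))])) => [x|].
  by rewrite -keysE.
rewrite /key_of; pt_inst fail.
by apply: (pt_pos (J := fun p => J (tag p))); pt.
Qed.

Ltac pt_dir tac :=
  pt_inst ltac:(idtac; lazymatch goal with
  | |- poly_time _ (fun x => code (orient _)) => apply: pt_orient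
  | |- poly_time _ (fun x => code (lexlt _ _)) => apply: pt_lexlt
  | |- poly_time _ (fun x => code (keys _ _ _)) => apply: pt_keys
  | |- _ => tac
  end).

Section Arms.
Variables (X : Type) (c : X -> tree) (J : X -> instance).
Variables (l : forall x, 'I_(nl (J x))) (u v : forall x, 'I_(nv (J x))).
Hypotheses (cJ : poly_time c (fun x => code_instance (J x)))
  (cl : poly_time c (fun x => code (l x))) (cu : poly_time c (fun x => code (u x)))
  (cv : poly_time c (fun x => code (v x))).

Lemma pt_traverses : poly_time c (fun x => code (traverses (@orient (J x)) (l x) (u x) (v x))).
Proof. by rewrite /traverses; pt_dir fail. Qed.

Lemma pt_bwd : poly_time c (fun x => code (bwd_path (@orient (J x)) (l x) (u x))).
Proof. by rewrite /bwd_path; pt_dir fail. Qed.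

Lemma pt_fwd : poly_time c (fun x => code (fwd_path (@orient (J x)) (l x) (u x))).
Proof. by rewrite /fwd_path; pt_dir fail. Qed.
End Arms.

Ltac pt_arm tac :=
  pt_dir ltac:(idtac; lazymatch goal with
  | |- poly_time _ (fun x => code (traverses _ _ _ _)) => apply: pt_traverses
  | |- poly_time _ (fun x => code (bwd_path _ _ _)) => apply: pt_bwd
  | |- poly_time _ (fun x => code (fwd_path _ _ _)) => apply: pt_fwd
  | |- _ => tac
  end).

Lemma pt_item_under X (c : X -> tree) (J : X -> instance)
    (s1 e1 s2 e2 : X -> bool) (l1 l2 : forall x, 'I_(nl (J x)))
    (d : forall x, ('I_(nv (J x)) * 'I_(nv (J x)))%type) :
  poly_time c (fun x => code_instance (J x)) ->
  poly_time c (fun x => code (s1 x)) -> poly_time c (fun x => code (e1 x)) ->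
  poly_time c (fun x => code (s2 x)) -> poly_time c (fun x => code (e2 x)) ->
  poly_time c (fun x => code (l1 x)) -> poly_time c (fun x => code (l2 x)) ->
  poly_time c (fun x => code (d x)) ->
  poly_time c (fun x => code
    (item_under (@orient (J x)) (s1 x) (e1 x) (s2 x) (e2 x) (l1 x) (l2 x) (d x))).
Proof. by move=> cJ ? ? ? ? ? ? ?; rewrite /item_under; pt_arm fail. Qed.

Ltac pt_item tac :=
  pt_arm ltac:(idtac; lazymatch goal with
  | |- poly_time _ (fun x => code (item_under _ _ _ _ _ _ _ _)) => apply: pt_item_under
  | |- poly_time _ (fun x => code None) => exact: pt_none
  | |- _ => tac
  end).

Lemma pt_pair_arcs X (c : X -> tree) (J : X -> instance)
    (l1 l2 : forall x, 'I_(nl (J x))) :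
  poly_time c (fun x => code_instance (J x)) ->
  poly_time c (fun x => code (l1 x)) -> poly_time c (fun x => code (l2 x)) ->
  poly_time c (fun x => code (pair_arcs (@orient (J x)) (l1 x) (l2 x))).
Proof.
by move=> cJ c1 c2; rewrite /pair_arcs /arc_tail /arc_head; pt_item fail.
Qed.

Lemma pt_cut_arcs X (c : X -> tree) (J : X -> instance) :
  poly_time c (fun x => code_instance (J x)) ->
  poly_time c (fun x => code (cut_arcs (@orient (J x)))).
Proof.
move=> cJ; rewrite /cut_arcs; pt_item fail.
by apply: (pt_pair_arcs (J := fun p => J (tag (tag p)))); pt.
Qed.

Lemma pt_min_sides X (c : X -> tree) (J : X -> instance)
    (l : forall x, 'I_(nl (J x))) (b : X -> bool) :
  poly_time c (fun x => code_instance (J x)) ->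
  poly_time c (fun x => code (l x)) -> poly_time c (fun x => code (b x)) ->
  poly_time c (fun x => code (min_sides (@orient (J x)) (l x) (b x))).
Proof.
move=> cJ cl cb; rewrite /min_sides /min_cut.
apply: (pt_mem (A := fun x => (option 'I_(nl (J x)) * bool)%type)).
  by pt_item fail.
apply: (pt_mincut (T := fun x => (option 'I_(nl (J x)) * bool)%type)).
- by pt_item fail.
- by pt_item fail.
exact: pt_cut_arcs.
Qed.

Section Before.
Variables (X : Type) (c : X -> tree) (J : X -> instance).
Variables (l l' : forall x, 'I_(nl (J x))) (u v : forall x, 'I_(nv (J x))).
Hypotheses (cJ : poly_time c (fun x => code_instance (J x)))
  (cl : poly_time c (fun x => code (l x))) (cl' : poly_time c (fun x => code (l' x)))
  (cu : poly_time c (fun x => code (u x))) (cv : poly_time c (fun x => code (v x))).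

Lemma pt_tail_before : poly_time c (fun x => code
  (tail_before (@orient (J x)) (min_sides (@orient (J x))) (u x) (v x) (l x) (l' x))).
Proof.
rewrite /tail_before /lex2 /bwd_keys /fwd_keys /=; pt_item fail.
all: by apply: pt_min_sides; pt.
Qed.

Lemma pt_head_before : poly_time c (fun x => code
  (head_before (@orient (J x)) (min_sides (@orient (J x))) (u x) (v x) (l x) (l' x))).
Proof.
rewrite /head_before /lex2 /bwd_keys /fwd_keys /=; pt_item fail.
all: by apply: pt_min_sides; pt.
Qed.
End Before.

Lemma pt_isort X (c : X -> tree) (A : X -> eqType) {cA : forall x, Code (A x)}
    (r : forall x, rel (A x)) (s : forall x, seq (A x)) :
  poly_time c (fun x => code (s x)) ->
  poly_time (ext (Z := fun x => (A x * A x)%type) c)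
    (fun p => code (r (tag p) (tagged p).1 (tagged p).2)) ->
  poly_time c (fun x => code (isort (r x) (s x))).
Proof.
move=> cs cr; have [k Hk] := pt_size cs; rewrite /isort.
have cr' : poly_time (ext (Z := fun p => A (tag p)) (ext (Z := fun x => (seq (A x) * A x)%type) c))
    (fun p => code (r (tag (tag p)) (tagged p) (tagged (tag p)).2)).
  pose g (p : {p : {x & (seq (A x) * A x)%type} & A (tag p)}) : {x & (A x * A x)%type} :=
    Tagged (fun x => (A x * A x)%type) (tagged p, (tagged (tag p)).2).
  apply: pt_trans (pt_reindex g cr); apply: pt_pair.
    exact: (pt_tag (pt_tag (pt_refl c))).
  apply: pt_mkpair; first exact: pt_tagged.
  exact: (pt_tag (pt_snd_of (pt_tagged _))).
apply: (pt_foldr (A := fun x => seq (A x)) (B := A) (a := fun=> [::])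
  (f := fun x z t => [seq y <- t | r x y z] ++ z :: [seq y <- t | ~~ r x y z])).
- by [].
- by pt.
- by pt.
exists (fun n => (n + k) ^ k) => [|x s1 s2 E]; first exact: poly_exp.
rewrite -/(isort (r x) s2) (tsize_code_perm (isort_perm (r x) s2)).
by apply: leq_trans (Hk x); rewrite E tsize_code_suffix.
Qed.

Lemma pt_sorted_layout X (c : X -> tree) (J : X -> instance)
    (u v : forall x, 'I_(nv (J x))) :
  poly_time c (fun x => code_instance (J x)) ->
  poly_time c (fun x => code (u x)) -> poly_time c (fun x => code (v x)) ->
  poly_time c (fun x => code
    (sorted_layout (@orient (J x)) (min_sides (@orient (J x))) (u x) (v x))).
Proof.
move=> cJ cu cv; rewrite /sorted_layout; apply: pt_if; first by pt_item fail.
  apply: (pt_isort (A := fun x => 'I_(nl (J x)))); first by pt_item fail.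
  by apply: (pt_tail_before (J := fun p => J (tag p))); pt.
apply: (pt_isort (A := fun x => 'I_(nl (J x)))); first by pt_item fail.
by apply: (pt_head_before (J := fun p => J (tag p))); pt.
Qed.

Lemma pt_solution : poly_time code_instance
  (fun I => code_layout (sorted_layout (@orient I) (min_sides (@orient I)))).
Proof.
apply: (@pt_ext _ _ (fun I => code
  [seq [seq sorted_layout (@orient I) (min_sides (@orient I)) u v | v <- nbrs u]
     | u <- enum 'I_(nv I)])) => [I|].
  rewrite code_map /code_layout; elim: (enum _) => // u s IH.
  by rewrite -![code_seq _ (u :: s)]/(Node _ (code_seq _ s)) IH code_map.
have cI : poly_time code_instance code_instance by exact: pt_refl.
pt_inst fail.
by apply: (pt_sorted_layout (J := fun p => tag (tag p))); pt.
Qed.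

Theorem theorem7 :
  solvable_in_poly_time code_instance code_layout
    (fun I => proper_instance I /\ consistently_directable I)
    (fun I pi => MLCM_P_solution pi).
Proof.
have [p [k H]] := pt_solution.
(* Building the initial pair costs about [2 * n], [p] runs with a stack of size 1, and extracting
   the output costs about twice its size. *)
have [m Hm] : poly_bounded (fun n => 2 * n + (n + 1 + k) ^ k + 2 * (n + k) ^ k + 9).
  apply: poly_add (poly_const _); apply: poly_add; last first.
    exact: poly_mul (poly_const _) (poly_exp _).
  apply: poly_add; first exact: poly_mul (poly_const _) poly_id.
  exact: poly_comp (poly_exp k) (poly_add poly_id (poly_const 1)).
(* The input is paired with an empty stack, which is dropped at the end. *)
exists (CSeq (CAssign 0 (ENode (EVar 0) ELeaf)) (CSeq p (CAssign 0 (EHd (EVar 0))))).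
(* As [n] is positive, [(n + m) ^ m <= m.+1 ^ m * n ^ m]; the sum serves as factor and as exponent
   at once. *)
exists (m.+1 ^ m + m) => I [prop cons].
set i := code_instance I; set s := update (fun=> Leaf) 0 i.
have s0 : s 0 = i by rewrite /s /update eqxx.
pose s1 := update s 0 (eval s (ENode (EVar 0) ELeaf)).
have s10 : s1 0 = Node i Leaf by rewrite /s1 /update eqxx /= s0.
have [s2 [t [ex s20 le_t le_h]]] := H I Leaf s1 s10.
exists (sorted_layout (@orient I) (min_sides (@orient I))).
exists ((ecost s (ENode (EVar 0) ELeaf)).+1 + (t + (ecost s2 (EHd (EVar 0))).+1).+1).+1.
split; last exact: solution_orient.
  exists (update s2 0 (eval s2 (EHd (EVar 0)))).
    by apply: ExSeq (ExAssign _ _ _) (ExSeq ex (ExAssign _ _ _)).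
  by rewrite /update eqxx /= s20.
set n := tsize i in le_t le_h *; have n0 : 0 < n by apply: tsize_gt0.
have le1 : 2 * n + (n + 1 + k) ^ k + 2 * (n + k) ^ k + 9 <= m.+1 ^ m * n ^ m.
  apply: leq_trans (Hm n) _; rewrite -expnMn.
  by have [->//|m0] := posnP m; rewrite leq_exp2r//; nia.
have le2 : m.+1 ^ m * n ^ m <= (m.+1 ^ m + m) * n ^ (m.+1 ^ m + m).
  by apply: leq_mul; [exact: leq_addr|rewrite leq_pexp2l// leq_addl].
apply: leq_trans (leq_trans _ (leq_trans le1 le2)) (leq_addr _ _).
have -> : ecost s (ENode (EVar 0) ELeaf) = 2 * n + 3.
  have -> : ecost s (ENode (EVar 0) ELeaf) =
    (tsize (s 0) + 1).+1 + (tsize (s 0) + 0 + (1 + 0)) by [].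
  by rewrite s0 -/n; lia.
have -> : ecost s2 (EHd (EVar 0)) = tsize (thd (s2 0)) + (tsize (s2 0) + 0) by [].
rewrite s20 [thd _]/= [tsize (Node _ _)]/=.
by move: le_t le_h; rewrite [tsize Leaf]/=; move: (tsize (code_layout _)) => h; lia.
Qed.
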